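(* Let $A$ be a commutative $C^*$-algebra, let $E_A$ be a countably generated Hilbert $A$-module, and let $1\le p<\infty$. The function $\|\cdot\|_p\colon T\mapsto \big\|\operatorname{tr}|T|^p\big\|_A^{1/p}$ is a norm that turns $\mathcal L^p(E_A)$ into a normed vector space. Moreover, for all $T\in\mathcal L^p(E_A)$: (1) $\|T\|_p=\sup_{\chi\in\widehat A}\|\chi_*T\|_p$; (2) $\|T^*\|_p=\|T\|_p$; (3) $\|ST\|_p\le\|S\|\,\|T\|_p$ for all $S\in\mathcal L(E_A)$; (4) $\|T\|\le\|T\|_p$; (5) for $p,q,r\ge1$ with $\frac1p+\frac1q=\frac1r$, if $S\in\mathcal L^q(E_A)$ and $T\in\mathcal L^p(E_A)$, then $ST\in\mathcal L^r(E_A)$ and $\|ST\|_r\le\|S\|_q\|T\|_p$. Moreover, $\mathcal L^p(E_A)$ is a Banach space with respect to $\|\cdot\|_p$.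
   Context: $\mathcal L(E_A)$ is the $C^*$-algebra of adjointable operators on $E_A$ with operator norm $\|\cdot\|$. $\widehat A$ is the space of characters of $A$ (weak-$*$ topology), so $A\cong C_0(\widehat A)$. For $\chi\in\widehat A$, $\chi_*E_A:=E_A\otimes_A\mathbb C$ (with $A$ acting on $\mathbb C$ via $\chi$) is the localized Hilbert space, and for $T\in\mathcal L(E_A)$, $\chi_*T:=T\otimes 1\in B(\chi_*E_A)$. On the Hilbert space $\chi_*E_A$, $\|R\|_p=(\operatorname{tr}|R|^p)^{1/p}$ is the usual Schatten norm. For $1\le p<\infty$, the $p$-th Schatten class $\mathcal L^p(E_A)$ is the set of all $T\in\mathcal L(E_A)$ for which the function $\operatorname{tr}|T|^p\colon\widehat A\to\mathbb R\cup\{\infty\}$, $\chi\mapsto\operatorname{tr}|\chi_*T|^p$, lies in $A\cong C_0(\widehat A)$; this element of $A$ is denoted $\operatorname{tr}|T|^p$. *)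

(* Defs.v *)
From HB Require Import structures.
From mathcomp Require Import all_boot all_order all_algebra.
From mathcomp Require Import complex.
From mathcomp Require Import all_classical all_reals all_analysis ring.

Set Implicit Arguments.
Unset Strict Implicit.
Unset Printing Implicit Defensive.

Import Order.TTheory GRing.Theory Num.Theory.
Import numFieldNormedType.Exports.
Local Open Scope classical_set_scope.
Local Open Scope ring_scope.

Lemma cauchyC_cvg (R : realType) (u : nat -> R[i]^o) :
  (forall e : R[i], 0 < e ->
     \forall n \near \oo, forall m, (n <= m)%N -> `|u n - u m| < e) ->
  cvgn u.
Proof.
move=> cu.
have key (h : R[i]^o -> R) : (forall z w, h (z - w) = h z - h w) ->
    (forall z, `|h z|%:C%C <= `|z|) -> cvgn (h \o u).
  move=> hB hn; apply: cauchy_cvg; apply: cauchy_exP => e e0.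
  have e0' : 0 < e%:C%C :> R[i] by rewrite ltcR.
  have [N _ /(_ N (leqnn N)) HN] := cu _ e0'.
  exists (h (u N)); exists N => // n /= Nn.
  rewrite /ball /= -hB -ltcR; exact: le_lt_trans (hn _) (HN _ Nn).
have /cvg_ex[/= a ua] : cvgn (@complex.Re R \o u).
  by apply: key => [[? ?] [? ?]|z] //; exact: normc_ge_Re.
have /cvg_ex[/= b ub] : cvgn (@complex.Im R \o u).
  apply: key => [[? ?] [? ?]|z] //.
  by rewrite normc_def lecR -sqrtr_sqr ler_wsqrtr// lerDr sqr_ge0.
apply/cvg_ex; exists (Complex a b : R[i]^o).
apply/cvgrPdist_lt => e e0.
have [f f0 ef] : exists2 f : R, 0 < f & e = f%:C%C.
  by move: e0; case: e => x y; rewrite ltcE /= => /andP[/eqP -> ?]; exists x.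
have f20 : 0 < f / 2 by rewrite divr_gt0.
move/cvgrPdist_lt : ua => /(_ _ f20) ua.
move/cvgrPdist_lt : ub => /(_ _ f20) ub.
near=> n.
have : `|a - complex.Re (u n)| < f / 2 by near: n.
have : `|b - complex.Im (u n)| < f / 2 by near: n.
rewrite ef; case: (u n) => x y /= hb ha.
have -> : Complex a b - Complex x y = (a - x)%:C%C + 'i%C * (b - y)%:C%C.
  by rewrite [LHS]complexE.
have nr (z : R) : `|z%:C%C| = `|z|%:C%C :> R[i].
  by rewrite normc_def /= expr0n addr0 sqrtr_sqr.
apply: (le_lt_trans (ler_normD _ _)).
have -> : `|'i%C * (b - y)%:C%C| = `|(b - y)%:C%C| :> R[i].
  rewrite !normc_def /= ?mul0r ?mul1r ?mulr0 ?subr0 ?oppr0 ?addr0 ?add0r ?subrr. by rewrite addrC.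
rewrite !nr.
by rewrite -rmorphD ltcR (splitr f) ltrD.
Unshelve. all: by end_near. Qed.

(* Semi-inner products are conjugate-linear in the first argument and linear
   in the second; 0 <= z in R[i] means that z is real and nonnegative. *)
Record semi_inner (R : realType) (V : lmodType R[i]) := SemiInner {
  sip :> V -> V -> R[i] ;
  sipDr : forall x y z, sip x (y + z) = sip x y + sip x z ;
  sipZr : forall (a : R[i]) x y, sip x (a *: y) = a * sip x y ;
  sipC : forall x y, sip y x = (sip x y)^* ;
  sip_ge0 : forall x, 0 <= sip x x }.

Section SemiInner.
Variables (R : realType) (V : lmodType R[i]) (s : semi_inner V).
Local Notation C := R[i].
Implicit Types (x y z : V) (a b : C).

Lemma sip0r x : s x 0 = 0.
Proof. by rewrite -(scale0r x) sipZr mul0r. Qed.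
Lemma sipNr x y : s x (- y) = - s x y.
Proof. by rewrite -scaleN1r sipZr mulN1r. Qed.
Lemma sipBr x y z : s x (y - z) = s x y - s x z.
Proof. by rewrite sipDr sipNr. Qed.
Lemma sipDl x y z : s (x + y) z = s x z + s y z.
Proof. by rewrite sipC sipDr rmorphD /= -!sipC. Qed.
Lemma sipZl a x y : s (a *: x) y = a^* * s x y.
Proof. by rewrite sipC sipZr rmorphM /= -sipC. Qed.
Lemma sipNl x y : s (- x) y = - s x y.
Proof. by rewrite sipC sipNr rmorphN /= -sipC. Qed.
Lemma sipBl x y z : s (x - y) z = s x z - s y z.
Proof. by rewrite sipDl sipNl. Qed.
Lemma sip0l x : s 0 x = 0.
Proof. by rewrite sipC sip0r rmorph0. Qed.

Lemma sip_subE x y : s (x - y) (x - y) = s x x - s y x - (s x y - s y y).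
Proof. by rewrite sipBr !sipBl. Qed.

Definition sip_norm x : C := sqrtC (s x x).

Lemma sip_norm_ge0 x : 0 <= sip_norm x. Proof. by rewrite sqrtC_ge0 sip_ge0. Qed.
Lemma sip_normK x : sip_norm x ^+ 2 = s x x. Proof. exact: sqrtCK. Qed.
Lemma sip_norm0 : sip_norm 0 = 0. Proof. by rewrite /sip_norm sip0r sqrtC0. Qed.

Lemma sip_normZ a x : sip_norm (a *: x) = `|a| * sip_norm x.
Proof.
apply/eqP; rewrite -(eqrXn2 (n := 2)) ?sip_norm_ge0 ?mulr_ge0 ?sip_norm_ge0 //.
by rewrite exprMn !sip_normK normCK sipZr sipZl mulrA.
Qed.
Lemma sip_normN x : sip_norm (- x) = sip_norm x.
Proof. by rewrite -scaleN1r sip_normZ normrN normr1 mul1r. Qed.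
Lemma sip_normB x y : sip_norm (x - y) = sip_norm (y - x).
Proof. by rewrite -sip_normN opprB. Qed.

Lemma sip_cs x y : `|s x y| <= sip_norm x * sip_norm y.
Proof.
have mn u v : `|s u v| ^+ 2 = s u v * s v u by rewrite normCK -sipC.
have key u v : 0 <= s v v * (s u u * s v v - `|s u v| ^+ 2).
  have := sip_ge0 s (s v v *: u - s v u *: v).
  rewrite sipBr !sipBl !sipZr !sipZl mn -!sipC.
  set a := s u u; set b := s v v; set c := s u v; set d := s v u.
  by congr (0 <= _); ring.
have n0 u v : 0 <= s u u * s v v - `|s u v| ^+ 2 \/ s v v = 0.
  have := sip_ge0 s v; rewrite le_eqVlt => /predU1P[<-|v0]; first by right.
  by left; have := key u v; rewrite pmulr_rge0.
suff : `|s x y| ^+ 2 <= (sip_norm x * sip_norm y) ^+ 2.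
  by rewrite ler_pXn2r// nnegrE ?mulr_ge0 ?sip_norm_ge0.
rewrite exprMn !sip_normK -subr_ge0.
have [//|y0] := n0 x y.
have [|x0] := n0 y x; first by rewrite mulrC (sipC s x y) norm_conjC.
have := sip_ge0 s (x - s y x *: y).
rewrite sipBr !sipBl !sipZr !sipZl x0 y0 mn -!sipC.
set c := s x y; set d := s y x => h.
have -> : 0 * 0 - c * d = (0 - c * d - (d * c - d * (c * 0))) / 2.
  by apply: (mulIf (x := 2)); rewrite ?pnatr_eq0// divfK ?pnatr_eq0//; ring.
by rewrite divr_ge0.
Qed.

Lemma sip_normD x y : sip_norm (x + y) <= sip_norm x + sip_norm y.
Proof.
suff : sip_norm (x + y) ^+ 2 <= (sip_norm x + sip_norm y) ^+ 2.
  by rewrite ler_pXn2r// nnegrE ?addr_ge0 ?sip_norm_ge0.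
rewrite sip_normK sipDr !sipDl sqrrD !sip_normK mulr2n !addrA lerD2r -!addrA lerD2l.
have r : s y x + s x y \is Num.real.
  by rewrite CrealE rmorphD /= -!sipC addrC.
apply: (le_trans (real_ler_norm r)); apply: (le_trans (ler_normD _ _)).
by rewrite lerD ?sip_cs // mulrC sip_cs.
Qed.

Definition seq_cauchy (u : nat -> V) := forall e : C, 0 < e ->
  exists N, forall m n, (N <= m)%N -> (N <= n)%N -> sip_norm (u m - u n) < e.

Lemma seq_cauchyP (u v : nat -> V) a :
  seq_cauchy u -> seq_cauchy v -> seq_cauchy (fun n => a *: u n + v n).
Proof.
move=> cu cv e e0.
have a0 : 0 < `|a| + 1 by rewrite ltr_wpDl.
have [N HN] := cu (e / 2 / (`|a| + 1)) ltac:(by rewrite !divr_gt0).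
have [M HM] := cv (e / 2) ltac:(by rewrite divr_gt0).
exists (maxn N M) => m n; rewrite !geq_max => /andP[Nm Mm] /andP[Nn Mn].
rewrite opprD addrACA -scalerBr; apply: (le_lt_trans (sip_normD _ _)).
rewrite (splitr e) ler_ltD ?HM// sip_normZ.
apply: (@le_trans _ _ ((`|a| + 1) * (e / 2 / (`|a| + 1)))).
  by rewrite ler_pM ?sip_norm_ge0// ?lerDl// ltW ?HN.
by rewrite mulrCA divff ?mulr1// gt_eqF.
Qed.

Lemma seq_cauchyB (u v : nat -> V) :
  seq_cauchy u -> seq_cauchy v -> seq_cauchy (fun n => u n - v n).
Proof.
move=> cu cv; have := seq_cauchyP (-1) cv cu.
by congr seq_cauchy; apply/funext => n; rewrite scaleN1r addrC.
Qed.

Lemma seq_cauchy_bnd u : seq_cauchy u -> exists2 M, 0 < M & \forall n \near \oo, sip_norm (u n) <= M.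
Proof.
move=> /(_ 1 ltr01)[N HN]; exists (sip_norm (u N) + 1).
  by rewrite ltr_wpDl ?sip_norm_ge0.
exists N => // n /= Nn; rewrite -[u n](subrK (u N)) (le_trans (sip_normD _ _))//.
by rewrite addrC lerD2l ltW ?HN.
Qed.

Lemma sip_cauchy_cvg (u v : nat -> V) : seq_cauchy u -> seq_cauchy v ->
  cvgn (fun n => s (u n) (v n) : C^o).
Proof.
move=> cu cv; apply: cauchyC_cvg => e e0.
have [M M0 [N1 _ HM]] := seq_cauchy_bnd cu.
have [L L0 [N2 _ HL]] := seq_cauchy_bnd cv.
have [N3 HN3] := cu (e / 2 / L) ltac:(by rewrite !divr_gt0).
have [N4 HN4] := cv (e / 2 / M) ltac:(by rewrite !divr_gt0).
exists (maxn (maxn N1 N2) (maxn N3 N4)) => // n /=.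
rewrite !geq_max => /andP[/andP[n1 n2] /andP[n3 n4]] m nm.
have -> : s (u n) (v n) - s (u m) (v m) = s (u n - u m) (v n) + s (u m) (v n - v m).
  by rewrite sipBl sipBr addrA subrK.
apply: (le_lt_trans (ler_normD _ _)); rewrite (splitr e) ltr_leD//.
  apply: (le_lt_trans (sip_cs _ _)); rewrite -[ltRHS](@divfK _ L) ?gt_eqF//.
  apply: (@le_lt_trans _ _ (sip_norm (u n - u m) * L)).
    by rewrite ler_wpM2l ?sip_norm_ge0 ?HL.
  by rewrite ltr_pM2r// HN3// (leq_trans n3).
apply: (le_trans (sip_cs _ _)); rewrite -[leRHS](@divfK _ M) ?gt_eqF// mulrC.
apply: ler_pM; rewrite ?sip_norm_ge0 ?HM//=; first by rewrite ltW// HN4// (leq_trans n4).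
exact: leq_trans nm.
Qed.

(* A Cauchy sequence u is identified with the functional y |-> lim s(y, u_n);
   two Cauchy sequences give the same functional exactly when the seminorm of
   their difference tends to 0. *)
Definition seq_repr (u : nat -> V) (f : V -> C^o) :=
  seq_cauchy u /\ forall y, (fun n => s y (u n) : C^o) @ \oo --> (f y : C^o).

Lemma cst_cauchy x : seq_cauchy (fun=> x).
Proof. by move=> e e0; exists 0%N => *; rewrite subrr sip_norm0. Qed.

Lemma seq_repr_sip0 (u v : nat -> V) : seq_repr u (fun=> 0) -> seq_cauchy v ->
  (fun n => s (v n) (u n) : C^o) @ \oo --> (0 : C^o).
Proof.
move=> [cu u0] cv; apply/cvgrPdist_lt => e e0.
have [M M0 [N1 _ HM]] := seq_cauchy_bnd cu.
have [N2 HN2] := cv (e / 2 / M) ltac:(by rewrite !divr_gt0).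
have := u0 (v N2); move/cvgrPdist_lt => /(_ (e / 2)) [|N3 _ HN3]; first by rewrite divr_gt0.
exists (maxn N1 (maxn N2 N3)) => // n /=; rewrite !geq_max => /and3P[n1 n2 n3].
rewrite sub0r normrN -[v n](subrK (v N2)) sipDl (splitr e).
apply: (le_lt_trans (ler_normD _ _)); rewrite ler_ltD//; last first.
  by have := HN3 n n3; rewrite sub0r normrN.
apply: (le_trans (sip_cs _ _)); rewrite -[leRHS](@divfK _ M) ?gt_eqF//.
by apply: ler_pM; rewrite ?sip_norm_ge0 ?HM// ltW// HN2.
Qed.

Lemma seq_reprB u v f : seq_repr u f -> seq_repr v f ->
  seq_repr (fun n => u n - v n) (fun=> 0).
Proof.
move=> [cu uf] [cv vf]; split; first exact: seq_cauchyB.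
move=> y; rewrite -[X in _ --> X](subrr (f y)).
by under eq_fun do rewrite sipBr; apply: cvgB.
Qed.

Definition completion_pred : {pred V -> C^o} :=
  fun f => `[< exists u, seq_repr u f >].

Lemma completion_submod : submod_closed completion_pred.
Proof.
split.
  apply/asboolP; exists (fun=> 0); split; first exact: cst_cauchy.
  by move=> y; under eq_fun do rewrite sip0r; exact: cvg_cst.
move=> a f g /asboolP[u [cu uf]] /asboolP[v [cv vg]]; apply/asboolP.
exists (fun n => a *: u n + v n); split; first exact: seq_cauchyP.
move=> y.
have -> : (fun n => s y (a *: u n + v n) : C^o) =
    (fun n => a *: (s y (u n) : C^o) + (s y (v n) : C^o)).
  by apply/funext => n; rewrite sipDr sipZr.
by apply: cvgD (vg y); apply: cvgZl_tmp; exact: uf.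
Qed.

End SemiInner.

HB.instance Definition _ (R : realType) (V : lmodType R[i])
    (s : semi_inner V) :=
  GRing.isSubmodClosed.Build R[i] (V -> R[i]^o) (completion_pred s)
    (completion_submod s).

(* The Hausdorff completion of (V, s), as a space of functionals on V. *)
Record completion (R : realType) (V : lmodType R[i]) (s : semi_inner V) :=
  Completion { cval :> V -> R[i]^o ; cvalP : cval \in completion_pred s }.

HB.instance Definition _ (R : realType) (V : lmodType R[i])
  (s : semi_inner V) := [isSub for @cval R V s].
HB.instance Definition _ (R : realType) (V : lmodType R[i])
  (s : semi_inner V) := [Choice of completion s by <:].
HB.instance Definition _ (R : realType) (V : lmodType R[i])
  (s : semi_inner V) := [SubChoice_isSubLmodule of completion s by <:].

Section CompletionDot.
Variables (R : realType) (V : lmodType R[i]) (s : semi_inner V).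
Local Notation C := R[i].
Local Notation H := (completion s).
Implicit Types (f g h : H) (x y : V).

Lemma completion_exrepr f : exists u, seq_repr s u f.
Proof. exact/asboolP/(cvalP f). Qed.

Definition cauchy_rep f : nat -> V := sval (cid (completion_exrepr f)).
Lemma cauchy_repP f : seq_repr s (cauchy_rep f) f.
Proof. exact: svalP (cid (completion_exrepr f)). Qed.

Definition completion_dot f g : C :=
  limn (fun n => s (cauchy_rep f n) (cauchy_rep g n) : C^o).

Lemma completion_dotP u v f g : seq_repr s u f -> seq_repr s v g ->
  (fun n => s (u n) (v n) : C^o) @ \oo --> (completion_dot f g : C^o).
Proof.
move=> uf vg; have [wf tg] := (cauchy_repP f, cauchy_repP g).
have wt := sip_cauchy_cvg wf.1 tg.1.
have h1 := seq_repr_sip0 (seq_reprB vg tg) uf.1.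
have h2 := seq_repr_sip0 (seq_reprB uf wf) tg.1.
have h3 : (fun n => s (u n - cauchy_rep f n) (cauchy_rep g n) : C^o) @ \oo --> (0 : C^o).
  move: h2 => /cvgrPdist_lt h2; apply/cvgrPdist_lt => e /h2.
  by apply: filterS => n; rewrite !sub0r !normrN (sipC s) norm_conjC.
rewrite -[X in _ --> X]add0r -[X in _ --> X]add0r.
have -> : (fun n => s (u n) (v n) : C^o) = (fun n =>
   s (u n) (v n - cauchy_rep g n) + (s (u n - cauchy_rep f n) (cauchy_rep g n)
    + s (cauchy_rep f n) (cauchy_rep g n)) : C^o).
  by apply/funext => n; rewrite sipBr sipBl !subrK.
by apply: cvgD h1 _; apply: cvgD h3 wt.
Qed.

Lemma limC_unique (u : nat -> C^o) (a b : C^o) :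
  u @ \oo --> a -> u @ \oo --> b -> a = b.
Proof. exact: (@cvg_unique _ (@norm_hausdorff _ C^o)). Qed.

Lemma cauchy_repE u f : seq_repr s u f -> forall v g, seq_repr s v g ->
  forall l : C, (fun n => s (u n) (v n) : C^o) @ \oo --> (l : C^o) ->
  completion_dot f g = l.
Proof. by move=> uf v g vg l; apply: limC_unique; exact: completion_dotP. Qed.

Lemma seq_reprD u v f g : seq_repr s u f -> seq_repr s v g ->
  seq_repr s (fun n => u n + v n) (f + g : H).
Proof.
move=> [cu uf] [cv vg]; split.
  have := seq_cauchyP 1 cu cv.
  by congr seq_cauchy; apply/funext => n; rewrite scale1r.
by move=> y; under eq_fun do rewrite sipDr; apply: cvgD.
Qed.

Lemma seq_reprZ (a : C) u f : seq_repr s u f ->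
  seq_repr s (fun n => a *: u n) (a *: f : H).
Proof.
move=> [cu uf]; split.
  have := seq_cauchyP a cu (cst_cauchy s 0).
  by congr seq_cauchy; apply/funext => n; rewrite addr0.
move=> y.
have -> : (fun n => s y (a *: u n) : C^o) = a \*: (fun n => s y (u n) : C^o).
  by apply/funext => n; rewrite sipZr.
have := @cvgZl_tmp _ C^o _ _ _ a _ _ (uf y); exact.
Qed.

Lemma completion_dotDr f g h :
  completion_dot f (g + h) = completion_dot f g + completion_dot f h.
Proof.
have [[F G] K] := (cauchy_repP f, cauchy_repP g, cauchy_repP h).
apply: (cauchy_repE F (seq_reprD G K)).
under eq_fun do rewrite sipDr.
by apply: cvgD; apply: completion_dotP.
Qed.

Lemma completion_dotZr a f g : completion_dot f (a *: g) = a * completion_dot f g.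
Proof.
have [F G] := (cauchy_repP f, cauchy_repP g).
apply: (cauchy_repE F (seq_reprZ a G)).
have -> : (fun n => s (cauchy_rep f n) (a *: cauchy_rep g n) : C^o) =
    a \*: (fun n => s (cauchy_rep f n) (cauchy_rep g n) : C^o).
  by apply/funext => n; rewrite sipZr.
exact: (@cvgZl_tmp _ C^o _ _ _ a _ _ (completion_dotP F G)).
Qed.

Lemma dist_conj (a b : C) : `|a^* - b^*| = `|a - b|.
Proof. by rewrite -rmorphB norm_conjC. Qed.

Lemma completion_dotC f g : completion_dot g f = (completion_dot f g)^*.
Proof.
have [F G] := (cauchy_repP f, cauchy_repP g).
apply: (cauchy_repE G F).
have /cvgrPdist_lt h := completion_dotP F G; apply/cvgrPdist_lt => e /h.
apply: filterS => n h'.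
by rewrite (sipC s (cauchy_rep f n)) (dist_conj (completion_dot f g)).
Qed.

Lemma completion_dot_ge0 f : 0 <= completion_dot f f.
Proof.
have F := cauchy_repP f; have /cvgrPdist_lt h := completion_dotP F F.
rewrite ger0_def -subr_eq0 -normr_eq0; apply: contraT => ne0.
set l := completion_dot f f in h ne0 *.
have d0 : 0 < `| `|l| - l| by rewrite lt_def ne0 normr_ge0.
have /h[N _ /(_ N (leqnn N)) /=] : 0 < `| `|l| - l| / 2 by rewrite divr_gt0.
set t := s _ _ => ht; have t0 : 0 <= t by exact: sip_ge0.
have hd : `| `|l| - l| <= `|l - t| + `|l - t|.
  rewrite -[`|l| - l](subrKA t); apply: (le_trans (ler_normD _ _)).
  rewrite lerD//; last by rewrite distrC.
  by rewrite -{1}(ger0_norm t0) ler_dist_dist.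
by have := le_lt_trans hd (ltrD ht ht); rewrite -splitr ltxx.
Qed.

Definition completion_sip : semi_inner H :=
  SemiInner completion_dotDr completion_dotZr completion_dotC completion_dot_ge0.

Lemma const_repr x : completion_pred s (s^~ x).
Proof.
apply/asboolP; exists (fun=> x); split; first exact: cst_cauchy.
by move=> y; exact: cvg_cst.
Qed.

(* The canonical map from V to its completion. *)
Definition completion_in x : H := Completion (const_repr x).

Lemma completion_in_repr x : seq_repr s (fun=> x) (completion_in x).
Proof. by split; [exact: cst_cauchy|move=> y; exact: cvg_cst]. Qed.

Lemma completion_dot_in x f : completion_dot (completion_in x) f = f x.
Proof.
have F := cauchy_repP f.
by apply: (cauchy_repE (completion_in_repr x) F); exact: F.2.
Qed.

Lemma completion_norm_eq0 f : sip_norm completion_sip f = 0 -> f = 0.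
Proof.
move=> f0; apply/val_inj/funext => x /=; apply/eqP.
rewrite -completion_dot_in -normr_le0.
by have := sip_cs completion_sip (completion_in x) f; rewrite f0 mulr0.
Qed.

End CompletionDot.

HB.instance Definition _ (R : realType) (V : lmodType R[i])
    (s : semi_inner V) :=
  Lmodule_isNormed.Build R[i] (completion s)
    (sip_normD (completion_sip s)) (sip_normZ (completion_sip s))
    (@completion_norm_eq0 R V s).

Section CompletionComplete.
Variables (R : realType) (V : lmodType R[i]) (s : semi_inner V).
Local Notation C := R[i].
Local Notation H := (completion s).

Lemma completion_inB (x y : V) :
  `|completion_in s x - completion_in s y| = sip_norm s (x - y).
Proof.
rewrite /Num.norm /= /sip_norm sip_subE; congr sqrtC.
apply: etrans (sip_subE (completion_sip s) _ _) _.
by rewrite /= !completion_dot_in.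
Qed.

Lemma seq_repr_approx u (f : H) : seq_repr s u f -> forall e : C, 0 < e ->
  exists N, forall n, (N <= n)%N -> `|f - completion_in s (u n)| < e.
Proof.
move=> uf e e0; have e20 : 0 < e / 2 by rewrite divr_gt0.
have [N HN] := uf.1 _ e20; exists N => n Nn.
suff : `|f - completion_in s (u n)| ^+ 2 < e ^+ 2.
  by rewrite ltr_pXn2r// nnegrE// ltW.
have rep : seq_repr s (fun m => u m - u n) (f - completion_in s (u n) : H).
  have -> : (f - completion_in s (u n) : H) = f + (-1) *: completion_in s (u n).
    by rewrite scaleN1r.
  have -> : (fun m => u m - u n) = (fun m => u m + (-1) *: u n).
    by apply/funext => m; rewrite scaleN1r.
  by apply: seq_reprD uf _; apply: seq_reprZ; exact: completion_in_repr.
have := completion_dotP rep rep.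
set g := f - _ => /cvgrPdist_lt /(_ ((e / 2) ^+ 2)).
rewrite exprn_gt0// => /(_ isT)[M _ HM].
have /HM /= hm := leq_maxr N M.
have -> : `|g| ^+ 2 = completion_dot g g by rewrite /Num.norm/=; exact: sip_normK.
set t := s _ _ in hm.
have ht : t < (e / 2) ^+ 2.
  rewrite /t -sip_normK ltr_pXn2r ?nnegrE ?sip_norm_ge0 1?ltW//.
  by rewrite HN// leq_maxl.
have t0 : 0 <= t by exact: sip_ge0.
rewrite -(ger0_norm (completion_dot_ge0 g)) -[completion_dot g g](subrK t).
apply: (le_lt_trans (ler_normD _ _)); rewrite (ger0_norm t0).
apply: (lt_le_trans (ltrD hm ht)).
have -> : e ^+ 2 = ((e / 2) ^+ 2 + (e / 2) ^+ 2) + ((e / 2) ^+ 2 + (e / 2) ^+ 2).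
  by field.
by rewrite lerDl addr_ge0// exprn_ge0// ltW.
Qed.

Lemma natSinv_ltC (e : C) : 0 < e -> exists N, forall n, (N <= n)%N ->
  n.+1%:R^-1 < e.
Proof.
case: e => x y; rewrite ltcE /= => /andP[/eqP -> x0].
have [N _ HN] := near_infty_natSinv_lt (PosNum x0).
exists N => n /HN /=; rewrite -ltcR; congr (_ < _).
by rewrite fmorphV rmorph_nat.
Qed.

Lemma completion_complete (F : set_system H) :
  ProperFilter F -> cauchy F -> cvg F.
Proof.
move=> FF /cauchyP cF.
have /choice[y Hy] (k : nat) : exists x,
    F (ball (completion_in s x) (k.+1%:R^-1 : C)).
  have e0 : 0 < (k.+1%:R^-1 / 2 : C) by rewrite divr_gt0.
  have [f Ff] := cF _ e0.
  have [N /(_ N (leqnn N)) HN] := seq_repr_approx (cauchy_repP f) e0.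
  exists (cauchy_rep f N); apply: filterS Ff => g fg.
  by apply: ball_splitr fg; rewrite -ball_normE.
have yB k l : sip_norm s (y k - y l) < k.+1%:R^-1 + l.+1%:R^-1.
  rewrite -completion_inB.
  have [g []] := filter_ex (filterI (Hy k) (Hy l)).
  rewrite -!ball_normE /= => gk gl.
  rewrite -[X in `|X|](subrKA g); apply: (le_lt_trans (ler_normD _ _)).
  by apply: ltrD; [exact: gk|rewrite distrC; exact: gl].
have cy : seq_cauchy s y.
  move=> e e0; have [N HN] := natSinv_ltC (divr_gt0 e0 (ltr0Sn _ 1)).
  exists N => m n Nm Nn; apply: (lt_trans (yB m n)).
  by rewrite (splitr e) ltrD// HN.
have repg : seq_repr s y (fun z => limn (fun n => s z (y n) : C^o)).
  by split=> // z; apply: sip_cauchy_cvg => //; exact: cst_cauchy.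
have fP : completion_pred s (fun z => limn (fun n => s z (y n) : C^o)).
  by apply/asboolP; exists y.
apply/cvg_ex; exists (Completion fP).
apply/cvg_ballP => e e0; have e20 := divr_gt0 e0 (ltr0Sn C 1).
have [N HN] := natSinv_ltC e20.
have [M HM] := @seq_repr_approx y (Completion fP) repg _ e20.
pose k := maxn N M.
apply: filterS (Hy k) => g; rewrite -!ball_normE /= => gk.
rewrite -[X in `|X|](subrKA (completion_in s (y k))).
apply: (le_lt_trans (ler_normD _ _)); rewrite (splitr e); apply: ltrD.
  by apply: HM; exact: leq_maxr.
by apply: (lt_trans gk); apply: HN; exact: leq_maxl.
Qed.

End CompletionComplete.

HB.instance Definition _ (R : realType) (V : lmodType R[i])
    (s : semi_inner V) :=
  Uniform_isComplete.Build (completion s) (@completion_complete R V s).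

HB.mixin Record CompleteNormedModule_isHilbert (R : realType) H
    of CompleteNormedModule R[i] H := {
  dot : H -> H -> R[i] ;
  dotDr : forall x y z, dot x (y + z) = dot x y + dot x z ;
  dotZr : forall a x y, dot x (a *: y) = a * dot x y ;
  dotC : forall x y, dot y x = (dot x y)^* ;
  dot_norm : forall x, dot x x = `|x| ^+ 2 }.

#[short(type="hilbertType")]
HB.structure Definition Hilbert (R : realType) :=
  { H of CompleteNormedModule R[i] H & CompleteNormedModule_isHilbert R H }.

Lemma completion_dot_norm (R : realType) (V : lmodType R[i])
  (s : semi_inner V) (f : completion s) : completion_dot f f = `|f| ^+ 2.
Proof. by rewrite /Num.norm /=; exact/esym/(sip_normK (completion_sip s)). Qed.

HB.instance Definition _ (R : realType) (V : lmodType R[i])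
    (s : semi_inner V) :=
  CompleteNormedModule_isHilbert.Build R (completion s)
    (@completion_dotDr R V s) (@completion_dotZr R V s)
    (@completion_dotC R V s) (@completion_dot_norm R V s).

(* Commutative C*-algebras; no unit is required, and A = 0 is allowed. *)
HB.mixin Record CompleteNormedModule_isCommCStar (R : realType) A
    of CompleteNormedModule R[i] A := {
  cmul : A -> A -> A ;
  cstar : A -> A ;
  cmulA : forall a b c, cmul a (cmul b c) = cmul (cmul a b) c ;
  cmulC : forall a b, cmul a b = cmul b a ;
  cmulDl : forall a b c, cmul (a + b) c = cmul a c + cmul b c ;
  cmulZl : forall (k : R[i]) a b, cmul (k *: a) b = k *: cmul a b ;
  cmul_norm : forall a b, `|cmul a b| <= `|a| * `|b| ;
  cstarK : forall a, cstar (cstar a) = a ;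
  cstarD : forall a b, cstar (a + b) = cstar a + cstar b ;
  cstarZ : forall (k : R[i]) a, cstar (k *: a) = k^* *: cstar a ;
  cstarM : forall a b, cstar (cmul a b) = cmul (cstar b) (cstar a) ;
  cstar_norm : forall a, `|cmul (cstar a) a| = `|a| ^+ 2 }.

#[short(type="commCStarType")]
HB.structure Definition CommCStar (R : realType) :=
  { A of CompleteNormedModule R[i] A & CompleteNormedModule_isCommCStar R A }.

(* Right Hilbert A-modules, with the inner product linear in its second
   argument; positivity in A means being of the form b^* b. *)
HB.mixin Record CompleteNormedModule_isHilbertModule (R : realType)
    (A : commCStarType R) E of CompleteNormedModule R[i] E := {
  act : E -> A -> E ;
  actDl : forall x y a, act (x + y) a = act x a + act y a ;
  actDr : forall x a b, act x (a + b) = act x a + act x b ;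
  actZl : forall (k : R[i]) x a, act (k *: x) a = k *: act x a ;
  actZr : forall (k : R[i]) x a, act x (k *: a) = k *: act x a ;
  actM : forall x a b, act x (cmul a b) = act (act x a) b ;
  inner : E -> E -> A ;
  innerDr : forall x y z, inner x (y + z) = inner x y + inner x z ;
  innerZr : forall (k : R[i]) x y, inner x (k *: y) = k *: inner x y ;
  inner_act : forall x y a, inner x (act y a) = cmul (inner x y) a ;
  innerC : forall x y, inner y x = cstar (inner x y) ;
  inner_ge0 : forall x, exists b, inner x x = cmul (cstar b) b ;
  inner_norm : forall x, `|inner x x| = `|x| ^+ 2 }.

#[short(type="hilbertModType")]
HB.structure Definition HilbertModule (R : realType) (A : commCStarType R) :=
  { E of CompleteNormedModule R[i] E
       & CompleteNormedModule_isHilbertModule R A E }.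

(* Norms of the library take their values in the scalars, here in R[i]. *)
Definition rnorm (R : realType) (V : normedModType R[i]) (x : V) : R :=
  complex.Re `|x|.

Definition opnorm (R : realType) (V : normedModType R[i]) (T : V -> V) : R :=
  sup [set rnorm (T x) | x in [set x : V | rnorm x <= 1]].

Definition is_adjoint (X Y : Type) (ip : X -> X -> Y) (T S : X -> X) :=
  forall x y, ip (T x) y = ip x (S y).

(* The adjoint of an adjointable map; otherwise a junk value. *)
Definition adjoint (X : choiceType) (Y : Type) (ip : X -> X -> Y)
  (T : X -> X) : X -> X := xget T [set S | is_adjoint ip T S].

Section HilbertSpaceOperators.
Variables (R : realType) (H : hilbertType R).

Definition bounded_operator (Q : H -> H) :=
  linear Q /\ exists M : R, forall x, rnorm (Q x) <= M * rnorm x.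

Definition poly_operator (q : {poly R}) (P : H -> H) : H -> H :=
  fun x => \sum_(i < size q) (q`_i)%:C%C *: iter i P x.

(* Continuous functional calculus: Q = f(P) for a positive operator P and a
   function f that is continuous on [0, +oo[.  The spectrum of P lies in
   [0, ||P||], where f is a uniform limit of polynomials. *)
Definition is_fun_calculus (f : R -> R) (P Q : H -> H) :=
  exists q : nat -> {poly R},
    (forall e : R, 0 < e -> \forall n \near \oo,
       forall t, 0 <= t <= opnorm P -> `|(q n).[t] - f t| <= e) /\
    (forall e : R, 0 < e -> \forall n \near \oo,
       forall x, rnorm (poly_operator (q n) P x - Q x) <= e * rnorm x).

Definition fun_calculus (f : R -> R) (P : H -> H) : H -> H :=
  xget (fun=> 0) [set Q | is_fun_calculus f P Q].

Definition abs_operator (Q : H -> H) : H -> H :=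
  fun_calculus (@Num.sqrt R) (adjoint dot Q \o Q).

Definition orthonormal_basis (B : set H) :=
  (forall e e', B e -> B e' -> dot e e' = (e == e')%:R) /\
  (forall x, (forall e, B e -> dot e x = 0) -> x = 0).

(* The trace of a positive operator, in [0, +oo]; it does not depend on the
   orthonormal basis. *)
Definition trace (Q : H -> H) : \bar R :=
  \esum_(e in xget set0 orthonormal_basis) (complex.Re (dot e (Q e)))%:E.

Definition trace_abs_pow (p : R) (Q : H -> H) : \bar R :=
  trace (fun_calculus (fun t => t `^ p) (abs_operator Q)).

Definition schatten_norm (p : R) (Q : H -> H) : \bar R :=
  poweR (trace_abs_pow p Q) p^-1.

End HilbertSpaceOperators.

Record character (R : realType) (A : commCStarType R) := Character {
  chi_fun :> A -> R[i] ;
  chiD : forall a b, chi_fun (a + b) = chi_fun a + chi_fun b ;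
  chiZ : forall (k : R[i]) a, chi_fun (k *: a) = k * chi_fun a ;
  chiM : forall a b, chi_fun (cmul a b) = chi_fun a * chi_fun b ;
  chi_star : forall a, chi_fun (cstar a) = (chi_fun a)^* ;
  chi_neq0 : exists a, chi_fun a != 0 }.

Section HilbertModules.
Variables (R : realType) (A : commCStarType R) (E : hilbertModType A).
Implicit Types (chi : character A) (T S : E -> E) (p : R).

Definition countably_generated :=
  exists g : nat -> E, forall (x : E) (e : R), 0 < e ->
    exists n (a : nat -> A), rnorm (x - \sum_(i < n) act (g i) (a i)) < e.

(* The space L(E) of adjointable operators. *)
Definition adjointable : set (E -> E) :=
  [set T | exists S, is_adjoint inner T S].

Section Localization.
Variable chi : character A.
Let s (x y : E) : R[i] := chi (inner x y).

Let sDr x y z : s x (y + z) = s x y + s x z.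
Proof. by rewrite /s innerDr chiD. Qed.
Let sZr (a : R[i]) x y : s x (a *: y) = a * s x y.
Proof. by rewrite /s innerZr chiZ. Qed.
Let sC x y : s y x = (s x y)^*.
Proof. by rewrite /s innerC chi_star. Qed.
Let s_ge0 x : 0 <= s x x.
Proof.
have [b] := inner_ge0 x; rewrite /s => ->.
by rewrite chiM chi_star mulrC mul_conjC_ge0.
Qed.

Definition localized_sip : semi_inner E := SemiInner sDr sZr sC s_ge0.

(* chi_* E, the interior tensor product of E with the A-module C (through chi):
   as x (x) l = (l *: x) (x) 1, it is the Hausdorff completion of E for the
   semi-inner product chi <x, y>. *)
Definition localization : hilbertType R := completion localized_sip.

(* x |-> x (x) 1 *)
Definition localize (x : E) : localization := completion_in localized_sip x.

(* chi_* T = T (x) 1, the bounded operator with x (x) 1 |-> T x (x) 1. *)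
Definition localize_op (T : E -> E) : localization -> localization :=
  xget (fun=> 0) [set Q | bounded_operator Q /\
                          forall x, Q (localize x) = localize (T x)].

End Localization.

(* The function f on the space of characters is the Gelfand transform of a. *)
Definition is_gelfand (f : character A -> \bar R) (a : A) :=
  forall chi, exists2 r : R, chi a = r%:C%C & f chi = r%:E.

Definition tr_abs_pow p T : character A -> \bar R :=
  fun chi => trace_abs_pow p (@localize_op chi T).

Definition schatten_class p : set (E -> E) :=
  [set T | adjointable T /\ exists a : A, is_gelfand (tr_abs_pow p T) a].

(* tr |T|^p as an element of A. *)
Definition tr_elt p T : A := xget 0 [set a | is_gelfand (tr_abs_pow p T) a].

Definition pnorm p T : R := rnorm (tr_elt p T) `^ p^-1.

End HilbertModules.

Arguments localized_sip {R A} E chi.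
Arguments localization {R A} E chi.
Arguments localize {R A E} chi x.
Arguments countably_generated {R A} E.
Arguments adjointable {R A} E.
Arguments schatten_class {R A} E p.
Arguments localize_op {R A E} chi T.

Definition normed_subspace (R : realType) (V : lmodType R[i]) (L : set V)
    (N : V -> R) :=
  [/\ L 0, forall u v, L u -> L v -> L (u + v)
     & forall (k : R[i]) u, L u -> L (k *: u)] /\
  [/\ forall u, L u -> 0 <= N u,
      forall u, L u -> N u = 0 -> u = 0,
      forall (k : R[i]) u, L u -> N (k *: u) = complex.Re `|k| * N u
    & forall u v, L u -> L v -> N (u + v) <= N u + N v].

Definition sequentially_complete (R : realType) (V : lmodType R[i])
    (L : set V) (N : V -> R) :=
  forall u : nat -> V, (forall n, L (u n)) ->
    (forall e : R, 0 < e -> exists n0, forall m n,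
       (n0 <= m)%N -> (n0 <= n)%N -> N (u m - u n) < e) ->
    exists2 v, L v & (fun n => N (u n - v)) @ \oo --> (0 : R).

(* Main.v *)
(* Proof idea.  On a Hilbert space, the p-th Schatten norm of Q is the supremum of
   (sum_i |<v_i, Q u_i>|^p)^(1/p) over finite Bessel families u, v.  From this description
   the triangle inequality, the ideal property, the invariance under adjoints, lower
   semicontinuity and Hoelder's inequality follow from finite-dimensional diagonalization,
   without any compactness or singular values.  By Gelfand's theorem the norm of A is the
   supremum over the characters, so that ||T||_p <= c if and only if every chi_* T has
   Schatten norm at most c, and all the norm inequalities can be checked at each chi.

   The continuity of chi |-> tr |chi_* T|^p is the remaining point: L^p(E) is the set of
   the operators that are approximated, in Schatten norm and uniformly in chi, by
   finite-rank operators F z = sum_i x_i <y_i, z>.  For such an F, the trace of |F|^p is a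
   uniform limit of traces of polynomials in F^* F, which are sums of inner products of
   elements of E; and tr |T|^p depends on T in a uniformly continuous way on bounded sets.
   Conversely, if (g_i) generates E and G_n z = sum_(i < n) g_i <g_i, z>, then
   D_n = (1 - G_n / c_n)^(k_n) tends strongly to 0 for suitable c_n and k_n, whereas 1 - D_n
   has finite rank.  The traces tr (D_n |T|^p D_n) lie in A and tend to 0 at each character;
   a Dini argument makes this uniform, and T - T (1 - D_n) = T D_n becomes small.  The class
   of the operators with finite-rank approximations is closed under all the operations of
   the theorem. *)

Require Import Defs.
From mathcomp Require Import all_boot all_order all_algebra.
From mathcomp Require Import complex spectral.
From mathcomp Require Import all_classical all_reals all_analysis.
From mathcomp Require Import ring lra.

Set Implicit Arguments.
Unset Strict Implicit.
Unset Printing Implicit Defensive.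

Import Order.TTheory GRing.Theory Num.Theory.
Import numFieldNormedType.Exports.

Local Open Scope classical_set_scope.
Local Open Scope ring_scope.

(** Bounds and continuity call for different tools. The partial isometry of a polar decomposition is
    out of reach of continuous functions, so it is replaced by contractions up to a small error,
    which lower semicontinuity absorbs. Hoelder's inequality passes through the norms of the columns
    Q u_i, and a Schatten bound controls these only for exponents at least 2; as r >= 1, at most one
    of p and q is below 2, and a Hilbert-Schmidt factor is split off the corresponding operator. Any
    finite number of assertions on functions of one positive operator is reduced to numbers by
    compressing it to a Krylov space. Continuity needs the same polynomial at every character, which
    is possible because all spectra of the |chi_* T| lie in [0, ||T||]; finite rank then turns an
    error in norm into an error in trace. Since A may lack a unit, limits of characters may vanish.
    In the Dini argument this is excluded because tr |T|^p is bounded below at the offending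
    characters. *)

(** * Finite sums of powers *)

Section PowerSums.
Variable R : realType.
Implicit Types (a b c d p q r s t x y : R) (I : finType).

Lemma ler_powRl p x y : 0 <= p -> 0 <= x -> x <= y -> x `^ p <= y `^ p.
Proof. by move=> p0 x0 xy; apply: ge0_ler_powR; rewrite ?nnegrE// (le_trans x0). Qed.

Lemma powR_le_inv p x y : 0 < p -> 0 <= y -> x `^ p <= y `^ p -> x <= y.
Proof.
move=> p0 y0 h; rewrite leNgt; apply/negP => yx.
by have := gt0_ltr_powR p0 y0 (ltW (le_lt_trans y0 yx)) yx; rewrite ltNge h.
Qed.

Lemma powRVK p x : 0 < p -> 0 <= x -> (x `^ p^-1) `^ p = x.
Proof. by move=> p0 x0; rewrite -powRrM mulVf ?gt_eqF// powRr1. Qed.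

Lemma powRKV p x : 0 < p -> 0 <= x -> (x `^ p) `^ p^-1 = x.
Proof. by move=> p0 x0; rewrite -powRrM mulfV ?gt_eqF// powRr1. Qed.

(** Young's inequality for the product t * 1 with the conjugate exponents s and s / (s - 1),
    multiplied by s. *)
Lemma powR_bernoulli s t : 1 <= s -> 0 <= t -> s * (t - 1) <= t `^ s - 1.
Proof.
rewrite le_eqVlt => /predU1P[<-|s1] t0; first by rewrite powRr1// mul1r.
have s0 : 0 < s by exact: lt_trans s1.
have q0 : 0 < s / (s - 1) by rewrite divr_gt0// subr_gt0.
have := @conjugate_powR _ t 1 s (s / (s - 1)) t0 ler01 s0 q0.
have -> : s^-1 + (s / (s - 1))^-1 = 1.
  by rewrite invf_div -{1}(div1r s) -mulrDl subrKC mulfV// gt_eqF.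
move=> /(_ erefl); rewrite powR1 mulr1 mul1r invf_div => h.
have : s * t <= s * (t `^ s / s + (s - 1) / s).
  by rewrite ler_pM2l.
have -> : s * (t `^ s / s + (s - 1) / s) = t `^ s + (s - 1).
  by field; rewrite gt_eqF.
lra.
Qed.

Lemma powRB1 s x : 0 < x -> x `^ (s - 1) * x = x `^ s.
Proof.
by move=> x0; rewrite -{2}(powRr1 (ltW x0)) -powRD ?subrK// (gt_eqF x0) implybT.
Qed.

(** Bernoulli's inequality at y / x, multiplied by x^s: a convex power lies above its tangents. *)
Lemma powR_tangent s x y : 1 <= s -> 0 < x -> 0 <= y ->
  x `^ s + s * x `^ (s - 1) * (y - x) <= y `^ s.
Proof.
move=> s1 x0 y0; have := powR_bernoulli s1 (divr_ge0 y0 (ltW x0)).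
have xs0 : 0 < x `^ s by rewrite powR_gt0.
rewrite -(ler_pM2l xs0) => h.
have e1 : x `^ s * (y / x) `^ s = y `^ s.
  by rewrite -powRM ?divr_ge0// ?ltW// mulrC divfK// gt_eqF.
have e2 := esym (powRB1 s x0).
move: h; rewrite [X in _ <= X]mulrBr e1 mulr1.
have -> : x `^ s * (s * (y / x - 1)) = s * x `^ (s - 1) * (y - x).
  by rewrite e2; field; rewrite gt_eqF.
lra.
Qed.

Lemma powR_lip s M x y : 1 <= s -> 0 <= x <= M -> 0 <= y <= M ->
  `|x `^ s - y `^ s| <= s * M `^ (s - 1) * `|x - y|.
Proof.
move=> s1 hx hy; wlog xy : x y hx hy / x <= y.
  move=> H; have [xy|/ltW yx] := leP x y; first exact: H.
  by rewrite distrC (distrC x); exact: H.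
case/andP: hx hy => x0 xM /andP[y0 yM].
have [y00|yn0] := eqVneq y 0.
  have -> : x = y by apply/eqP; rewrite eq_le xy /= y00.
  by rewrite !subrr normr0 mulr0.
have yp : 0 < y by rewrite lt_def yn0.
have s0 : 0 <= s by lra.
rewrite distrC ger0_norm ?subr_ge0 ?ler_powRl//.
rewrite distrC ger0_norm ?subr_ge0//.
have := powR_tangent s1 yp x0.
have : y `^ (s - 1) <= M `^ (s - 1) by rewrite ler_powRl ?subr_ge0.
set u := y `^ (s - 1); set v := M `^ (s - 1) => uv.
have : s * u * (y - x) <= s * v * (y - x).
  by rewrite ler_wpM2r ?subr_ge0// ler_wpM2l.
rewrite -(opprB y x) mulrN; lra.
Qed.

(** Each of x / (x + y) and y / (x + y) lies in [0, 1], hence is at most its a-th power, and the two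
    add up to 1. *)
Lemma powR_subadd a x y : 0 < a <= 1 -> 0 <= x -> 0 <= y ->
  (x + y) `^ a <= x `^ a + y `^ a.
Proof.
move=> /andP[a0 a1] x0 y0.
have [->|xn0] := eqVneq x 0; first by rewrite powR0 ?gt_eqF// !add0r.
have s0 : 0 < x + y by rewrite ltr_wpDr// lt_def xn0.
have key z : 0 <= z -> z <= x + y -> z / (x + y) <= (z / (x + y)) `^ a.
  move=> z0 zs; have u0 : 0 <= z / (x + y) by rewrite divr_ge0// ltW.
  have [->|un0] := eqVneq (z / (x + y)) 0; first by rewrite powR_ge0.
  have u1 : 0 < z / (x + y) <= 1.
    by rewrite lt_def un0 u0 /= ler_pdivrMr// mul1r.
  by rewrite -{1}(powRr1 u0); exact: ger_powR.
have kx := key x x0; have ky := key y y0.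
have sa : 0 < (x + y) `^ a by rewrite powR_gt0.
have e z : 0 <= z -> (z / (x + y)) `^ a * (x + y) `^ a = z `^ a.
  by move=> z0; rewrite -powRM ?divr_ge0 ?(ltW s0)// divfK ?gt_eqF.
rewrite -(e x)// -(e y)// -mulrDl -{1}(mul1r ((x + y) `^ a)) ler_wpM2r ?(ltW sa)//.
rewrite -(@divff _ (x + y)) ?gt_eqF// mulrDl lerD// ?kx ?ky//; lra.
Qed.

Lemma powR_mod a x y : 0 < a <= 1 -> 0 <= x -> 0 <= y ->
  `|x `^ a - y `^ a| <= `|x - y| `^ a.
Proof.
move=> ha x0 y0; have a0 : 0 <= a by case/andP: ha => /ltW.
wlog xy : x y x0 y0 / x <= y.
  move=> H; have [xy|/ltW yx] := leP x y; first exact: H.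
  by rewrite distrC (distrC x); exact: H.
rewrite distrC ger0_norm ?subr_ge0 ?ler_powRl// distrC ger0_norm ?subr_ge0//.
have := @powR_subadd a x (y - x) ha x0; rewrite subr_ge0 subrKC => /(_ xy); lra.
Qed.

(** Total mass at most 1 is what Bessel's inequality gives for the squared coefficients of a vector
    in the unit ball. The missing mass may be placed at 0, where the power vanishes. *)
Lemma sum_jensen I (c l : I -> R) s : 1 <= s ->
  (forall i, 0 <= c i) -> (forall i, 0 <= l i) -> \sum_i c i <= 1 ->
  (\sum_i c i * l i) `^ s <= \sum_i c i * l i `^ s.
Proof.
move=> s1 c0 l0 c1; set x := \sum_i c i * l i.
have x0 : 0 <= x by apply: sumr_ge0 => i _; rewrite mulr_ge0.
have [x00|xn0] := eqVneq x 0.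
  rewrite x00 powR0; last by rewrite gt_eqF; lra.
  by apply: sumr_ge0 => i _; rewrite mulr_ge0 ?powR_ge0.
have xp : 0 < x by rewrite lt_def xn0.
(* The tangent at the mean x takes the value (1 - s) x^s <= 0 at the point 0, which settles the
   missing mass. *)
apply: (@le_trans _ _ (\sum_i c i * (x `^ s + s * x `^ (s - 1) * (l i - x)))).
  have -> : \sum_i c i * (x `^ s + s * x `^ (s - 1) * (l i - x)) =
     (\sum_i c i) * (x `^ s - s * x `^ (s - 1) * x) + s * x `^ (s - 1) * x.
    have lin K X z : \sum_i c i * (X + K * (l i - z)) =
        (\sum_i c i) * (X - K * z) + K * \sum_i c i * l i.
      by rewrite mulr_suml mulr_sumr -big_split /=; apply: eq_bigr => i _; ring.
    exact: lin.
  rewrite -mulrA powRB1//.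
  have : 0 <= (1 - \sum_i c i) * ((s - 1) * x `^ s).
    by rewrite !mulr_ge0 ?powR_ge0; lra.
  lra.
by apply: ler_sum => i _; rewrite ler_wpM2l// powR_tangent.
Qed.

Lemma sum_powR_eq0 I (a : I -> R) p : 0 < p -> (forall i, 0 <= a i) ->
  \sum_i a i `^ p <= 0 -> forall i, a i = 0.
Proof.
move=> p0 a0 h i; apply: (powR_eq0_eq0 (p := p)); apply/eqP.
rewrite eq_le powR_ge0 andbT (le_trans _ h)//.
by rewrite (bigD1 i)//= lerDl sumr_ge0// => j _; exact: powR_ge0.
Qed.

(** A zero bound kills its family. Otherwise (a + b) / (c + d) is the convex combination of a / c
    and b / d with weights c / (c + d) and d / (c + d), and Jensen's inequality applies to each
    term. *)
Lemma sum_minkowski I (a b : I -> R) p c d : 1 <= p -> 0 <= c -> 0 <= d ->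
  (forall i, 0 <= a i) -> (forall i, 0 <= b i) ->
  \sum_i a i `^ p <= c `^ p -> \sum_i b i `^ p <= d `^ p ->
  \sum_i (a i + b i) `^ p <= (c + d) `^ p.
Proof.
move=> p1 c0 d0 a0 b0 ha hb; have p0 : 0 < p by lra.
have [cz|cn0] := eqVneq c 0.
  move: ha; rewrite cz powR0 ?gt_eqF// => /(sum_powR_eq0 p0 a0) az.
  by rewrite add0r (le_trans _ hb)// ler_sum// => i _; rewrite az add0r.
have [dz|dn0] := eqVneq d 0.
  move: hb; rewrite dz powR0 ?gt_eqF// => /(sum_powR_eq0 p0 b0) bz.
  by rewrite addr0 (le_trans _ ha)// ler_sum// => i _; rewrite bz addr0.
have cp : 0 < c by rewrite lt_def cn0.
have dp : 0 < d by rewrite lt_def dn0.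
have sp : 0 < c + d by exact: addr_gt0.
pose w (j : bool) := (if j then c else d) / (c + d).
have key i : ((a i + b i) / (c + d)) `^ p <=
    c / (c + d) * (a i / c) `^ p + d / (c + d) * (b i / d) `^ p.
  have := @sum_jensen bool w (fun j => if j then a i / c else b i / d) p p1.
  rewrite !big_bool /= /w.
  have -> : c / (c + d) * (a i / c) + d / (c + d) * (b i / d) = (a i + b i) / (c + d).
    by field; rewrite cn0 dn0 gt_eqF.
  apply; last by rewrite -mulrDl divff// gt_eqF.
    by case; rewrite divr_ge0// ltW.
  by case; rewrite divr_ge0.
have eM x y : 0 <= x -> 0 < y -> (x / y) `^ p = x `^ p / y `^ p.
  move=> x0 y0; have yy : y `^ p != 0 by rewrite gt_eqF// powR_gt0.
  by apply: (mulIf yy); rewrite divfK// -powRM ?divr_ge0// ?ltW// divfK// gt_eqF.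
have : \sum_i ((a i + b i) / (c + d)) `^ p <= 1.
  apply: (le_trans (ler_sum _ (fun i _ => key i))).
  rewrite big_split /= -!mulr_sumr.
  have -> : \sum_i (a i / c) `^ p = (\sum_i a i `^ p) / c `^ p.
    by rewrite mulr_suml; apply: eq_bigr => i _; rewrite eM.
  have -> : \sum_i (b i / d) `^ p = (\sum_i b i `^ p) / d `^ p.
    by rewrite mulr_suml; apply: eq_bigr => i _; rewrite eM.
  rewrite -[leRHS](@divff _ (c + d)) ?gt_eqF// mulrDl.
  by rewrite lerD// ger_pMr ?divr_gt0// ler_pdivrMr ?powR_gt0// mul1r.
under eq_bigr do rewrite eM ?addr_ge0//.
by rewrite -mulr_suml ler_pdivrMr ?powR_gt0// mul1r.
Qed.

(** Young's inequality for the r-th powers of the normalized terms, with exponents p / r and q /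
    r. *)
Lemma sum_hoelder I (a b : I -> R) p q r c d :
  0 < p -> 0 < q -> 0 < r -> p^-1 + q^-1 = r^-1 -> 0 <= c -> 0 <= d ->
  (forall i, 0 <= a i) -> (forall i, 0 <= b i) ->
  \sum_i a i `^ p <= c `^ p -> \sum_i b i `^ q <= d `^ q ->
  \sum_i (a i * b i) `^ r <= (c * d) `^ r.
Proof.
move=> p0 q0 r0 pqr c0 d0 a0 b0 ha hb.
have [cz|cn0] := eqVneq c 0.
  move: ha; rewrite cz powR0 ?gt_eqF// => /(sum_powR_eq0 p0 a0) az.
  by rewrite big1 ?powR_ge0// => i _; rewrite az mul0r powR0 ?gt_eqF.
have [dz|dn0] := eqVneq d 0.
  move: hb; rewrite dz powR0 ?gt_eqF// => /(sum_powR_eq0 q0 b0) bz.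
  by rewrite big1 ?powR_ge0// => i _; rewrite bz mulr0 powR0 ?gt_eqF.
have cp : 0 < c by rewrite lt_def cn0.
have dp : 0 < d by rewrite lt_def dn0.
have eM x y s : 0 <= x -> 0 < y -> (x / y) `^ s = x `^ s / y `^ s.
  move=> x0 y0; have yy : y `^ s != 0 by rewrite gt_eqF// powR_gt0.
  by apply: (mulIf yy); rewrite divfK// -powRM ?divr_ge0// ?ltW// divfK// gt_eqF.
have rr : r / p + r / q = 1 by rewrite -mulrDr pqr mulfV// gt_eqF.
have key i : ((a i * b i) / (c * d)) `^ r <=
    r / p * (a i / c) `^ p + r / q * (b i / d) `^ q.
  have := @conjugate_powR _ ((a i / c) `^ r) ((b i / d) `^ r) (p / r) (q / r).
  rewrite !powR_ge0 !divr_gt0// !invf_div => /(_ isT isT isT isT rr).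
  rewrite -!powRrM !(mulrCA r) !divff ?gt_eqF// !mulr1.
  rewrite -powRM ?divr_ge0// mulf_div => h.
  by rewrite (mulrC (r / p)) (mulrC (r / q)).
have : \sum_i ((a i * b i) / (c * d)) `^ r <= 1.
  apply: (le_trans (ler_sum _ (fun i _ => key i))).
  rewrite big_split /= -!mulr_sumr.
  have -> : \sum_i (a i / c) `^ p = (\sum_i a i `^ p) / c `^ p.
    by rewrite mulr_suml; apply: eq_bigr => i _; rewrite eM.
  have -> : \sum_i (b i / d) `^ q = (\sum_i b i `^ q) / d `^ q.
    by rewrite mulr_suml; apply: eq_bigr => i _; rewrite eM.
  rewrite -[leRHS]rr.
  by rewrite lerD// ger_pMr ?divr_gt0// ler_pdivrMr ?powR_gt0// mul1r.
under eq_bigr do rewrite eM ?mulr_ge0 ?mulr_gt0//.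
by rewrite -mulr_suml ler_pdivrMr ?powR_gt0 ?mulr_gt0// mul1r.
Qed.

End PowerSums.

(** * Uniform polynomial approximation *)

Section Weierstrass.
Variable R : realType.
Implicit Types (f g : R -> R) (M N K a e t x y c : R) (q : {poly R}).

(* The Bernstein polynomial: [bernstein n g] has the value
   [\sum_(k <= n) 'C(n, k) x^k (1 - x)^(n - k) g k] at [x]. *)
Fixpoint bernstein n (g : nat -> R) : {poly R} :=
  if n is m.+1 then 'X * bernstein m (g \o succn) + (1 - 'X) * bernstein m g
  else (g 0%N)%:P.

Arguments bernstein : simpl never.

Lemma bernsteinS n (g : nat -> R) x : (bernstein n.+1 g).[x] =
  x * (bernstein n (g \o succn)).[x] + (1 - x) * (bernstein n g).[x].
Proof. by rewrite /bernstein -/bernstein !hornerE. Qed.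

Lemma le_bernstein n (g h : nat -> R) x : 0 <= x <= 1 ->
  (forall k, (k <= n)%N -> g k <= h k) ->
  (bernstein n g).[x] <= (bernstein n h).[x].
Proof.
move=> /andP[x0 x1]; elim: n g h => [|n IH] g h gh.
  by rewrite /bernstein !hornerC gh.
rewrite !bernsteinS lerD// ler_wpM2l ?subr_ge0//.
  by apply: IH => k kn; exact: gh.
by apply: IH => k kn; apply: gh; exact: leqW.
Qed.

Lemma bernsteinD n (g h : nat -> R) x :
  (bernstein n (fun k => g k + h k)).[x] = (bernstein n g).[x] + (bernstein n h).[x].
Proof.
elim: n g h => [|n IH] g h; first by rewrite /bernstein !hornerC.
rewrite !bernsteinS.
have -> : (fun k => g k + h k) \o succn = (fun k => (g \o succn) k + (h \o succn) k) by [].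
by rewrite !IH; ring.
Qed.

Lemma bernsteinZ n c (g : nat -> R) x :
  (bernstein n (fun k => c * g k)).[x] = c * (bernstein n g).[x].
Proof.
elim: n g => [|n IH] g; first by rewrite /bernstein !hornerC.
rewrite !bernsteinS.
have -> : (fun k => c * g k) \o succn = (fun k => c * (g \o succn) k) by [].
by rewrite !IH; ring.
Qed.

Lemma bernstein_cst n c x : (bernstein n (fun=> c)).[x] = c.
Proof.
elim: n => [|n IH]; first by rewrite /bernstein hornerC.
by rewrite bernsteinS [bernstein n (_ \o _)]/(bernstein n (fun=> c)) IH; ring.
Qed.

(** The second moment about c of the binomial law of mean n x and variance n x (1 - x). The centre
    is arbitrary because the recursion shifts it to c - 1. *)
Lemma bernstein_var n c x :
  (bernstein n (fun k => (k%:R - c) ^+ 2)).[x] = (n%:R * x - c) ^+ 2 + n%:R * x * (1 - x).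
Proof.
elim: n c => [|n IH] c; first by rewrite /bernstein hornerC; ring.
rewrite bernsteinS IH.
have -> : (fun k : nat => (k%:R - c) ^+ 2) \o succn = (fun k : nat => (k%:R - (c - 1)) ^+ 2).
  by apply/funext => k /=; rewrite -natr1; congr (_ ^+ 2); ring.
by rewrite IH -natr1; ring.
Qed.

Definition poly_approx M f := forall e, 0 < e ->
  exists q, forall t, 0 <= t <= M -> `|q.[t] - f t| <= e.

Definition unif_cont_itv M f := forall e, 0 < e -> exists2 d, 0 < d &
  forall x y, 0 <= x <= M -> 0 <= y <= M -> `|x - y| < d -> `|f x - f y| <= e.

(** Chebyshev's argument: nodes M k / n close to t are handled by uniform continuity, the others by
    a multiple of (k - n x)^2, whose Bernstein mean is the variance n x (1 - x). *)
Lemma weierstrass M f K : 0 < M -> (forall t, 0 <= t <= M -> `|f t| <= K) ->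
  unif_cont_itv M f -> poly_approx M f.
Proof.
move=> M0 fK uf e e0; have e20 : 0 < e / 2 by rewrite divr_gt0.
have [d d0 Hd] := uf _ e20.
have K0 : 0 <= K.
  by have := fK 0; rewrite lexx (ltW M0) => /(_ isT); apply: le_trans.
have [N HN] : exists N : nat, 2 * K / (d / M) ^+ 2 / (e / 2) < N.+1%:R.
  by exists (Num.truncn (2 * K / (d / M) ^+ 2 / (e / 2))); exact: truncnS_gt.
set n := N.+1 in HN; have n0 : 0 < n%:R :> R by rewrite ltr0n.
pose g (k : nat) := f (M * (k%:R / n%:R)).
exists (bernstein n g \Po (M^-1 *: 'X)) => t /andP[t0 tM].
rewrite horner_comp hornerZ hornerX; set x := M^-1 * t.
have tE : t = M * x by rewrite /x mulrA divff ?mul1r// gt_eqF.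
have x01 : 0 <= x <= 1.
  by rewrite /x mulrC divr_ge0 ?(ltW M0)//= ler_pdivrMr// mul1r.
(* With this C, the product C (k - n x)^2 equals 2 K ((M k / n - t) / d)^2, which is at least 2 K
   once M k / n is at distance d or more from t. *)
pose C := 2 * K / (d / M) ^+ 2 / n%:R ^+ 2.
pose h (k : nat) := e / 2 + C * (k%:R - n%:R * x) ^+ 2.
have dM : 0 < (d / M) ^+ 2 by rewrite exprn_gt0// divr_gt0.
have C0 : 0 <= C
  by rewrite /C divr_ge0 ?exprn_ge0 ?ler0n// divr_ge0 ?(ltW dM)// mulr_ge0.
have fh k : (k <= n)%N -> `|g k - f t| <= h k.
  move=> kn; have kn01 : 0 <= M * (k%:R / n%:R) <= M.
    rewrite mulr_ge0 ?divr_ge0 ?(ltW M0)//= ger_pMr// ler_pdivrMr// mul1r ler_nat//.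
  have [lt|ge] := ltP `|M * (k%:R / n%:R) - t| d.
    apply: (le_trans (Hd _ _ kn01 _ lt)); first by rewrite t0.
    by rewrite /h lerDl mulr_ge0// sqr_ge0.
  apply: (@le_trans _ _ (2 * K)).
    apply: (le_trans (ler_normB _ _)); rewrite mulr2n mulrDl mul1r.
    by rewrite lerD// fK// t0.
  apply: (@le_trans _ _ (C * (k%:R - n%:R * x) ^+ 2)); last by rewrite /h lerDr ltW.
  have -> : C * (k%:R - n%:R * x) ^+ 2 = 2 * K * ((M * (k%:R / n%:R) - t) ^+ 2 / d ^+ 2).
    by rewrite /C tE; field; rewrite !gt_eqF.
  rewrite ler_peMr ?mulr_ge0// ler_pdivlMr ?exprn_gt0// mul1r.
  by rewrite -[leRHS]real_normK ?num_real// ler_pXn2r ?nnegrE ?normr_ge0// ltW.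
have Bh : (bernstein n h).[x] <= e.
  rewrite /h bernsteinD bernstein_cst bernsteinZ bernstein_var subrr expr0n add0r.
  rewrite {2}(splitr e) lerD2l.
  apply: (@le_trans _ _ (C * n%:R)).
    rewrite ler_wpM2l// -mulrA ger_pMr//.
    by case/andP: x01 => x0 x1; rewrite mulr_ile1 ?subr_ge0 ?gerBl.
  have -> : C * n%:R = (2 * K / (d / M) ^+ 2) / n%:R.
    by rewrite /C; field; rewrite !gt_eqF ?exprn_gt0// divr_gt0.
  by rewrite ler_pdivrMr// [leRHS]mulrC -ler_pdivrMr// ltW.
rewrite ler_norml; apply/andP; split.
  have : (bernstein n (fun k => f t + -1 * h k)).[x] <= (bernstein n g).[x].
    apply: le_bernstein => // k /fh; rewrite ler_norml => /andP[]; lra.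
  by rewrite bernsteinD bernstein_cst bernsteinZ; lra.
have : (bernstein n g).[x] <= (bernstein n (fun k => f t + h k)).[x].
  apply: le_bernstein => // k /fh; rewrite ler_norml => /andP[]; lra.
by rewrite bernsteinD bernstein_cst; lra.
Qed.

Lemma poly_approx_poly M q : poly_approx M (fun t => q.[t]).
Proof. by move=> e e0; exists q => t _; rewrite subrr normr0 ltW. Qed.

(** The power is Lipschitz on [0, M] if a >= 1, and Hoelder continuous of exponent a otherwise. *)
Lemma poly_approx_powR M a : 0 < M -> 0 < a -> poly_approx M (fun t => t `^ a).
Proof.
move=> M0 a0; apply: (@weierstrass _ _ (M `^ a)) => //.
  by move=> t /andP[t0 tM]; rewrite ger0_norm ?powR_ge0// ler_powRl// ltW.
have [a1|a1] := leP 1 a; move=> e e0.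
  pose L := a * M `^ (a - 1) + 1.
  have L0 : 0 < L by rewrite ltr_wpDl// mulr_ge0 ?powR_ge0 ?ltW.
  exists (e / L); first by rewrite divr_gt0.
  move=> x y hx hy xy; apply: (le_trans (powR_lip a1 hx hy)).
  apply: (@le_trans _ _ (L * `|x - y|)); first by rewrite ler_wpM2r// /L lerDl.
  by rewrite mulrC -ler_pdivlMr// ltW.
exists (e `^ a^-1); first by rewrite powR_gt0.
move=> x y /andP[x0 _] /andP[y0 _] xy.
have ha : 0 < a <= 1 by rewrite a0 ltW.
apply: (le_trans (powR_mod ha x0 y0)).
rewrite -[leRHS](powRVK a0 (ltW e0)); apply: ler_powRl; rewrite ?normr_ge0// ltW//.
Qed.

Lemma poly_approx_inv M e : 0 <= M -> 0 < e -> poly_approx M (fun t => (t + e)^-1).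
Proof.
move=> M0 e0; have M1 : 0 < M + 1 by rewrite ltr_wpDl.
have pos x z : 0 <= x <= z -> 0 < x + e by case/andP => x0 _; rewrite ltr_wpDl.
(* [weierstrass] requires an interval of positive length, and M may be 0. *)
suff H : poly_approx (M + 1) (fun t => (t + e)^-1).
  move=> d /H[q Hq]; exists q => t /andP[t0 tM].
  by apply: Hq; rewrite t0 (le_trans tM)// lerDl.
apply: (@weierstrass _ _ e^-1) => //.
  move=> t ht; have te := pos _ _ ht; case/andP: ht => t0 tM.
  rewrite ger0_norm ?invr_ge0 ?(ltW te)// lef_pV2 ?posrE// lerDr//.
move=> d d0; exists (d * e ^+ 2); first by rewrite mulr_gt0// exprn_gt0.
move=> x y hx hy xy; have xe := pos _ _ hx; have ye := pos _ _ hy.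
have -> : (x + e)^-1 - (y + e)^-1 = (y - x) / ((x + e) * (y + e)).
  by field; rewrite !gt_eqF.
rewrite normrM distrC normfV (gtr0_norm (mulr_gt0 xe ye)).
rewrite ler_pdivrMr ?mulr_gt0// (le_trans (ltW xy))// ler_wpM2l ?(ltW d0)//.
by rewrite expr2; apply: ler_pM; rewrite ?(ltW e0)// lerDr; [case/andP: hx|case/andP: hy].
Qed.

Lemma poly_bounded M q : exists2 K, 0 <= K & forall t, 0 <= t <= M -> `|q.[t]| <= K.
Proof.
elim/poly_ind: q => [|q c [K K0 HK]].
  by exists 0 => // t _; rewrite horner0 normr0.
exists (K * `|M| + `|c|); first by rewrite addr_ge0 ?mulr_ge0.
move=> t ht; rewrite !hornerE (le_trans (ler_normD _ _))// lerD2r normrM.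
apply: ler_pM; rewrite ?normr_ge0 ?HK//.
by case/andP: ht => t0 tM; rewrite !ger0_norm// (le_trans t0).
Qed.

Lemma poly_approxM M f g :
  poly_approx M f -> poly_approx M g -> poly_approx M (fun t => f t * g t).
Proof.
move=> af ag e e0.
have [q1 Hq1] := af 1 ltr01; have [K K0 HK] := poly_bounded M q1.
have fK t : 0 <= t <= M -> `|f t| <= K + 1.
  move=> ht; have -> : f t = q1.[t] - (q1.[t] - f t) by ring.
  by rewrite (le_trans (ler_normB _ _))// lerD ?HK ?Hq1.
have [r Hr] := ag (e / 2 / (K + 1)) ltac:(by rewrite !divr_gt0// ltr_wpDl).
have [L L0 HL] := poly_bounded M r.
have [q Hq] := af (e / 2 / (L + 1)) ltac:(by rewrite !divr_gt0// ltr_wpDl).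
exists (q * r) => t ht; rewrite hornerM.
have -> : q.[t] * r.[t] - f t * g t = (q.[t] - f t) * r.[t] + f t * (r.[t] - g t) by ring.
rewrite (le_trans (ler_normD _ _))// (splitr e) !normrM lerD//.
  apply: (@le_trans _ _ (e / 2 / (L + 1) * (L + 1))).
    by apply: ler_pM; rewrite ?normr_ge0 ?Hq// (le_trans (HL _ ht))// lerDl.
  by rewrite divfK// gt_eqF// ltr_wpDl.
apply: (@le_trans _ _ ((K + 1) * (e / 2 / (K + 1)))).
  by apply: ler_pM; rewrite ?normr_ge0 ?fK ?Hr.
by rewrite mulrC divfK// gt_eqF// ltr_wpDl.
Qed.

Lemma poly_approx_ext M f g : (forall t, 0 <= t <= M -> f t = g t) ->
  poly_approx M f -> poly_approx M g.
Proof. by move=> fg af e /af[q Hq]; exists q => t ht; rewrite -fg// Hq. Qed.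

Lemma poly_approx_sub M N f : N <= M -> poly_approx M f -> poly_approx N f.
Proof.
move=> NM af e /af[q Hq]; exists q => t /andP[t0 tN].
by rewrite Hq// t0 (le_trans tN).
Qed.

End Weierstrass.

(** * Hilbert spaces *)

Section ComplexModulus.
Variable R : realType.
Implicit Types (z w : R[i]) (a b : R).

Definition cabs z : R := complex.Re `|z|.

Lemma ge0_RRe z : 0 <= z -> (complex.Re z)%:C%C = z.
Proof. by move=> z0; apply: RRe_real; rewrite realE z0. Qed.

Lemma cabsE z : `|z| = (cabs z)%:C%C.
Proof. by rewrite ge0_RRe. Qed.

Lemma cabs_ge0 z : 0 <= cabs z.
Proof. by rewrite -ler0c -cabsE. Qed.

Lemma cabsD z w : cabs (z + w) <= cabs z + cabs w.
Proof. by rewrite -lecR rmorphD /= -!cabsE ler_normD. Qed.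

Lemma cabsM z w : cabs (z * w) = cabs z * cabs w.
Proof. by apply: complexI; rewrite rmorphM /= -!cabsE normrM. Qed.

Lemma cabsN z : cabs (- z) = cabs z.
Proof. by rewrite /cabs normrN. Qed.

Lemma cabsB z w : cabs (z - w) <= cabs z + cabs w.
Proof. by rewrite (le_trans (cabsD _ _))// cabsN. Qed.

Lemma cabs_distC z w : cabs (z - w) = cabs (w - z).
Proof. by rewrite /cabs distrC. Qed.

Lemma cabs0 : cabs 0 = 0. Proof. by rewrite /cabs normr0. Qed.

Lemma cabs1 : cabs 1 = 1. Proof. by rewrite /cabs normr1. Qed.

Lemma cabsJ z : cabs z^* = cabs z.
Proof. by rewrite /cabs norm_conjC. Qed.

Lemma cabsR a : cabs a%:C%C = `|a|.
Proof. by rewrite /cabs normc_def /= expr0n addr0 sqrtr_sqr. Qed.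

Lemma cabs_eq0 z : cabs z = 0 -> z = 0.
Proof. by move=> h; apply/eqP; rewrite -normr_eq0 cabsE h. Qed.

Lemma cabs_sqr z : (cabs z ^+ 2)%:C%C = z^* * z.
Proof. by rewrite rmorphXn /= -cabsE normCK mulrC. Qed.

Lemma cabsX z n : cabs (z ^+ n) = cabs z ^+ n.
Proof. by elim: n => [|n IH]; rewrite ?expr0 ?cabs1// !exprS cabsM IH. Qed.

Lemma cabs_sum (I : Type) (r : seq I) (P : pred I) (F : I -> R[i]) :
  cabs (\sum_(i <- r | P i) F i) <= \sum_(i <- r | P i) cabs (F i).
Proof.
elim/big_ind2: _ => [|x a y b xa yb|//]; first by rewrite cabs0.
by rewrite (le_trans (cabsD _ _))// lerD.
Qed.

Lemma ReD z w : complex.Re (z + w) = complex.Re z + complex.Re w.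
Proof. by case: z w => [a b] [c d]. Qed.

Lemma ReN z : complex.Re (- z) = - complex.Re z.
Proof. by case: z. Qed.

Lemma ReZ a z : complex.Re (a%:C%C * z) = a * complex.Re z.
Proof. by case: z => x y /=; rewrite mul0r subr0. Qed.

Lemma Re_sum (I : Type) (r : seq I) (P : pred I) (F : I -> R[i]) :
  complex.Re (\sum_(i <- r | P i) F i) = \sum_(i <- r | P i) complex.Re (F i).
Proof. by apply: (big_morph (@complex.Re R)) => // x y; exact: ReD. Qed.

Lemma Re_le_cabs z : `|complex.Re z| <= cabs z.
Proof. by rewrite -lecR -cabsE; exact: normc_ge_Re. Qed.

Lemma conjR a : (a%:C%C : R[i])^* = a%:C%C.
Proof. by rewrite /Num.conj /= oppr0. Qed.

Lemma cabs_ge0E z : 0 <= z -> cabs z = complex.Re z.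
Proof. by move=> z0; rewrite /cabs ger0_norm. Qed.

Lemma le_of_eps a b : (forall e : R, 0 < e -> a <= b + e) -> a <= b.
Proof. by move=> h; apply/ler_addgt0Pr. Qed.

Lemma le_of_epsM a b c : 0 <= c -> (forall e : R, 0 < e -> a <= b + e * c) -> a <= b.
Proof.
move=> c0 h; apply: le_of_eps => e e0.
have d0 : 0 < e / (c + 1) by rewrite divr_gt0// ltr_wpDl.
rewrite (le_trans (h _ d0))// lerD2l -mulrA ger_pMr// mulrC.
by rewrite ler_pdivrMr ?mul1r ?lerDl// ltr_wpDl.
Qed.

Lemma natSinv_lt (e : R) : 0 < e -> exists N, forall n, (N <= n)%N -> n.+1%:R^-1 < e.
Proof.
by move=> e0; have [N _ HN] := near_infty_natSinv_lt (PosNum e0); exists N => n /HN.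
Qed.

End ComplexModulus.

Section RealNorm.
Variables (R : realType) (V : normedModType R[i]).
Implicit Types (x y : V).

Lemma rnormE x : `|x| = (rnorm x)%:C%C.
Proof. by rewrite ge0_RRe. Qed.

Lemma rnorm_ge0 x : 0 <= rnorm x.
Proof. by rewrite -ler0c -rnormE. Qed.

Lemma rnormD x y : rnorm (x + y) <= rnorm x + rnorm y.
Proof. by rewrite -lecR rmorphD /= -!rnormE ler_normD. Qed.

Lemma rnormZ k x : rnorm (k *: x) = cabs k * rnorm x.
Proof. by apply: complexI; rewrite rmorphM /= -!rnormE -cabsE normrZ. Qed.

Lemma rnormN x : rnorm (- x) = rnorm x.
Proof. by rewrite /rnorm normrN. Qed.

Lemma rnormB x y : rnorm (x - y) <= rnorm x + rnorm y.
Proof. by rewrite (le_trans (rnormD _ _))// rnormN. Qed.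

Lemma rnorm_distC x y : rnorm (x - y) = rnorm (y - x).
Proof. by rewrite /rnorm distrC. Qed.

Lemma rnorm0 : rnorm (0 : V) = 0. Proof. by rewrite /rnorm normr0. Qed.

Lemma rnorm_eq0 x : rnorm x = 0 -> x = 0.
Proof. by move=> h; apply/eqP; rewrite -normr_eq0 rnormE h. Qed.

Lemma rnorm_triB x y z : rnorm (x - z) <= rnorm (x - y) + rnorm (y - z).
Proof. by rewrite -(subrKA y) rnormD. Qed.

Lemma rnorm_sum (I : Type) (r : seq I) (P : pred I) (F : I -> V) :
  rnorm (\sum_(i <- r | P i) F i) <= \sum_(i <- r | P i) rnorm (F i).
Proof.
elim/big_ind2: _ => [|x a y b xa yb|//]; first by rewrite rnorm0.
by rewrite (le_trans (rnormD _ _))// lerD.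
Qed.

Definition scvg (u : nat -> V) (l : V) := forall e : R, 0 < e ->
  exists N, forall n, (N <= n)%N -> rnorm (u n - l) <= e.

Lemma scvg_le (u : nat -> V) l z c : scvg u l ->
  (exists N, forall n, (N <= n)%N -> rnorm (u n - z) <= c) -> rnorm (l - z) <= c.
Proof.
move=> ul [M HM]; apply: le_of_eps => e e0; have [N HN] := ul e e0.
rewrite (le_trans (rnorm_triB _ (u (maxn M N)) _))// addrC lerD//.
  by rewrite HM// leq_maxl.
by rewrite rnorm_distC HN// leq_maxr.
Qed.

Lemma scvg_unique (u : nat -> V) l z : scvg u l -> scvg u z -> l = z.
Proof.
move=> ul uz; apply/eqP; rewrite -subr_eq0; apply/eqP/rnorm_eq0.
apply/eqP; rewrite eq_le rnorm_ge0 andbT; apply: le_of_eps => e e0.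
by rewrite add0r; apply: (scvg_le ul); exact: uz.
Qed.

Lemma opnorm_has_sup (T : V -> V) M : (forall x, rnorm (T x) <= M * rnorm x) ->
  has_sup [set rnorm (T x) | x in [set x : V | rnorm x <= 1]].
Proof.
move=> h; split; first by exists (rnorm (T 0)), 0 => //=; rewrite rnorm0.
exists `|M| => _ [x /= x1 <-]; apply: (le_trans (h x)).
apply: (@le_trans _ _ (`|M| * rnorm x)).
  by rewrite ler_wpM2r ?rnorm_ge0// ler_norm.
by rewrite ler_piMr.
Qed.

Lemma opnorm_ge0 (T : V -> V) : 0 <= opnorm T.
Proof.
rewrite /opnorm; set S := (X in sup X).
have [h|h] := pselect (has_sup S); last by rewrite sup_out.
have S0 : S (rnorm (T 0)) by exists 0 => //=; rewrite rnorm0.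
exact: le_trans (rnorm_ge0 _) (ub_le_sup h.2 S0).
Qed.

Lemma opnorm_le (T : V -> V) M : 0 <= M ->
  (forall x, rnorm (T x) <= M * rnorm x) -> opnorm T <= M.
Proof.
move=> M0 h; apply: ge_sup; first exact: (opnorm_has_sup h).1.
by move=> _ [x /= x1 <-]; rewrite (le_trans (h x))// ler_piMr.
Qed.

Lemma le_opnorm (T : V -> V) M : (forall (k : R[i]) x, T (k *: x) = k *: T x) ->
  (forall x, rnorm (T x) <= M * rnorm x) ->
  forall x, rnorm (T x) <= opnorm T * rnorm x.
Proof.
move=> TZ h x; have [x0|xn0] := eqVneq (rnorm x) 0.
  by rewrite (le_trans (h x))// x0 !mulr0.
have xp : 0 < rnorm x by rewrite lt_def xn0 rnorm_ge0.
have kx : cabs (rnorm x)^-1%:C%C = (rnorm x)^-1 by rewrite cabsR ger0_norm// invr_ge0 ltW.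
rewrite -ler_pdivrMr// mulrC -kx -rnormZ -TZ; apply: ub_le_sup.
  exact: (opnorm_has_sup h).2.
by eexists; last reflexivity; rewrite /= rnormZ kx mulVf.
Qed.

End RealNorm.

Lemma scvg_complete (R : realType) (V : completeNormedModType R[i]) (u : nat -> V) :
  (forall e : R, 0 < e -> exists N, forall m n, (N <= m)%N -> (N <= n)%N ->
     rnorm (u m - u n) <= e) -> exists l, scvg u l.
Proof.
move=> cu; have : cvgn u.
  apply: cauchy_cvg; apply: cauchy_exP => e e0.
  have [f f0 ef] : exists2 f : R, 0 < f & e = f%:C%C.
    by move: e0; case: e => x y; rewrite ltcE /= => /andP[/eqP -> ?]; exists x.
  have [N HN] := cu (f / 2) ltac:(by rewrite divr_gt0).
  exists (u N); exists N => // n /= Nn; rewrite -ball_normE /= rnormE ef ltcR.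
  by rewrite (le_lt_trans (HN _ _ _ Nn))// ltr_pdivrMr// ltr_pMr// ltr1n.
move=> /cvg_ex[l ul]; exists l => e e0.
have e0' : 0 < e%:C%C :> R[i] by rewrite ltcR.
move/cvgrPdist_lt : ul => /(_ _ e0')[N _ HN]; exists N => n Nn.
by have := HN n Nn; rewrite /= rnormE ltcR rnorm_distC => /ltW.
Qed.

Section HilbertBasics.
Variables (R : realType) (H : hilbertType R).
Implicit Types (x y z : H) (I : finType).

Lemma dot_ge0 x : 0 <= dot x x.
Proof. by rewrite dot_norm exprn_ge0. Qed.

Definition dot_sip : semi_inner H := SemiInner (@dotDr R H) (@dotZr R H) (@dotC R H) dot_ge0.

Lemma dotDl x y z : dot (x + y) z = dot x z + dot y z.
Proof. exact: (sipDl dot_sip). Qed.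
Lemma dotZl (a : R[i]) x y : dot (a *: x) y = a^* * dot x y.
Proof. exact: (sipZl dot_sip). Qed.
Lemma dotBr x y z : dot x (y - z) = dot x y - dot x z.
Proof. exact: (sipBr dot_sip). Qed.
Lemma dotBl x y z : dot (x - y) z = dot x z - dot y z.
Proof. exact: (sipBl dot_sip). Qed.
Lemma dot0r x : dot x 0 = 0.
Proof. exact: (sip0r dot_sip). Qed.
Lemma dot0l x : dot 0 x = 0.
Proof. exact: (sip0l dot_sip). Qed.

Lemma dot_sumr (I : Type) (r : seq I) (P : pred I) (F : I -> H) x :
  dot x (\sum_(i <- r | P i) F i) = \sum_(i <- r | P i) dot x (F i).
Proof. by apply: (big_morph (dot x)); [exact: dotDr|exact: dot0r]. Qed.

Lemma dot_suml (I : Type) (r : seq I) (P : pred I) (F : I -> H) x :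
  dot (\sum_(i <- r | P i) F i) x = \sum_(i <- r | P i) dot (F i) x.
Proof. by apply: (big_morph (dot^~ x)) => [y z|]; [exact: dotDl|exact: dot0l]. Qed.

Lemma dotxx x : dot x x = (rnorm x ^+ 2)%:C%C.
Proof. by rewrite dot_norm rnormE -rmorphXn. Qed.

Lemma rnorm_sqr x : rnorm x ^+ 2 = complex.Re (dot x x).
Proof. by rewrite dotxx. Qed.

Lemma dot_cs x y : cabs (dot x y) <= rnorm x * rnorm y.
Proof.
have h z : sip_norm dot_sip z = (rnorm z)%:C%C.
  apply/eqP; rewrite -(eqrXn2 (n := 2)) ?sip_norm_ge0 ?ler0c ?rnorm_ge0//.
  by rewrite sip_normK /= dotxx rmorphXn.
by rewrite -lecR rmorphM /= -cabsE -!h; exact: (sip_cs dot_sip).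
Qed.

Lemma cabs_dotC x y : cabs (dot x y) = cabs (dot y x).
Proof. by rewrite dotC cabsJ. Qed.

Lemma dot_nondeg x y : (forall z, dot z x = dot z y) -> x = y.
Proof.
move=> h; apply/eqP; rewrite -subr_eq0; apply/eqP/rnorm_eq0/eqP.
by rewrite -sqrf_eq0 rnorm_sqr dotBr h subrr.
Qed.

Lemma rnorm_le_dot x c : 0 <= c -> (forall z, cabs (dot z x) <= c * rnorm z) -> rnorm x <= c.
Proof.
move=> c0 h; have := h x; rewrite dotxx cabsR ger0_norm ?sqr_ge0// expr2.
have [->|xn0] := eqVneq (rnorm x) 0; first by [].
by rewrite ler_pM2r// lt_def xn0 rnorm_ge0.
Qed.

Definition orthonormal I (v : I -> H) := forall i j, dot (v i) (v j) = (i == j)%:R.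

Definition bessel I (v : I -> H) :=
  forall x, \sum_i cabs (dot (v i) x) ^+ 2 <= rnorm x ^+ 2.

Definition spanned I (v : I -> H) x := x = \sum_i dot (v i) x *: v i.

Lemma dot_spanned I (v : I -> H) x y : spanned v x ->
  dot y x = \sum_i dot (v i) x * dot y (v i).
Proof. by move=> hx; rewrite {1}hx dot_sumr; apply: eq_bigr => i _; rewrite dotZr. Qed.

Lemma dot_spannedl I (v : I -> H) x y : spanned v x ->
  dot x y = \sum_i (dot (v i) x)^* * dot (v i) y.
Proof.
move=> hx; rewrite {1}hx dot_suml; apply: eq_bigr => i _.
by rewrite dotZl.
Qed.

Lemma rnorm_spanned I (v : I -> H) x : spanned v x ->
  rnorm x ^+ 2 = \sum_i cabs (dot (v i) x) ^+ 2.
Proof.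
move=> hx; apply: complexI; rewrite -dotxx (dot_spannedl _ hx) rmorph_sum /=.
by apply: eq_bigr => i _; rewrite cabs_sqr.
Qed.

Lemma orthonormal_proj I (v : I -> H) x : orthonormal v -> forall j,
  dot (v j) (\sum_i dot (v i) x *: v i) = dot (v j) x.
Proof.
move=> hv j; rewrite dot_sumr (bigD1 j)//= dotZr hv eqxx mulr1 big1 ?addr0// => i ij.
by rewrite dotZr hv eq_sym (negbTE ij) mulr0.
Qed.

Lemma orthonormal_residual I (v : I -> H) x : orthonormal v ->
  rnorm (x - \sum_i dot (v i) x *: v i) ^+ 2 =
  rnorm x ^+ 2 - \sum_i cabs (dot (v i) x) ^+ 2.
Proof.
move=> hv; set y := \sum_i _.
have sy : spanned v y by rewrite /spanned {1}/y; apply: eq_bigr => i _; rewrite orthonormal_proj.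
have e1 : dot y y = (\sum_i cabs (dot (v i) x) ^+ 2)%:C%C.
  rewrite dotxx (rnorm_spanned sy); congr (_%:C%C); apply: eq_bigr => i _.
  by rewrite orthonormal_proj.
have e2 : dot y x = dot y y.
  rewrite !(dot_spannedl _ sy); apply: eq_bigr => i _.
  by rewrite orthonormal_proj.
have e3 : dot x y = dot y y by rewrite dotC e2 {1}e1 conjR -e1.
apply: complexI; rewrite -dotxx dotBr !dotBl e2 e3 subrr subr0 e1 dotxx -rmorphB //.
Qed.

Lemma orthonormal_bessel I (v : I -> H) : orthonormal v -> bessel v.
Proof. by move=> hv x; rewrite -subr_ge0 -orthonormal_residual// sqr_ge0. Qed.

Lemma orthonormal_norm I (v : I -> H) i : orthonormal v -> rnorm (v i) = 1.
Proof.
move=> hv; apply/eqP; rewrite -(eqrXn2 (n := 2)) ?rnorm_ge0// rnorm_sqr hv eqxx.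
by rewrite expr1n.
Qed.

Lemma bessel_norm I (v : I -> H) i : bessel v -> rnorm (v i) <= 1.
Proof.
move=> /(_ (v i)) h; have [->//|n0] := eqVneq (rnorm (v i)) 0.
have p0 : 0 < rnorm (v i) ^+ 2 by rewrite exprn_gt0// lt_def n0 rnorm_ge0.
have : (rnorm (v i) ^+ 2) ^+ 2 <= rnorm (v i) ^+ 2.
  apply: le_trans h; rewrite (bigD1 i)//= dotxx cabsR ger0_norm ?sqr_ge0//.
  by rewrite lerDl sumr_ge0// => j _; rewrite sqr_ge0.
by rewrite expr2 ger_pMr// expr_le1// rnorm_ge0.
Qed.

(** The bound on m later bounds a rank, in [trace_small]. *)
Lemma gram_schmidt (s : seq H) : exists m (v : 'I_m -> H),
  [/\ (m <= size s)%N, orthonormal v & forall x, x \in s -> spanned v x].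
Proof.
elim: s => [|x s [m [v [ms hv vs]]]].
  by exists 0%N, (fun=> 0); split=> // -[].
pose r := x - \sum_i dot (v i) x *: v i.
have xE : x = r + \sum_i dot (v i) x *: v i by rewrite /r subrK.
have vr i : dot (v i) r = 0 by rewrite /r dotBr orthonormal_proj// subrr.
have [r0|rn0] := eqVneq (rnorm r) 0.
  exists m, v; split=> //; first exact: leqW.
  move=> y; rewrite inE => /predU1P[->|]; last exact: vs.
  by rewrite /spanned {1}xE (rnorm_eq0 r0) add0r.
pose w := ((rnorm r)^-1)%:C%C *: r.
have ww : dot w w = 1.
  rewrite /w dotZr dotZl dotxx conjR -!rmorphM /=.
  by have -> : (rnorm r)^-1 * ((rnorm r)^-1 * rnorm r ^+ 2) = 1 by field.
have vw i : dot (v i) w = 0 by rewrite /w dotZr vr mulr0.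
have wv i : dot w (v i) = 0 by rewrite dotC vw conjC0.
pose u (i : 'I_m.+1) := if unlift ord0 i is Some j then v j else w.
have u0 : u ord0 = w by rewrite /u unlift_none.
have uS j : u (lift ord0 j) = v j by rewrite /u liftK.
have hu : orthonormal u.
  move=> i j; case: (unliftP ord0 i) => [i' ->|->]; case: (unliftP ord0 j) => [j' ->|->];
  rewrite ?u0 ?uS ?vw ?wv ?ww ?eqxx ?hv ?(inj_eq lift_inj)//.
exists m.+1, u; split=> //.
move=> y; rewrite inE /spanned big_ord_recl u0 => /predU1P[->|ys].
  under eq_bigr do rewrite uS.
  rewrite {1}xE; congr (_ + _).
  rewrite xE dotDr dot_sumr big1 ?addr0 => [|i _]; last by rewrite dotZr wv mulr0.
  rewrite /w dotZl dotxx conjR scalerA -!rmorphM /=.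
  have -> : (rnorm r)^-1 * rnorm r ^+ 2 * (rnorm r)^-1 = 1 by field.
  by rewrite scale1r.
under eq_bigr do rewrite uS.
rewrite {2}(vs _ ys) dot_sumr big1 => [|i _]; last by rewrite dotZr wv mulr0.
by rewrite scale0r add0r; exact: vs.
Qed.

Lemma sumM_le_sqr I (a b : I -> R) A B : 0 <= A -> 0 <= B ->
  (forall i, 0 <= a i) -> (forall i, 0 <= b i) ->
  \sum_i a i ^+ 2 <= A ^+ 2 -> \sum_i b i ^+ 2 <= B ^+ 2 ->
  \sum_i a i * b i <= A * B.
Proof.
move=> A0 B0 a0 b0 ha hb.
have h2 : 2^-1 + 2^-1 = 1^-1 :> R by field.
have P (c : I -> R) n : (forall i, 0 <= c i) ->
    \sum_i c i `^ n%:R = \sum_i c i ^+ n.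
  by move=> c0; apply: eq_bigr => i _; rewrite powR_mulrn.
have := @sum_hoelder R I a b 2 2 1 A B (ltr0Sn _ _) (ltr0Sn _ _) ltr01 h2 A0 B0 a0 b0.
rewrite !P// !powR_mulrn// (P _ 1%N) => [/(_ ha hb)|i]; last by rewrite mulr_ge0.
by rewrite powRr1 ?mulr_ge0//; under eq_bigr do rewrite expr1.
Qed.

End HilbertBasics.

(** * Adjoint pairs of bounded operators, and polynomials in an operator *)

Section BoundedOperators.
Variables (R : realType) (H : hilbertType R).
Implicit Types (x y z : H) (Q S T B F G : H -> H) (c : R) (q r : {poly R}).

Definition bnd c Q := forall x, rnorm (Q x) <= c * rnorm x.

(** The adjoint is carried along as an argument. Having one already forces linearity ([adj_linear]),
    so that only boundedness is added. *)
Definition bop Q Q' := is_adjoint dot Q Q' /\ exists c, bnd c Q.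

Lemma adj_dotr Q Q' x y : is_adjoint dot Q Q' -> dot x (Q y) = dot (Q' x) y.
Proof. by move=> h; rewrite dotC h -dotC. Qed.

Lemma adj_sym Q Q' : is_adjoint dot Q Q' -> is_adjoint dot Q' Q.
Proof. by move=> h x y; rewrite (adj_dotr _ _ h). Qed.

Lemma adj_linear Q Q' a x y : is_adjoint dot Q Q' -> Q (a *: x + y) = a *: Q x + Q y.
Proof.
move=> h; apply: dot_nondeg => z.
by rewrite dotDr dotZr !(adj_dotr _ _ h) dotDr dotZr.
Qed.

Lemma adjD Q Q' x y : is_adjoint dot Q Q' -> Q (x + y) = Q x + Q y.
Proof. by move=> h; have := adj_linear 1 x y h; rewrite !scale1r. Qed.

Lemma adj0 Q Q' : is_adjoint dot Q Q' -> Q 0 = 0.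
Proof. by move=> h; apply: dot_nondeg => z; rewrite (adj_dotr _ _ h) !dot0r. Qed.

Lemma adjZ Q Q' a x : is_adjoint dot Q Q' -> Q (a *: x) = a *: Q x.
Proof. by move=> h; have := adj_linear a x 0 h; rewrite !addr0 (adj0 h) addr0. Qed.

Lemma adjB Q Q' x y : is_adjoint dot Q Q' -> Q (x - y) = Q x - Q y.
Proof. by move=> h; rewrite (adjD _ _ h) -scaleN1r (adjZ _ _ h) scaleN1r. Qed.

Lemma adj_sum Q Q' (I : Type) (s : seq I) (P : pred I) (f : I -> H) :
  is_adjoint dot Q Q' -> Q (\sum_(i <- s | P i) f i) = \sum_(i <- s | P i) Q (f i).
Proof. by move=> h; apply: (big_morph Q) => [x y|]; [exact: adjD h|exact: adj0 h]. Qed.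

Lemma bnd_adj Q Q' c : 0 <= c -> is_adjoint dot Q Q' -> bnd c Q -> bnd c Q'.
Proof.
move=> c0 h b x; apply: rnorm_le_dot; first by rewrite mulr_ge0 ?rnorm_ge0.
move=> z; rewrite -h (le_trans (dot_cs _ _))// mulrAC ler_wpM2r ?rnorm_ge0//.
Qed.

Lemma bnd_ge0 Q c : bnd c Q -> bnd `|c| Q.
Proof. by move=> h x; rewrite (le_trans (h x))// ler_wpM2r ?rnorm_ge0 ?ler_norm. Qed.

Lemma bndW c d Q : c <= d -> bnd c Q -> bnd d Q.
Proof. by move=> cd h x; rewrite (le_trans (h x))// ler_wpM2r ?rnorm_ge0. Qed.

Lemma bop_sym Q Q' : bop Q Q' -> bop Q' Q.
Proof.
move=> [h [c /bnd_ge0 b]]; split; first exact: adj_sym.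
by exists `|c|; apply: bnd_adj h b.
Qed.

Lemma bop_opnorm Q Q' : bop Q Q' -> bnd (opnorm Q) Q.
Proof. by move=> [h [c b]]; apply: le_opnorm b => k x; apply: adjZ h. Qed.

Lemma bnd_comp c d Q S : 0 <= c -> bnd c Q -> bnd d S -> bnd (c * d) (Q \o S).
Proof.
by move=> c0 bQ bS x; rewrite /= (le_trans (bQ _))// -mulrA ler_wpM2l.
Qed.

Lemma bop_comp Q Q' S S' : bop Q Q' -> bop S S' -> bop (Q \o S) (S' \o Q').
Proof.
move=> [hQ [c bQ]] [hS [d bS]]; split; first by move=> x y; rewrite /= hQ hS.
by exists (`|c| * d); apply: bnd_comp => //; exact: bnd_ge0.
Qed.

Lemma bop_id : bop id id.
Proof. by split=> //; exists 1 => x; rewrite mul1r. Qed.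

Lemma bopD Q Q' S S' : bop Q Q' -> bop S S' ->
  bop (fun x => Q x + S x) (fun x => Q' x + S' x).
Proof.
move=> [hQ [c bQ]] [hS [d bS]]; split.
  by move=> x y; rewrite dotDl dotDr hQ hS.
by exists (c + d) => x; rewrite mulrDl (le_trans (rnormD _ _))// lerD.
Qed.

Lemma bopZ a Q Q' : bop Q Q' -> bop (fun x => a *: Q x) (fun x => a^* *: Q' x).
Proof.
move=> [hQ [c bQ]]; split; first by move=> x y; rewrite dotZl dotZr hQ.
by exists (cabs a * c) => x; rewrite rnormZ -mulrA ler_wpM2l ?cabs_ge0.
Qed.

Lemma bopB Q Q' S S' : bop Q Q' -> bop S S' ->
  bop (fun x => Q x - S x) (fun x => Q' x - S' x).
Proof.
move=> bQ bS; have := bopD bQ (bopZ (-1) bS).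
rewrite rmorphN rmorph1.
by congr bop; apply/funext => x; rewrite scaleN1r.
Qed.

Lemma adjoint_dotE Q Q' : is_adjoint dot Q Q' -> adjoint dot Q = Q'.
Proof.
move=> h; rewrite /adjoint; apply: xget_unique => // S hS.
by apply/funext => x; apply: dot_nondeg => z; rewrite -h hS.
Qed.

Definition posop B := bop B B /\ forall x, 0 <= dot x (B x).

Lemma posop_sqr Q Q' : bop Q Q' -> posop (Q' \o Q).
Proof.
move=> bQ; split; first exact: bop_comp (bop_sym bQ) bQ.
by move=> x /=; rewrite -bQ.1 dot_ge0.
Qed.

Lemma poly_operatorE n q B x : (size q <= n)%N ->
  poly_operator q B x = \sum_(i < n) (q`_i)%:C%C *: iter i B x.
Proof.
move=> sn; rewrite /poly_operator (big_ord_widen _ (fun i => (q`_i)%:C%C *: iter i B x) sn).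
rewrite big_mkcond /=; apply: eq_bigr => i _.
by case: ltnP => // h; rewrite nth_default// scale0r.
Qed.

Lemma poly_operatorD q r B x :
  poly_operator (q + r) B x = poly_operator q B x + poly_operator r B x.
Proof.
pose n := maxn (size (q + r)) (maxn (size q) (size r)).
rewrite !(@poly_operatorE n) ?leq_max ?leqnn ?orbT//.
rewrite -big_split /=; apply: eq_bigr => i _.
by rewrite coefD rmorphD /= scalerDl.
Qed.

Lemma poly_operatorZ (a : R) q B x :
  poly_operator (a *: q) B x = a%:C%C *: poly_operator q B x.
Proof.
rewrite !(@poly_operatorE (size q)) ?size_scale_leq// scaler_sumr.
by apply: eq_bigr => i _; rewrite coefZ rmorphM /= scalerA.
Qed.

Lemma poly_operatorC (a : R) B x : poly_operator a%:P B x = a%:C%C *: x.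
Proof.
by rewrite (@poly_operatorE 1) ?size_polyC ?leq_b1// big_ord1 coefC.
Qed.

Lemma poly_operatorMX q B x : poly_operator (q * 'X) B x = poly_operator q B (B x).
Proof.
rewrite (@poly_operatorE (size q).+1) ?(leq_trans (size_polyMleq _ _)) ?size_polyX ?addn2//.
rewrite big_ord_recl coefMX eqxx scale0r add0r.
by rewrite (@poly_operatorE (size q))//; apply: eq_bigr => i _; rewrite coefMX -iterSr.
Qed.

Lemma poly_operator_adj q B : is_adjoint dot B B ->
  is_adjoint dot (poly_operator q B) (poly_operator q B).
Proof.
move=> h x y; rewrite /poly_operator dot_suml dot_sumr; apply: eq_bigr => i _.
rewrite dotZl dotZr conjR; congr (_ * _).
elim: (i : nat) x y => // k IH x y; rewrite iterSr IH.
by rewrite h -iterS.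
Qed.

(** Even polynomials in |T| are polynomials in T^* T, and these already make sense on the Hilbert
    module. *)
Lemma poly_operator_sqr q B x :
  poly_operator (q \Po ('X * 'X)) B x = poly_operator q (B \o B) x.
Proof.
elim/poly_ind: q x => [|q c IH] x.
  by rewrite comp_poly0 /poly_operator size_poly0 !big_ord0.
rewrite comp_polyD comp_polyC comp_polyM comp_polyX mulrA.
by rewrite !(poly_operatorD, poly_operatorC, poly_operatorMX) IH.
Qed.

End BoundedOperators.

(** * Functional calculus *)

Section Krylov.
Variables (R : realType) (H : hilbertType R).
Implicit Types (x y z : H) (B F G : H -> H) (f g : R -> R).

(** The spectral theorem for the Hermitian matrix of the compression of [B] to the span of [u]; its
    unitary matrix changes [u] into [v]. *)
Lemma diagonalize B m (u : 'I_m -> H) : posop B -> orthonormal u ->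
  exists2 v : 'I_m -> H, orthonormal v &
    [/\ forall i j, i != j -> dot (v i) (B (v j)) = 0
      & forall x, spanned u x -> spanned v x].
Proof.
move=> [bB Bge0] hu; pose M := \matrix_(i, j) dot (u i) (B (u j)).
have nM : M \is normalmx.
  apply: hermitian_normalmx; apply/is_hermitianmxP.
  rewrite expr0 scale1r; apply/matrixP => i j; rewrite !mxE.
  by rewrite -dotC bB.1.
have /orthomx_spectralP := nM; set P := spectralmx M; set D := spectral_diag M.
have uP : P \is unitarymx by exact: spectral_unitarymx.
move=> ME.
have PMP : P *m M *m (map_mx Num.conj (trmx P)) = diag_mx D.
  rewrite ME !mulmxA mulmxV ?unitarymx_unit// mul1mx -mulmxA.
  by rewrite (unitarymxP uP) mulmx1.
have PP : P *m (map_mx Num.conj (trmx P)) = 1%:M by exact: unitarymxP.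
have PP' : (map_mx Num.conj (trmx P)) *m P = 1%:M by rewrite -invmx_unitary// mulVmx// unitarymx_unit.
(* [dot] is conjugate-linear on the left, so the conjugates here give [dot (v k)] the coefficients
   [P k i] themselves. *)
pose v k := \sum_i (P k i)^* *: u i.
have dotv k x : dot (v k) x = \sum_i P k i * dot (u i) x.
  by rewrite dot_suml; apply: eq_bigr => i _; rewrite dotZl conjCK.
exists v.
  move=> k l; rewrite dotv; have /matrixP/(_ k l) := PP; rewrite !mxE => <-.
  apply: eq_bigr => i _; rewrite !mxE dot_sumr (bigD1 i)//= dotZr hu eqxx mulr1.
  by rewrite big1 ?addr0// => j ji; rewrite dotZr hu eq_sym (negbTE ji) mulr0.
split=> [k l kl|x xu].
  have /matrixP/(_ k l) := PMP; rewrite !mxE (negbTE kl) mulr0n => <-.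
  rewrite dotv [B (v l)](adj_sum _ _ _ bB.1).
  under eq_bigr do rewrite dot_sumr mulr_sumr.
  rewrite exchange_big /=; apply: eq_bigr => j _; rewrite !mxE mulr_suml.
  apply: eq_bigr => i _; rewrite !mxE (adjZ _ _ bB.1) dotZr; ring.
rewrite /spanned {1}xu.
under [RHS]eq_bigr => k _.
  rewrite dotv /v scaler_sumr.
  under eq_bigr do rewrite scalerA mulr_suml scaler_suml.
  over.
rewrite exchange_big /=.
have -> : \sum_j \sum_i \sum_i0 (P i i0 * dot (u i0) x * (P i j)^*) *: u j =
   \sum_j \sum_i0 (\sum_i ((P i j)^* * P i i0)) *: (dot (u i0) x *: u j).
  apply: eq_bigr => j _; rewrite exchange_big /=; apply: eq_bigr => i0 _.
  by rewrite scaler_suml; apply: eq_bigr => i _; rewrite scalerA; congr (_ *: _); ring.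
have PPs j i : \sum_k (P k j)^* * P k i = (j == i)%:R.
  have /matrixP/(_ j i) := PP'; rewrite !mxE => <-.
  by apply: eq_bigr => k _; rewrite !mxE.
apply: eq_bigr => j _; rewrite (bigD1 j)//= PPs eqxx scale1r big1 ?addr0// => i ij.
by rewrite PPs eq_sym (negbTE ij) scale0r.
Qed.

End Krylov.

(** * The continuous functional calculus of a positive operator *)

Section FunctionalCalculus.
Variables (R : realType) (H : hilbertType R) (B : H -> H).
Hypothesis pB : posop B.
Local Notation M := (opnorm B).
Implicit Types (x y z : H) (F G : H -> H) (f g h : R -> R) (q : {poly R}) (c e : R).

(** The span of the iterates up to degree d contains the image under [B] of every iterate of lower
    degree. On those iterates [B] agrees with its compression, which [diagonalize] makes
    diagonal. *)
Lemma krylov (es : seq H) d : exists m (v : 'I_m -> H) (l : 'I_m -> R),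
  [/\ orthonormal v, forall j, 0 <= l j <= M, forall j, dot (v j) (B (v j)) = (l j)%:C%C
    & forall x, x \in es -> forall k, (k <= d)%N -> spanned v (iter k B x) /\
        forall j, dot (v j) (iter k B x) = (l j ^+ k)%:C%C * dot (v j) x].
Proof.
have [bB B0] := pB.
have [m [u [_ hu us]]] := gram_schmidt [seq iter k B x | x <- es, k <- iota 0 d.+1].
have [v hv [vB vs]] := diagonalize pB hu.
exists m, v, (fun j => complex.Re (dot (v j) (B (v j)))).
have lE j : dot (v j) (B (v j)) = (complex.Re (dot (v j) (B (v j))))%:C%C by rewrite ge0_RRe.
have sp x k : x \in es -> (k <= d)%N -> spanned v (iter k B x).
  by move=> xes kd; apply/vs/us/allpairs_f => //; rewrite mem_iota.
split=> // [j|x xes k kd].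
  rewrite -ler0c -lE B0 /= -lecR -lE -(ger0_norm (B0 _)) cabsE lecR.
  apply: (le_trans (dot_cs _ _)); rewrite (orthonormal_norm _ hv) mul1r.
  by rewrite (le_trans (bop_opnorm bB _))// (orthonormal_norm _ hv) mulr1.
split=> [|j]; first exact: sp.
elim: k kd => [|k IH] kd; first by rewrite expr0 mul1r.
rewrite iterS (adj_dotr _ _ bB.1) (dot_spanned _ (sp _ _ xes (ltnW kd))) (bigD1 j)//=.
rewrite big1 ?addr0 => [|i ij]; last first.
  by rewrite bB.1 vB ?mulr0// eq_sym.
by rewrite bB.1 lE IH ?(ltnW kd)// exprS rmorphM /=; ring.
Qed.

Lemma krylov_poly (es : seq H) d : exists m (v : 'I_m -> H) (l : 'I_m -> R),
  [/\ orthonormal v, forall j, 0 <= l j <= M, forall j, dot (v j) (B (v j)) = (l j)%:C%C,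
      forall x, x \in es -> spanned v x
    & forall x q, x \in es -> (size q <= d)%N ->
        poly_operator q B x = \sum_j ((q.[l j])%:C%C * dot (v j) x) *: v j].
Proof.
have [m [v [l [hv hl vl hx]]]] := krylov es d.
exists m, v, l; split=> // [x /hx/(_ 0%N isT)[]//|x q xes sq].
rewrite /poly_operator.
have step (i : 'I_(size q)) : iter i B x = \sum_j ((l j ^+ i)%:C%C * dot (v j) x) *: v j.
  have [s dE] := hx x xes i (leq_trans (ltnW (ltn_ord i)) sq).
  by rewrite {1}s; apply: eq_bigr => j _; rewrite dE.
under eq_bigr do rewrite step scaler_sumr.
rewrite exchange_big /=; apply: eq_bigr => j _.
rewrite horner_coef rmorph_sum mulr_suml scaler_suml; apply: eq_bigr => i _.
by rewrite scalerA rmorphM mulrA.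
Qed.

Lemma rnorm_orthonormal_sum (I : finType) (v : I -> H) (a : I -> R[i]) : orthonormal v ->
  rnorm (\sum_j a j *: v j) ^+ 2 = \sum_j cabs (a j) ^+ 2.
Proof.
move=> hv; have dE j : dot (v j) (\sum_i a i *: v i) = a j.
  rewrite dot_sumr (bigD1 j)//= dotZr hv eqxx mulr1 big1 ?addr0// => i ij.
  by rewrite dotZr hv eq_sym (negbTE ij) mulr0.
rewrite rnorm_sqr dot_suml Re_sum; apply: eq_bigr => j _.
by rewrite dotZl dE -cabs_sqr.
Qed.

Local Notation fcal f F := (is_fun_calculus f B F).
Local Notation diag v l f x := (\sum_j ((f (l j))%:C%C * dot (v j) x) *: v j).

Lemma diag_dist m (v : 'I_m -> H) (l : 'I_m -> R) f g x e : orthonormal v -> 0 <= e ->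
  (forall j, `|f (l j) - g (l j)| <= e) ->
  rnorm (diag v l f x - diag v l g x) <= e * rnorm x.
Proof.
move=> hv e0 fg.
have -> : diag v l f x - diag v l g x = \sum_j ((f (l j) - g (l j))%:C%C * dot (v j) x) *: v j.
  rewrite -sumrB; apply: eq_bigr => j _.
  by rewrite -scalerBl -mulrBl -rmorphB.
rewrite -(@ler_pXn2r _ 2) ?nnegrE ?rnorm_ge0 ?mulr_ge0 ?rnorm_ge0//.
rewrite rnorm_orthonormal_sum// exprMn.
apply: (@le_trans _ _ (\sum_j e ^+ 2 * cabs (dot (v j) x) ^+ 2)).
  apply: ler_sum => j _; rewrite cabsM exprMn ler_wpM2r ?sqr_ge0//.
  by rewrite cabsR ler_pXn2r ?nnegrE.
by rewrite -mulr_sumr ler_wpM2l ?sqr_ge0//; exact: orthonormal_bessel.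
Qed.

Lemma fcal_approx f F e : fcal f F -> 0 < e -> exists2 q,
  forall t, 0 <= t <= M -> `|q.[t] - f t| <= e &
  forall x, rnorm (poly_operator q B x - F x) <= e * rnorm x.
Proof.
move=> [q [qf qF]] e0; have [n [h1 h2]] := filter_ex (filterI (qf e e0) (qF e e0)).
by exists (q n).
Qed.

(** Up to e, finitely many functions of [B] act on finitely many vectors like one diagonal matrix
    with entries in the spectral interval. The rules of the calculus are checked on these
    entries. *)
Lemma fcal_diag (fs : seq ((R -> R) * (H -> H))) (es : seq H) e :
  (forall fF, List.In fF fs -> fcal fF.1 fF.2) -> 0 < e ->
  exists m (v : 'I_m -> H) (l : 'I_m -> R),
  [/\ orthonormal v, forall j, 0 <= l j <= M, forall j, dot (v j) (B (v j)) = (l j)%:C%C,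
      forall x, x \in es -> spanned v x
    & forall fF x, List.In fF fs -> x \in es ->
        rnorm (fF.2 x - diag v l fF.1 x) <= e * rnorm x].
Proof.
move=> hfs e0; have e20 : 0 < e / 2 by rewrite divr_gt0.
have [d hd] : exists d, forall fF, List.In fF fs -> exists q, [/\ (size q <= d)%N,
    forall t, 0 <= t <= M -> `|q.[t] - fF.1 t| <= e / 2 &
    forall x, rnorm (poly_operator q B x - fF.2 x) <= e / 2 * rnorm x].
  elim: fs hfs => [|a fs IH] hfs; first by exists 0%N.
  have [d hd] := IH (fun fF i => hfs fF (or_intror i)).
  have [q q1 q2] := fcal_approx (hfs a (or_introl erefl)) e20.
  exists (maxn (size q) d) => fF /= [<-|/hd[r [r1 r2 r3]]].
    by exists q; split=> //; rewrite leq_maxl.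
  by exists r; split=> //; rewrite (leq_trans r1)// leq_maxr.
have [m [v [l [hv hl vl vs vq]]]] := krylov_poly es d.
exists m, v, l; split=> // fF x /hd[q [sq q1 q2]] xes.
rewrite (le_trans (rnorm_triB _ (poly_operator q B x) _))//.
rewrite [X in _ <= X * _](splitr e) mulrDl lerD//; first by rewrite rnorm_distC.
rewrite (vq x q)//; apply: (diag_dist (f := fun t => q.[t])) => //; first exact: ltW.
by move=> j; exact: q1.
Qed.

Lemma fcal_poly q : fcal (fun t => q.[t]) (poly_operator q B).
Proof.
exists (fun=> q); split=> e e0; exists 0%N => // n _ /=.
  by move=> t _; rewrite subrr normr0 ltW.
by move=> x; rewrite subrr rnorm0 mulr_ge0 ?rnorm_ge0// ltW.
Qed.

Lemma fcal_ext f g F : (forall t, 0 <= t <= M -> f t = g t) -> fcal f F -> fcal g F.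
Proof.
move=> fg [q [h1 h2]]; exists q; split=> // e /h1; apply: filterS => n h t ht.
by rewrite -fg// h.
Qed.

Lemma fcal_1 : fcal (fun=> 1) id.
Proof.
have := fcal_poly 1%:P.
rewrite (_ : poly_operator _ _ = id); last first.
  by apply/funext => x; rewrite poly_operatorC scale1r.
by apply: fcal_ext => t _; rewrite hornerC.
Qed.

Lemma fcal_id : fcal id B.
Proof.
have := fcal_poly 'X.
rewrite (_ : poly_operator _ _ = B); last first.
  by apply/funext => x; rewrite -['X]mul1r poly_operatorMX poly_operatorC scale1r.
by apply: fcal_ext => t _; rewrite hornerX.
Qed.

(** With one factor on each side of the inner product, self-adjointness is the case [g = 1] and the
    norm of [F x] the case [f = g]. The identity is exact for the diagonal sums, so only
    approximation errors remain. *)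
Lemma fcal_mul f g h F G K : fcal f F -> fcal g G -> fcal h K ->
  (forall t, 0 <= t <= M -> f t * g t = h t) ->
  forall x y, dot (F x) (G y) = dot x (K y).
Proof.
move=> hf hg hh fgh x y; apply/eqP; rewrite -subr_eq0; apply/eqP/cabs_eq0/eqP.
rewrite eq_le cabs_ge0 andbT.
(* The sum of the three error terms, divided by e. The restriction e <= 1 serves to bound the
   diagonal approximation of [F x] by [rnorm (F x) + rnorm x]. *)
pose C := rnorm x * rnorm (G y) + (rnorm (F x) + rnorm x) * rnorm y + rnorm x * rnorm y.
have C0 : 0 <= C by rewrite !addr_ge0 ?mulr_ge0 ?addr_ge0 ?rnorm_ge0.
suff key e : 0 < e -> e <= 1 -> cabs (dot (F x) (G y) - dot x (K y)) <= 0 + e * C.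
  apply: (@le_of_epsM _ _ _ C) => // e e0.
  have [e1|/ltW e1] := leP e 1; first exact: key.
  by rewrite (le_trans (key 1 ltr01 (lexx _)))// lerD2l ler_wpM2r.
move=> e0 e1; rewrite add0r.
have [|m [v [l [hv hl _ vs hd]]]] := @fcal_diag [:: (f, F); (g, G); (h, K)] [:: x; y] e _ e0.
  by move=> fF /= [<-|[<-|[<-|[]]]].
have yin : y \in [:: x; y] by rewrite !inE eqxx orbT.
have := hd (f, F) x (or_introl erefl) (mem_head _ _).
have := hd (g, G) y (or_intror (or_introl erefl)) yin.
have := hd (h, K) y (or_intror (or_intror (or_introl erefl))) yin.
have sx := vs x (mem_head _ _).
rewrite /=; set X := diag v l f x; set Y := diag v l g y; set Z := diag v l h y.
move=> dZ dY dX.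
have XY : dot X Y = dot x Z.
  rewrite (dot_spannedl _ sx) /X dot_suml; apply: eq_bigr => j _.
  have dd (k : R -> R) z : dot (v j) (diag v l k z) = (k (l j))%:C%C * dot (v j) z.
    rewrite dot_sumr (bigD1 j)//= dotZr hv eqxx mulr1 big1 ?addr0// => i ij.
    by rewrite dotZr hv eq_sym (negbTE ij) mulr0.
  rewrite dotZl !dd -fgh// !rmorphM /= conjR; ring.
have -> : dot (F x) (G y) - dot x (K y) =
    dot (F x - X) (G y) + dot X (G y - Y) - dot x (K y - Z).
  rewrite dotBl !dotBr XY; ring.
have nX : rnorm X <= rnorm (F x) + rnorm x.
  have -> : X = F x - (F x - X) by rewrite opprB addrC subrK.
  rewrite (le_trans (rnormB _ _))// lerD2l (le_trans dX)//.
  by rewrite ler_piMl ?rnorm_ge0.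
rewrite (le_trans (cabsB _ _))// /C !mulrDr lerD//.
  rewrite (le_trans (cabsD _ _))// lerD//.
    rewrite (le_trans (dot_cs _ _))// mulrA ler_wpM2r ?rnorm_ge0//.
  rewrite (le_trans (dot_cs _ _))//.
  apply: (@le_trans _ _ ((rnorm (F x) + rnorm x) * (e * rnorm y))).
    by apply: ler_pM => //; exact: rnorm_ge0.
  by rewrite le_eqVlt; apply/orP; left; apply/eqP; ring.
rewrite (le_trans (dot_cs _ _))// mulrCA ler_wpM2l ?rnorm_ge0//.
Qed.

Lemma fcal_adj f F : fcal f F -> is_adjoint dot F F.
Proof. by move=> hf x y; apply: (fcal_mul hf fcal_1 hf) => t _; rewrite mulr1. Qed.

Lemma fcal_unique f F G : fcal f F -> fcal f G -> F = G.
Proof.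
move=> hF hG; apply/funext => x; apply: dot_nondeg => z.
rewrite -(fcal_adj hF) -(fcal_adj hG).
rewrite (fcal_mul hF fcal_1 hG)=> [|t _]; last by rewrite mulr1.
by rewrite (fcal_mul hG fcal_1 hG)=> [|t _]; last by rewrite mulr1.
Qed.

Lemma fun_calculusE f F : fcal f F -> fun_calculus f B = F.
Proof.
by move=> h; rewrite /fun_calculus; apply: xget_unique => // G hG; exact: fcal_unique hG h.
Qed.

Lemma fcal_bnd f F c : 0 <= c -> fcal f F ->
  (forall t, 0 <= t <= M -> `|f t| <= c) -> bnd c F.
Proof.
move=> c0 hf fc x; apply: (@le_of_epsM _ _ _ (rnorm x)) => [|e e0].
  exact: rnorm_ge0.
have [|m [v [l [hv hl _ vs hd]]]] := @fcal_diag [:: (f, F)] [:: x] e _ e0.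
  by move=> fF /= [<-|[]].
have := hd (f, F) x (or_introl erefl) (mem_head _ _); rewrite /= => h.
rewrite -[F x](subrK (diag v l f x)) (le_trans (rnormD _ _))// addrC lerD//.
have -> : diag v l f x = diag v l f x - diag v l (fun=> 0) x.
  by rewrite [X in _ - X]big1 ?subr0// => j _; rewrite mul0r scale0r.
by apply: (diag_dist (g := fun=> 0)) => // j; rewrite subr0 fc.
Qed.

Lemma fcal_bop f F : fcal f F -> bop F F.
Proof.
move=> hf; split; first exact: fcal_adj hf.
have [q q1 q2] := fcal_approx hf ltr01.
have [K K0 HK] := poly_bounded M q.
exists (K + 1); apply: fcal_bnd hf _ => [|t ht]; first by rewrite addr_ge0.
have -> : f t = q.[t] - (q.[t] - f t) by ring.
by rewrite (le_trans (ler_normB _ _))// lerD ?HK ?q1.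
Qed.

Lemma fcal_bnd_dist f g F G c : 0 <= c -> fcal f F -> fcal g G ->
  (forall t, 0 <= t <= M -> `|f t - g t| <= c) -> bnd c (fun x => F x - G x).
Proof.
move=> c0 hf hg fg x; apply: (@le_of_epsM _ _ _ (2 * rnorm x)) => [|e e0].
  by rewrite mulr_ge0 ?rnorm_ge0.
have [|m [v [l [hv hl _ vs hd]]]] := @fcal_diag [:: (f, F); (g, G)] [:: x] e _ e0.
  by move=> fF /= [<-|[<-|[]]].
have := hd (f, F) x (or_introl erefl) (mem_head _ _).
have := hd (g, G) x (or_intror (or_introl erefl)) (mem_head _ _).
have := @diag_dist m v l f g x c hv c0 (fun j => fg _ (hl j)).
rewrite /=; set X := diag v l f x; set Y := diag v l g x => h1 h2 h3.
rewrite (le_trans (rnorm_triB _ X _))// (le_trans (lerD (lexx _) (rnorm_triB _ Y _)))//.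
rewrite (rnorm_distC Y) addrCA mulrCA mulr2n mulrDl mul1r.
by rewrite !lerD.
Qed.

(** Uniformly close polynomials give operators close in norm ([fcal_bnd_dist]), so the polynomial
    approximations form a Cauchy sequence. *)
Lemma fcal_exists f : poly_approx M f -> exists F, fcal f F.
Proof.
move=> af; have i0 (n : nat) : 0 < n.+1%:R^-1 :> R by rewrite invr_gt0.
have /choice[q hq] (n : nat) := af _ (i0 n).
have cau e : 0 < e -> exists N, forall m n, (N <= m)%N -> (N <= n)%N ->
    bnd e (fun x => poly_operator (q m) B x - poly_operator (q n) B x).
  move=> e0; have [N HN] := natSinv_lt (divr_gt0 e0 (ltr0Sn R 1)).
  exists N => m n Nm Nn; apply: (fcal_bnd_dist (ltW e0) (fcal_poly _) (fcal_poly _)) => t ht.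
  have -> : (q m).[t] - (q n).[t] = ((q m).[t] - f t) - ((q n).[t] - f t) by ring.
  rewrite (le_trans (ler_normB _ _))// (splitr e) lerD// (le_trans (hq _ _ ht))//.
    by rewrite ltW// HN.
  by rewrite ltW// HN.
have /choice[F hF] x : exists y, scvg (fun n => poly_operator (q n) B x) y.
  apply: scvg_complete => e e0.
  have [N HN] := cau (e / (rnorm x + 1)) ltac:(by rewrite divr_gt0// ltr_wpDl ?rnorm_ge0).
  exists N => m n Nm Nn; rewrite (le_trans (HN _ _ Nm Nn _))//.
  rewrite -mulrA ger_pMr// mulrC ler_pdivrMr ?mul1r ?lerDl//.
  by rewrite ltr_wpDl ?rnorm_ge0.
exists F, q; split=> e e0.
  have [N HN] := natSinv_lt e0; exists N => // n /= Nn t ht.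
  by rewrite (le_trans (hq _ _ ht))// ltW// HN.
have [N HN] := cau e e0; exists N => // n /= Nn x.
rewrite rnorm_distC; apply: (scvg_le (hF x)); exists N => m Nm.
exact: HN.
Qed.

Lemma fcal_posop f F : fcal f F -> (forall t, 0 <= t <= M -> 0 <= f t) -> posop F.
Proof.
move=> hf f0; split; first exact: fcal_bop hf.
move=> x; have fr : complex.Im (dot x (F x)) = 0.
  have : dot x (F x) = (dot x (F x))^* by rewrite -dotC (fcal_adj hf).
  by case: (dot x (F x)) => a b /= [] /eqP; rewrite eq_sym -subr_eq0 -opprD oppr_eq0 => /eqP; lra.
rewrite [X in _ <= X]complexE fr mulr0 addr0 ler0c.
apply: (@le_of_epsM _ _ _ (rnorm x ^+ 2)); first exact: sqr_ge0.
move=> e e0.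
have [|m [v [l [hv hl _ vs hd]]]] := @fcal_diag [:: (f, F)] [:: x] e _ e0.
  by move=> fF /= [<-|[]].
have := hd (f, F) x (or_introl erefl) (mem_head _ _); rewrite /=.
set X := diag v l f x => h.
have X0 : 0 <= complex.Re (dot x X).
  rewrite dot_sumr Re_sum sumr_ge0// => j _.
  by rewrite dotZr -mulrA ReZ mulr_ge0 ?f0// (dotC (v j) x) mulrC -cabs_sqr /= sqr_ge0.
have : - (e * rnorm x ^+ 2) <= complex.Re (dot x (F x - X)).
  rewrite lerNl (le_trans (ler_norm _))// normrN (le_trans (Re_le_cabs _))//.
  by rewrite (le_trans (dot_cs _ _))// mulrC expr2 mulrA ler_wpM2r ?rnorm_ge0.
rewrite dotBr ReD ReN; lra.
Qed.

End FunctionalCalculus.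

(** * Jensen's inequality and traces in the functional calculus *)

Section Jensen.
Variables (R : realType) (H : hilbertType R) (B : H -> H).
Hypothesis pB : posop B.
Local Notation M := (opnorm B).
Local Notation fcal f F := (is_fun_calculus f B F).
Implicit Types (x y z : H) (F G K : H -> H) (f g h : R -> R) (c e s : R).

Lemma fcal_comp f g h F G K : fcal f F -> fcal g G -> fcal h K ->
  (forall t, 0 <= t <= M -> f t * g t = h t) -> forall x, F (G x) = K x.
Proof.
move=> hf hg hh fgh x; apply: dot_nondeg => z.
by rewrite -(fcal_adj pB hf) (fcal_mul pB hf hg hh).
Qed.

Lemma Re_dot_diag m (v : 'I_m -> H) (l : 'I_m -> R) f x :
  complex.Re (dot x (\sum_j ((f (l j))%:C%C * dot (v j) x) *: v j)) =
  \sum_j cabs (dot (v j) x) ^+ 2 * f (l j).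
Proof.
rewrite dot_sumr Re_sum; apply: eq_bigr => j _.
by rewrite dotZr -mulrA ReZ (dotC (v j) x) [_ * _^*]mulrC -cabs_sqr /= mulrC.
Qed.

Lemma Re_dot_le x y e : rnorm y <= e * rnorm x -> `|complex.Re (dot x y)| <= e * rnorm x ^+ 2.
Proof.
move=> h; rewrite (le_trans (Re_le_cabs _))// (le_trans (dot_cs _ _))//.
by rewrite expr2 mulrA mulrC ler_wpM2r ?rnorm_ge0.
Qed.

(** The squared coefficients of x in the diagonalizing family play the part of its spectral measure;
    their sum is at most 1 by Bessel's inequality, so [sum_jensen] applies. *)
Lemma fcal_jensen f g F G s x : 1 <= s -> fcal f F -> fcal g G ->
  (forall t, 0 <= t <= M -> 0 <= f t) ->
  (forall t, 0 <= t <= M -> f t `^ s = g t) -> rnorm x <= 1 ->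
  complex.Re (dot x (F x)) `^ s <= complex.Re (dot x (G x)).
Proof.
move=> s1 hf hg f0 fg x1.
have [_ /(_ x)] := fcal_posop pB hf f0; set a := complex.Re _ => a0.
have {}a0 : 0 <= a by rewrite -ler0c ge0_RRe.
set b := complex.Re _.
have C0 : 0 <= s * (a + 1) `^ (s - 1) + 1 by rewrite addr_ge0// mulr_ge0 ?powR_ge0//; lra.
apply: (@le_of_epsM _ _ _ _ C0).
suff key e : 0 < e -> e <= 1 -> a `^ s <= b + e * (s * (a + 1) `^ (s - 1) + 1).
  move=> e e0; have [e1|/ltW e1] := leP e 1; first exact: key.
  by rewrite (le_trans (key 1 ltr01 (lexx _)))// lerD2l ler_wpM2r.
move=> e0 e1.
have [|m [v [l [hv hl _ vs hd]]]] := @fcal_diag _ _ _ pB [:: (f, F); (g, G)] [:: x] e _ e0.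
  by move=> fF /= [<-|[<-|[]]].
have /= /Re_dot_le := hd (f, F) x (or_introl erefl) (mem_head _ _).
have /= /Re_dot_le := hd (g, G) x (or_intror (or_introl erefl)) (mem_head _ _).
rewrite !dotBr !ReD !ReN !Re_dot_diag -/a -/b.
pose c j := cabs (dot (v j) x) ^+ 2.
have c0 j : 0 <= c j by exact: sqr_ge0.
have x2 : rnorm x ^+ 2 <= 1 by rewrite expr_le1// rnorm_ge0.
have c1 : \sum_j c j <= 1 by rewrite (le_trans (orthonormal_bessel hv x)).
have := @sum_jensen R _ c (fun j => f (l j)) s s1 c0 (fun j => f0 _ (hl j)) c1.
under [X in _ <= X -> _]eq_bigr do rewrite fg//.
rewrite /c; set a' := \sum_j _ * f _; set b' := \sum_j _ * g _ => jen hb ha.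
have a'0 : 0 <= a' by apply: sumr_ge0 => j _; rewrite mulr_ge0 ?f0 ?sqr_ge0.
have ex : e * rnorm x ^+ 2 <= e by rewrite ler_piMr// ltW.
have hb' : b' <= b + e by have := le_trans hb ex; rewrite ler_norml => /andP[]; lra.
have ha' := le_trans ha ex.
(* If a <= a', monotonicity of the power suffices. Otherwise both lie in [0, a + 1], where the power
   is Lipschitz with the constant that appears in the error bound. *)
have [aa'|/ltW aa'] := leP a a'.
  have : a `^ s <= a' `^ s by rewrite ler_powRl//; lra.
  have : 0 <= e * (s * (a + 1) `^ (s - 1)) by rewrite !mulr_ge0 ?powR_ge0//; lra.
  lra.
have h1 : 0 <= a <= a + 1 by rewrite a0 lerDl ler01.
have h2 : 0 <= a' <= a + 1 by rewrite a'0 (le_trans aa')// lerDl ler01.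
have := powR_lip s1 h1 h2; rewrite ler_norml => /andP[_ lip].
have : s * (a + 1) `^ (s - 1) * `|a - a'| <= s * (a + 1) `^ (s - 1) * e.
  by rewrite ler_wpM2l// mulr_ge0 ?powR_ge0//; lra.
lra.
Qed.

(** Passes from given vectors to eigenvectors of a compression, whose eigenvalues are diagonal
    coefficients of [B] itself. By Bessel's inequality for [u], the total weight of each [v j] is at
    most 1. *)
Lemma fcal_trace_diag g G n (u : 'I_n -> H) e : fcal g G -> orthonormal u ->
  (forall t, 0 <= t <= M -> 0 <= g t) -> 0 < e ->
  exists m (v : 'I_m -> H) (l : 'I_m -> R),
  [/\ orthonormal v, forall j, 0 <= l j, forall j, dot (v j) (B (v j)) = (l j)%:C%C
    & \sum_i complex.Re (dot (u i) (G (u i))) <= \sum_j g (l j) + e].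
Proof.
move=> hg hu g0 e0; have n0 : 0 < n.+1%:R :> R by rewrite ltr0n.
(* The error is shared among the n vectors; n + 1 avoids a division by 0. *)
have d0 : 0 < e / n.+1%:R by rewrite divr_gt0.
have [|m [v [l [hv hl vl vs hd]]]] := @fcal_diag _ _ _ pB [:: (g, G)] (codom u) _ _ d0.
  by move=> fF /= [<-|[]].
exists m, v, l; split=> // [j|]; first by case/andP: (hl j).
apply: (@le_trans _ _ (\sum_i (\sum_j cabs (dot (v j) (u i)) ^+ 2 * g (l j) + e / n.+1%:R))).
  apply: ler_sum => i _; have /= /Re_dot_le := hd (g, G) (u i) (or_introl erefl) (codom_f u i).
  rewrite (orthonormal_norm _ hu) expr1n mulr1 dotBr ReD ReN Re_dot_diag ler_norml.
  by move=> /andP[_]; rewrite lerBlDl addrC.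
rewrite big_split /= lerD//; last first.
  rewrite sumr_const card_ord -[X in X <= _]mulr_natr mulrAC ler_pdivrMr// ler_wpM2l ?(ltW e0)//.
  by rewrite ler_nat.
rewrite exchange_big /= ler_sum// => j _; rewrite -mulr_suml ler_piMl ?g0//.
under eq_bigr do rewrite cabs_dotC.
by rewrite (le_trans (orthonormal_bessel hu _))// (orthonormal_norm _ hv) expr1n.
Qed.

Lemma fcal_powR a : 0 < a -> exists F, fcal (fun t => t `^ a) F.
Proof.
move=> a0; apply: (fcal_exists pB); apply: (@poly_approx_sub _ (M + 1)).
  by rewrite lerDl.
by apply: poly_approx_powR => //; rewrite ltr_wpDl ?opnorm_ge0.
Qed.

End Jensen.

(** * The absolute value and an approximate polar decomposition *)

Section AbsoluteValue.
Variables (R : realType) (H : hilbertType R) (Q Q' : H -> H).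
Hypothesis bQ : bop Q Q'.
Local Notation B := (abs_operator Q).
Implicit Types (x y z : H).

(** [abs_operator] is a choice with a default value; existence and uniqueness of the calculus show
    that it is the genuine square root. *)
Lemma abs_fcal : is_fun_calculus (@Num.sqrt R) (Q' \o Q) B.
Proof.
have pP := posop_sqr bQ.
have [F hF] := fcal_powR pP (a := 2^-1) ltac:(by rewrite invr_gt0).
have {}hF : is_fun_calculus (@Num.sqrt R) (Q' \o Q) F.
  by apply: fcal_ext hF => t /andP[t0 _]; rewrite powR12_sqrt.
by rewrite /abs_operator (adjoint_dotE bQ.1) (fun_calculusE pP hF).
Qed.

Lemma abs_posop : posop B.
Proof. by apply: (fcal_posop (posop_sqr bQ) abs_fcal) => t _; exact: sqrtr_ge0. Qed.

Lemma abs_sqr x : B (B x) = Q' (Q x).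
Proof.
have pP := posop_sqr bQ.
apply: (fcal_comp pP abs_fcal abs_fcal (fcal_id _)) => t /andP[t0 _].
by rewrite -expr2 sqr_sqrtr.
Qed.

Lemma rnorm_abs x : rnorm (B x) = rnorm (Q x).
Proof.
apply/eqP; rewrite -(eqrXn2 (n := 2)) ?rnorm_ge0// !rnorm_sqr.
by rewrite abs_posop.1.1 abs_sqr -bQ.1.
Qed.

(* [W = Q (|Q| + d)^-1] replaces the partial isometry of the polar decomposition. *)
Lemma polar_approx e : 0 < e -> exists W W', [/\ bop W W', bnd 1 W, bnd 1 W',
  bnd e (fun x => Q x - W (B x)) & bnd e (fun x => B x - W' (Q x))].
Proof.
move=> e0; have pB := abs_posop; have M0 := opnorm_ge0 B.
pose r (t : R) := (t + e)^-1.
have ar : poly_approx (opnorm B) r by exact: poly_approx_inv.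
have at_ : poly_approx (opnorm B) (@id R).
  by apply: poly_approx_ext (poly_approx_poly _ 'X) => t _; rewrite hornerX.
have [F hF] := fcal_exists pB ar.
have [G hG] := fcal_exists pB (poly_approxM at_ ar).
have [K hK] := fcal_exists pB (poly_approxM (poly_approxM at_ ar) at_).
have BF x : B (F x) = G x by apply: (fcal_comp pB (fcal_id _) hF hG).
have GB x : G (B x) = K x by apply: (fcal_comp pB hG (fcal_id _) hK).
have bF := fcal_bop pB hF.
have te t : 0 <= t -> 0 < t + e by move=> t0; rewrite ltr_wpDl.
have bG : bnd 1 G.
  apply: (fcal_bnd pB ler01 hG) => t /andP[t0 _].
  rewrite ger0_norm ?divr_ge0 ?(ltW (te _ t0))// ler_pdivrMr ?te// mul1r lerDl ltW //.
have bK : bnd e (fun x => B x - K x).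
  apply: (fcal_bnd_dist pB (ltW e0) (fcal_id _) hK) => t /andP[t0 _].
  rewrite /r; have -> : t - t * (t + e)^-1 * t = e * (t / (t + e)).
    by field; rewrite gt_eqF ?te.
  rewrite ger0_norm ?mulr_ge0 ?invr_ge0 ?(ltW e0) ?(ltW (te _ t0))//.
  by rewrite ger_pMr// ler_pdivrMr ?te// mul1r lerDl ltW.
have bW : bop (Q \o F) (F \o Q') by exact: bop_comp.
(* [Q] and |Q| have the same norms on vectors, and |Q| after [F] is the function t / (t + e) <= 1 of
   |Q|. *)
have W1 : bnd 1 (Q \o F) by move=> x; rewrite /= -rnorm_abs BF.
exists (Q \o F), (F \o Q'); split=> //; first exact: bnd_adj bW.1 _.
  move=> x; rewrite /= -(adjB _ _ bQ.1) -rnorm_abs (adjB _ _ pB.1.1) BF GB.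
  exact: bK.
move=> x /=; rewrite -abs_sqr (_ : F (B (B x)) = K x)//.
apply: dot_nondeg => z; rewrite -(fcal_adj pB hF) -pB.1.1 BF.
by rewrite (fcal_adj pB hG) GB.
Qed.

End AbsoluteValue.

(** * Orthonormal bases, possibly uncountable *)

Section OrthonormalBasis.
Variables (R : realType) (H : hilbertType R).
Implicit Types (x y z e : H) (s : seq H).

Definition basis : set H := xget set0 (@orthonormal_basis R H).

(** Zorn's lemma: a nonzero vector orthogonal to a maximal orthonormal set could be normalized and
    adjoined. *)
Lemma orthonormal_basis_exists : exists S, @orthonormal_basis R H S.
Proof.
pose P := [set S : set H | forall e e', S e -> S e' -> dot e e' = (e == e')%:R].
have [F FP Ftot|A [PA mA]] := @Zorn_bigcup H P.
  move=> e e' [S FS Se] [S' FS' S'e'].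
  by have [h|h] := Ftot _ _ FS FS'; [apply: (FP _ FS') => //; exact: h|apply: (FP _ FS) => //; exact: h].
exists A; split=> // x hx; apply: contrapT => xn0.
have nx : rnorm x != 0 by apply: contra_notN xn0 => /eqP; exact: rnorm_eq0.
pose w := ((rnorm x)^-1)%:C%C *: x.
have ww : dot w w = 1.
  rewrite /w dotZr dotZl dotxx conjR -!rmorphM /=.
  by have -> : (rnorm x)^-1 * ((rnorm x)^-1 * rnorm x ^+ 2) = 1 by field.
have Aw e : A e -> dot e w = 0 by move=> Ae; rewrite /w dotZr hx ?mulr0.
have nAw : ~ A w.
  by move=> Aw'; have := Aw w Aw'; rewrite ww => /eqP; rewrite oner_eq0.
apply: (mA (w |` A)).
  split; first by move=> e Ae; right.
  by move=> /(_ w (or_introl erefl)).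
have wA e : A e -> e == w = false by move=> Ae; apply/negP => /eqP ew; apply: nAw; rewrite -ew.
move=> e e' [->|Ae] [->|Ae'].
- by rewrite eqxx ww.
- by rewrite dotC Aw// conjC0 eq_sym wA.
- by rewrite Aw// wA.
- exact: PA.
Qed.

Lemma basisP : orthonormal_basis basis.
Proof.
by have [S hS] := orthonormal_basis_exists; rewrite /basis; apply: (@xgetPex _ set0 _); exists S.
Qed.

Definition sub_basis s := uniq s /\ forall e, e \in s -> basis e.

Lemma sub_basis_orthonormal s : sub_basis s -> orthonormal (tnth (in_tuple s)).
Proof.
move=> [us hs] i j.
have mt (k : 'I_(size s)) : tnth (in_tuple s) k \in s by exact: (mem_tnth k (in_tuple s)).
rewrite (basisP.1 _ _ (hs _ (mt i)) (hs _ (mt j))).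
rewrite !(tnth_nth 0) /=; case: i j => [i hi] [j hj] /=.
by rewrite nth_uniq.
Qed.

Lemma sub_basis_bessel s x : sub_basis s ->
  \sum_(e <- s) cabs (dot e x) ^+ 2 <= rnorm x ^+ 2.
Proof.
by move=> /sub_basis_orthonormal hs; rewrite big_tnth; exact: orthonormal_bessel.
Qed.

Lemma sub_basis_residual s x : sub_basis s ->
  rnorm (x - \sum_(e <- s) dot e x *: e) ^+ 2 =
  rnorm x ^+ 2 - \sum_(e <- s) cabs (dot e x) ^+ 2.
Proof.
by move=> /sub_basis_orthonormal hs; rewrite [in LHS]big_tnth [in RHS]big_tnth orthonormal_residual.
Qed.

Lemma sub_basis_undup s t : sub_basis s -> sub_basis t -> sub_basis (undup (s ++ t)).
Proof.
move=> [us hs] [ut ht]; split; first exact: undup_uniq.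
by move=> e; rewrite mem_undup mem_cat => /orP[/hs|/ht].
Qed.

Lemma uniq_sum_le (f : H -> R) s t : uniq s -> uniq t -> (forall x, 0 <= f x) ->
  {subset s <= t} -> \sum_(e <- s) f e <= \sum_(e <- t) f e.
Proof.
move=> us ut f0 st; rewrite [leRHS](bigID [in s])/=.
have -> : \sum_(e <- t | e \in s) f e = \sum_(e <- s) f e.
  rewrite -big_filter; apply: perm_big; apply: uniq_perm; rewrite ?filter_uniq//.
  by move=> x; rewrite mem_filter; case: (boolP (x \in s)) => //= /st ->.
by rewrite lerDl sumr_ge0.
Qed.

Lemma sub_basis_dot s x e : sub_basis s -> basis e ->
  dot e (x - \sum_(e' <- s) dot e' x *: e') = if e \in s then 0 else dot e x.
Proof.
move=> [us hs] be; rewrite dotBr dot_sumr; case: ifPn => es.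
  rewrite (bigD1_seq e)//= dotZr (basisP.1 e e)// eqxx mulr1 big_seq_cond big1 ?addr0 ?subrr//.
  by move=> e' /andP[/hs be' ne]; rewrite dotZr (basisP.1 e e')// eq_sym (negbTE ne) mulr0.
rewrite big_seq big1 ?subr0// => e' /[dup] e's /hs be'; rewrite dotZr (basisP.1 e e')//.
by case: eqP => [ee'|]; rewrite ?mulr0//; move: es; rewrite ee' e's.
Qed.

(** The finite sets u n exhaust the supremum of the sums of squared coefficients up to 1 / (n + 1),
    so a finite set containing u n adds at most that much. Hence the partial sums are Cauchy, and
    their limit has the coefficients of [x]. *)
Lemma parseval x (d : R) : 0 < d -> exists2 s0, sub_basis s0 &
  forall s, sub_basis s -> {subset s0 <= s} -> rnorm (x - \sum_(e <- s) dot e x *: e) <= d.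
Proof.
pose val s := \sum_(e <- s) cabs (dot e x) ^+ 2.
pose S := [set val s | s in [set s | sub_basis s]].
have sb0 : sub_basis [::] by [].
have supS : has_sup S.
  split; first by exists (val [::]); exists [::].
  by exists (rnorm x ^+ 2) => _ [s hs <-]; exact: sub_basis_bessel.
have /choice[u hu] (n : nat) : exists s, sub_basis s /\ sup S - n.+1%:R^-1 < val s.
  have [_ [s hs <-] h] := @sup_adherent _ S n.+1%:R^-1 ltac:(by rewrite invr_gt0) supS.
  by exists s.
have valS s : sub_basis s -> val s <= sup S.
  by move=> hs; apply: (ub_le_sup supS.2); exists s.
pose y n := \sum_(e <- u n) dot e x *: e.
have yd s n : sub_basis s -> {subset u n <= s} ->
    rnorm (\sum_(e <- s) dot e x *: e - y n) ^+ 2 <= n.+1%:R^-1.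
  move=> hs us; have [un hn] := hu n.
  pose t := [seq e <- s | e \notin u n].
  have st : sub_basis t.
    split; first exact: filter_uniq hs.1.
    by move=> e; rewrite mem_filter => /andP[_ /hs.2].
  have split_sum (V : zmodType) (f : H -> V) : \sum_(e <- s) f e = \sum_(e <- u n) f e + \sum_(e <- t) f e.
    rewrite (bigID [in u n])/= big_filter; congr (_ + _).
    rewrite -big_filter; apply: perm_big; apply: uniq_perm; rewrite ?filter_uniq//; [exact: hs.1|exact: un.1|].
    by move=> z; rewrite mem_filter; case: (boolP (z \in u n)) => //= /us ->.
  rewrite split_sum /y addrAC subrr add0r.
  have -> : \sum_(e <- t) dot e x *: e =
      \sum_i dot (tnth (in_tuple t) i) x *: tnth (in_tuple t) i by rewrite big_tnth.
  rewrite (rnorm_orthonormal_sum _ (sub_basis_orthonormal st)).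
  have := valS _ hs; rewrite /val split_sum -/(val (u n)) [X in _ + X <= _ -> _]big_tnth.
  by move=> h; rewrite -(lerD2l (val (u n))) (le_trans h)// -lerBlDr ltW.
have ycauchy : exists l, scvg y l.
  apply: scvg_complete => e e0.
  have [N HN] := natSinv_lt (exprn_gt0 2 (divr_gt0 e0 (ltr0Sn R 1))).
  have hN m n : (N <= m)%N -> rnorm (\sum_(e <- undup (u m ++ u n)) dot e x *: e - y m) <= e / 2 /\
      rnorm (\sum_(e <- undup (u n ++ u m)) dot e x *: e - y m) <= e / 2.
    move=> Nm; split; rewrite -(@ler_pXn2r _ 2) ?nnegrE ?rnorm_ge0 ?divr_ge0 ?(ltW e0)//.
      apply: le_trans (ltW (HN m Nm)); apply: yd; first exact: sub_basis_undup (hu m).1 (hu n).1.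
      by move=> z zm; rewrite mem_undup mem_cat zm.
    apply: le_trans (ltW (HN m Nm)); apply: yd; first exact: sub_basis_undup (hu n).1 (hu m).1.
    by move=> z zm; rewrite mem_undup mem_cat zm orbT.
  exists N => m n Nm Nn.
  rewrite (le_trans (rnorm_triB _ (\sum_(e <- undup (u m ++ u n)) dot e x *: e) _))//.
  by rewrite (splitr e) lerD//; [rewrite rnorm_distC; exact: (hN m n Nm).1|exact: (hN n m Nn).2].
have [l yl] := ycauchy.
have xl : x = l.
  apply/eqP; rewrite -subr_eq0; apply/eqP/basisP.2 => e be.
  apply: cabs_eq0; apply/eqP; rewrite eq_le cabs_ge0 andbT.
  have ne : rnorm e = 1.
    by apply/eqP; rewrite -(eqrXn2 (n := 2)) ?rnorm_ge0// rnorm_sqr basisP.1// eqxx expr1n.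
  apply: (@le_of_epsM _ _ _ 2) => // d0 d0p; rewrite add0r.
  have [N1 HN1] := yl _ d0p; have [N2 HN2] := natSinv_lt (exprn_gt0 2 d0p).
  pose n := maxn N1 N2.
  have -> : x - l = (x - y n) + (y n - l) by rewrite addrA subrK.
  rewrite dotDr (le_trans (cabsD _ _))// mulrC mulrDl !mul1r lerD//; last first.
    by rewrite (le_trans (dot_cs _ _))// ne mul1r HN1// leq_maxl.
  have [un hn] := hu n; rewrite sub_basis_dot//; case: ifPn => eu; first by rewrite cabs0 ltW.
  rewrite -(@ler_pXn2r _ 2) ?nnegrE ?cabs_ge0 ?(ltW d0p)//.
  apply: le_trans (ltW (HN2 n (leq_maxr _ _))).
  (* A basis vector outside [u n] would raise the sum by its squared coefficient, which is therefore
     at most 1 / (n + 1). *)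
  have sc : sub_basis (e :: u n).
    split; first by rewrite /= eu un.1.
    by move=> z; rewrite inE => /predU1P[->//|/un.2].
  have := valS _ sc; rewrite /val big_cons -/(val (u n)) => h.
  by rewrite -(lerD2r (val (u n))) (le_trans h)// addrC -lerBlDr ltW.
move=> d0; have [N HN] := yl d d0; exists (u N); first exact: (hu N).1.
move=> s hs us; apply: le_trans (HN N (leqnn _)).
rewrite -(@ler_pXn2r _ 2) ?nnegrE ?rnorm_ge0// -xl (rnorm_distC (y N)) /y.
rewrite (sub_basis_residual x hs) (sub_basis_residual x (hu N).1) lerD2l lerN2; apply: uniq_sum_le => //.
- exact: (hu N).1.1.
- exact: hs.1.
- by move=> z; exact: sqr_ge0.
Qed.

End OrthonormalBasis.

(** * Schatten bounds *)

Section SchattenBounds.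
Variables (R : realType) (H : hilbertType R).
Implicit Types (x y z : H) (Q S T B F G K : H -> H) (f g h : R -> R) (a c d p q r s t : R).

(* [schle p Q c] says that the [p]-th Schatten norm of [Q] is at most [c]: Bessel
   families, unlike orthonormal ones, are stable under contractions. *)
Definition schle p Q c := 0 <= c /\ forall n (u v : 'I_n -> H), bessel u -> bessel v ->
  \sum_i cabs (dot (v i) (Q (u i))) `^ p <= c `^ p.

(** By Cauchy-Schwarz such a bound on the columns implies the bound [schle]; the converse holds for
    exponents at least 2 ([schle_colle]). *)
Definition colle p Q c := 0 <= c /\ forall n (u : 'I_n -> H), bessel u ->
  \sum_i rnorm (Q (u i)) `^ p <= c `^ p.

Lemma schleD p Q S c d : 1 <= p -> schle p Q c -> schle p S d ->
  schle p (fun x => Q x + S x) (c + d).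
Proof.
move=> p1 [c0 hc] [d0 hd]; split; first exact: addr_ge0.
move=> n u v hu hv; have p0 : 0 <= p by lra.
apply: le_trans (sum_minkowski p1 c0 d0 _ _ (hc n u v hu hv) (hd n u v hu hv)).
- apply: ler_sum => i _; rewrite ler_powRl ?cabs_ge0// dotDr; exact: cabsD.
- by move=> i; exact: cabs_ge0.
- by move=> i; exact: cabs_ge0.
Qed.

Lemma schleZ p Q c (k : R[i]) : 1 <= p -> schle p Q c -> schle p (fun x => k *: Q x) (cabs k * c).
Proof.
move=> p1 [c0 hc]; split; first by rewrite mulr_ge0 ?cabs_ge0.
move=> n u v hu hv; rewrite powRM ?cabs_ge0//.
apply: le_trans (ler_wpM2l (powR_ge0 _ _) (hc n u v hu hv)).
rewrite mulr_sumr; apply: ler_sum => i _.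
by rewrite dotZr cabsM powRM ?cabs_ge0.
Qed.

Lemma schle_adj p Q Q' c : is_adjoint dot Q Q' -> schle p Q c -> schle p Q' c.
Proof.
move=> h [c0 hc]; split=> // n u v hu hv.
apply: le_trans (hc n v u hv hu); apply: ler_sum => i _.
by rewrite -h cabs_dotC.
Qed.

Lemma schle_mono p Q c d : 0 <= p -> c <= d -> schle p Q c -> schle p Q d.
Proof.
move=> p0 cd [c0 hc]; split=> [|n u v hu hv]; first exact: le_trans cd.
by rewrite (le_trans (hc n u v hu hv))// ler_powRl.
Qed.

Lemma bessel_contraction n (u : 'I_n -> H) S S' : is_adjoint dot S S' -> bnd 1 S' ->
  bessel u -> bessel (fun i => S (u i)).
Proof.
move=> h b hu x; under eq_bigr do rewrite h.
rewrite (le_trans (hu _))// ler_pXn2r ?nnegrE ?rnorm_ge0//.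
by rewrite (le_trans (b x))// mul1r.
Qed.

Lemma schle_compl1 p Q S S' c : is_adjoint dot S S' -> bnd 1 S ->
  schle p Q c -> schle p (S \o Q) c.
Proof.
move=> h b [c0 hc]; split=> // n u v hu hv.
have hw := bessel_contraction (adj_sym h) b hv.
apply: le_trans (hc n u _ hu hw); apply: ler_sum => i _.
by rewrite /= (adj_dotr _ _ h).
Qed.

Lemma schle_compl p Q S S' c M : 1 <= p -> 0 <= M -> is_adjoint dot S S' -> bnd M S ->
  schle p Q c -> schle p (S \o Q) (M * c).
Proof.
move=> p1 M0 h b hc; have [Mz|Mn0] := eqVneq M 0.
  split=> [|n u v hu hv]; first by rewrite mulr_ge0// hc.1.
  rewrite big1 ?powR_ge0// => i _; rewrite /=.
  have -> : S (Q (u i)) = 0.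
    by apply: rnorm_eq0; apply/eqP; rewrite eq_le rnorm_ge0 andbT (le_trans (b _))// Mz mul0r.
  by rewrite dot0r cabs0 powR0// gt_eqF//; lra.
have Mp : 0 < M by rewrite lt_def Mn0.
have Mi : cabs (M^-1)%:C%C = M^-1 by rewrite cabsR ger0_norm// invr_ge0.
have h1 : is_adjoint dot (fun x => (M^-1)%:C%C *: S x) (fun x => (M^-1)%:C%C *: S' x).
  by move=> x y; rewrite dotZl dotZr conjR h.
have b1 : bnd 1 (fun x => (M^-1)%:C%C *: S x).
  by move=> x; rewrite rnormZ Mi mul1r mulrC ler_pdivrMr// mulrC.
have := schleZ M%:C%C p1 (schle_compl1 h1 b1 hc).
rewrite cabsR ger0_norm//; congr (schle p _ _); apply/funext => x /=.
by rewrite scalerA -rmorphM divff// scale1r.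
Qed.

(** For a fixed family of n vectors, an error e in norm costs at most e n^(1/p) in Minkowski's
    inequality, and this tends to 0 with e. *)
Lemma schle_lsc p Q c : 1 <= p -> 0 <= c ->
  (forall e : R, 0 < e -> exists2 Q1, schle p Q1 (c + e) & bnd e (fun x => Q x - Q1 x)) ->
  schle p Q c.
Proof.
move=> p1 c0 happ; split=> // n u v hu hv; have p0 : 0 < p by lra.
set X := \sum_i _; have X0 : 0 <= X by rewrite sumr_ge0// => i _; exact: powR_ge0.
rewrite -(powRVK p0 X0); apply: ler_powRl; rewrite ?powR_ge0 ?(ltW p0)//.
apply: (@le_of_epsM _ _ _ (1 + n%:R `^ p^-1)); first by rewrite addr_ge0 ?powR_ge0.
move=> e e0; have [Q1 h1 h2] := happ e e0.
rewrite -[leRHS](powRKV p0) ?addr_ge0 ?mulr_ge0 ?addr_ge0 ?powR_ge0 ?(ltW e0)//.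
apply: ler_powRl => //; first by rewrite invr_ge0 ltW.
rewrite mulrDr mulr1 addrA.
have he : \sum_(i < n) e `^ p <= (e * n%:R `^ p^-1) `^ p.
  rewrite sumr_const card_ord powRM ?powR_ge0 ?(ltW e0)// powRVK ?ler0n//.
  by rewrite mulr_natr.
have e1 : 0 <= e * n%:R `^ p^-1 by exact: mulr_ge0 (ltW e0) (powR_ge0 _ _).
have ce : 0 <= c + e by exact: addr_ge0 c0 (ltW e0).
apply: le_trans (sum_minkowski p1 ce e1 _ _ (h1.2 n u v hu hv) he) => //; last 2 first.
- by move=> i; exact: cabs_ge0.
- by move=> i; exact: ltW.
apply: ler_sum => i _; rewrite ler_powRl ?cabs_ge0 ?(ltW p0)//.
have -> : dot (v i) (Q (u i)) = dot (v i) (Q1 (u i)) + dot (v i) (Q (u i) - Q1 (u i)).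
  by rewrite -dotDr addrC subrK.
rewrite (le_trans (cabsD _ _))// lerD2l (le_trans (dot_cs _ _))//.
rewrite -[leRHS]mul1r; apply: ler_pM; rewrite ?rnorm_ge0 ?bessel_norm//.
by rewrite (le_trans (h2 _))// ler_piMr ?bessel_norm// ltW.
Qed.

Lemma bessel1 x : rnorm x <= 1 -> bessel (fun _ : 'I_1 => x).
Proof.
move=> x1 y; rewrite big_ord1 ler_pXn2r ?nnegrE ?cabs_ge0 ?rnorm_ge0//.
by rewrite (le_trans (dot_cs _ _))// ler_piMl ?rnorm_ge0.
Qed.

Lemma unit_vector x : rnorm x != 0 -> rnorm (((rnorm x)^-1)%:C%C *: x) = 1.
Proof.
move=> x0; rewrite rnormZ cabsR ger0_norm ?mulVf// invr_ge0 rnorm_ge0//.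
Qed.

(** Take families with a single member, x / |x| and Q x / |Q x|. *)
Lemma schle_bnd p Q Q' c : 0 < p -> is_adjoint dot Q Q' -> schle p Q c -> bnd c Q.
Proof.
move=> p0 h [c0 hc] x.
have [Qx0|Qxn0] := eqVneq (rnorm (Q x)) 0; first by rewrite Qx0 mulr_ge0 ?rnorm_ge0.
have xn0 : rnorm x != 0.
  by apply: contra_neq Qxn0 => /rnorm_eq0 ->; rewrite (adj0 h) rnorm0.
have xp : 0 < rnorm x by rewrite lt_def xn0 rnorm_ge0.
have Qxp : 0 < rnorm (Q x) by rewrite lt_def Qxn0 rnorm_ge0.
pose u := ((rnorm x)^-1)%:C%C *: x; pose v := ((rnorm (Q x))^-1)%:C%C *: Q x.
have := hc 1%N (fun=> u) (fun=> v).
rewrite big_ord1 => /(_ (bessel1 _) (bessel1 _)).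
rewrite !unit_vector// => /(_ (lexx _) (lexx _)) /(powR_le_inv p0 c0).
rewrite /u /v (adjZ _ _ h) dotZr dotZl conjR dotxx -!rmorphM /= cabsR.
have -> : (rnorm x)^-1 * ((rnorm (Q x))^-1 * rnorm (Q x) ^+ 2) = rnorm (Q x) / rnorm x.
  by field; rewrite xn0.
by rewrite ger0_norm ?divr_ge0 ?rnorm_ge0// ler_pdivrMr.
Qed.

Lemma posop_cs B x y : posop B ->
  cabs (dot x (B y)) ^+ 2 <= complex.Re (dot x (B x)) * complex.Re (dot y (B y)).
Proof.
move=> [bB B0].
have sC u v : dot v (B u) = (dot u (B v))^* by rewrite -dotC bB.1.
have sD u v w : dot u (B (v + w)) = dot u (B v) + dot u (B w) by rewrite (adjD _ _ bB.1) dotDr.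
have sZ (k : R[i]) u v : dot u (B (k *: v)) = k * dot u (B v) by rewrite (adjZ _ _ bB.1) dotZr.
have := sip_cs (SemiInner sD sZ sC B0) x y.
rewrite -(ler_pXn2r (n := 2)) ?nnegrE ?mulr_ge0 ?sip_norm_ge0//.
rewrite exprMn !sip_normK /= cabsE -rmorphXn /= -(ge0_RRe (B0 x)) -(ge0_RRe (B0 y)).
by rewrite -rmorphM lecR.
Qed.

Definition basis_le Q t := forall s : seq H, sub_basis s -> \sum_(e <- s) complex.Re (dot e (Q e)) <= t.

Lemma parseval_fin (xs : seq H) d : 0 < d -> exists2 s : seq H, sub_basis s &
  forall x, x \in xs -> rnorm x ^+ 2 <= \sum_(e <- s) cabs (dot e x) ^+ 2 + d ^+ 2.
Proof.
move=> d0; elim: xs => [|x xs [s hs hx]]; first by exists [::].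
have [s0 hs0 h0] := parseval x d0.
have hu := sub_basis_undup hs0 hs.
exists (undup (s0 ++ s)) => // y; rewrite inE => /predU1P[->|/hx].
  have : rnorm (x - \sum_(e <- undup (s0 ++ s)) dot e x *: e) ^+ 2 <= d ^+ 2.
    rewrite ler_pXn2r ?nnegrE ?rnorm_ge0 ?(ltW d0)//; apply: h0 => //.
    by move=> z zs; rewrite mem_undup mem_cat zs.
  by rewrite sub_basis_residual//; lra.
move=> h; rewrite (le_trans h)// lerD2r; apply: uniq_sum_le.
- exact: hs.1.
- exact: undup_uniq.
- by move=> z; exact: sqr_ge0.
- by move=> z zs; rewrite mem_undup mem_cat zs orbT.
Qed.

(** Expand |Q u_i|^2 over a finite part of the basis, up to e, and sum over i first: Bessel's
    inequality for [u] leaves the squares |Q' x|^2. This carries bounds on the basis over to all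
    Bessel families. *)
Lemma hs_adj Q Q' t : is_adjoint dot Q Q' ->
  (forall s : seq H, sub_basis s -> \sum_(e <- s) rnorm (Q' e) ^+ 2 <= t) ->
  forall n (u : 'I_n -> H), bessel u -> \sum_i rnorm (Q (u i)) ^+ 2 <= t.
Proof.
move=> h ht n u hu; apply: (@le_of_epsM _ _ _ n%:R) => // e e0.
have se : 0 < Num.sqrt e by rewrite sqrtr_gt0.
have [s hs hx] := parseval_fin (codom (Q \o u)) se.
rewrite sqr_sqrtr ?(ltW e0)// in hx.
apply: (@le_trans _ _ (\sum_(i < n) (\sum_(x <- s) cabs (dot x (Q (u i))) ^+ 2 + e))).
  by apply: ler_sum => i _; apply: hx; exact: (codom_f (Q \o u)).
rewrite big_split /= sumr_const card_ord -[X in _ + X <= _]mulr_natr lerD2r.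
rewrite exchange_big /=; apply: le_trans (ht s hs); apply: ler_sum => x _.
under eq_bigr do rewrite (adj_dotr _ _ h) cabs_dotC.
exact: hu.
Qed.

Lemma fcal_rnorm B f g F G x : posop B -> is_fun_calculus f B F -> is_fun_calculus g B G ->
  (forall t, 0 <= t <= opnorm B -> f t ^+ 2 = g t) ->
  rnorm (F x) ^+ 2 = complex.Re (dot x (G x)).
Proof.
by move=> pB hF hG fg; rewrite rnorm_sqr (fcal_mul pB hF hF hG).
Qed.

(** The trace of G = F^2 is the squared Hilbert-Schmidt norm of the self-adjoint [F], to which
    [hs_adj] applies. *)
Lemma bessel_trace B f g F G t : posop B -> is_fun_calculus f B F -> is_fun_calculus g B G ->
  (forall t, 0 <= t <= opnorm B -> f t ^+ 2 = g t) -> basis_le G t ->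
  forall n (u : 'I_n -> H), bessel u -> \sum_i complex.Re (dot (u i) (G (u i))) <= t.
Proof.
move=> pB hF hG fg ht n u hu.
under eq_bigr do rewrite -(fcal_rnorm _ pB hF hG fg).
apply: (hs_adj (fcal_adj pB hF)) => // s hs.
by under eq_bigr do rewrite (fcal_rnorm _ pB hF hG fg); exact: ht.
Qed.

Lemma powR_half_sqr t p : 0 <= t -> (t `^ (p / 2)) ^+ 2 = t `^ p.
Proof. by move=> t0; rewrite -powR_mulrn ?powR_ge0// -powRrM divfK. Qed.

Lemma powR_sqr t p : 0 <= t -> (t ^+ 2) `^ (p / 2) = t `^ p.
Proof. by move=> t0; rewrite -powR_mulrn// -powRrM mulrC divfK. Qed.

Lemma bessel_trace_powR B G p t : posop B -> 0 < p ->
  is_fun_calculus (fun t => t `^ p) B G -> basis_le G t ->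
  forall n (u : 'I_n -> H), bessel u -> \sum_i complex.Re (dot (u i) (G (u i))) <= t.
Proof.
move=> pB p0 hG; have [F hF] := fcal_powR pB (divr_gt0 p0 (ltr0Sn R 1)).
apply: (bessel_trace pB hF hG) => s /andP[s0 _]; exact: powR_half_sqr.
Qed.

(** By Cauchy-Schwarz |<v, B u>|^p is at most (<v, B v> <u, B u>)^(p/2), hence at most half the sum
    of <v, B v>^p and <u, B u>^p; Jensen's inequality bounds these by the diagonal coefficients of
    B^p. *)
Lemma posop_schle B G p c : posop B -> 1 <= p -> 0 <= c ->
  is_fun_calculus (fun t => t `^ p) B G -> basis_le G (c `^ p) -> schle p B c.
Proof.
move=> pB p1 c0 hG ht; split=> // n u v hu hv; have p0 : 0 < p by lra.
have tr := bessel_trace_powR pB p0 hG ht.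
have jen x : rnorm x <= 1 -> complex.Re (dot x (B x)) `^ p <= complex.Re (dot x (G x)).
  by move=> x1; apply: (fcal_jensen pB p1 (fcal_id _) hG) => // t /andP[].
have pos x : 0 <= complex.Re (dot x (B x)) by rewrite -ler0c ge0_RRe// pB.2.
apply: (@le_trans _ _ (\sum_i (complex.Re (dot (u i) (G (u i))) / 2 +
    complex.Re (dot (v i) (G (v i))) / 2))); last first.
  rewrite big_split /= -!mulr_suml (splitr (c `^ p)).
  by rewrite lerD// ler_wpM2r ?invr_ge0// tr.
apply: ler_sum => i _.
have hu1 := jen _ (bessel_norm i hu); have hv1 := jen _ (bessel_norm i hv).
rewrite -powR_sqr ?cabs_ge0//.
apply: (@le_trans _ _ ((complex.Re (dot (v i) (B (v i))) * complex.Re (dot (u i) (B (u i)))) `^ (p / 2))).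
  by apply: ler_powRl; rewrite ?sqr_ge0 ?divr_ge0 ?(ltW p0)//; exact: posop_cs.
rewrite powRM ?pos//.
move: hu1 hv1; rewrite -!(powR_half_sqr p (pos _)).
set a := _ `^ (p / 2); set b := _ `^ (p / 2).
by have : 0 <= (a - b) ^+ 2 by [exact: sqr_ge0]; rewrite sqrrB; lra.
Qed.

Lemma trace_leP Q t : (forall x, 0 <= complex.Re (dot x (Q x))) ->
  (trace Q <= t%:E)%E <-> basis_le Q t.
Proof.
move=> Q0; rewrite /trace -/(@basis R H); split=> [ht s [us hs]|ht].
  rewrite -lee_fin -sumEFin; apply: le_trans ht.
  apply: esum_ge; exists [set` s].
    by split; [exact: finite_seq|move=> x /= /hs].
  by rewrite fsbig_seq.
apply: ge_ereal_sup => _ [A [fA Abas] <-].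
rewrite fsbig_finite//= sumEFin lee_fin; apply: ht; split; first exact: finmap.fset_uniq.
by move=> x; rewrite in_fset_set// inE; exact: Abas.
Qed.

Section Operator.
Variables (Q Q' : H -> H) (p : R).
Hypotheses (bQ : bop Q Q') (p1 : 1 <= p).
Local Notation B := (abs_operator Q).

(** Each of [Q] and [B] is approximated in norm by a contraction times the other, and [schle_lsc]
    removes the error. *)
Lemma schle_abs c : schle p B c <-> schle p Q c.
Proof.
split=> hc; apply: schle_lsc => //; (try exact: hc.1) => e e0;
    have [W [W' [bW W1 W1' h1 h2]]] := polar_approx bQ e0.
  exists (W \o B); last exact: h1.
  by apply: schle_mono (schle_compl1 bW.1 W1 hc); [exact: le_trans ler01 p1|rewrite lerDl ltW].
exists (W' \o Q); last exact: h2.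
by apply: schle_mono (schle_compl1 (adj_sym bW.1) W1' hc); [exact: le_trans ler01 p1|rewrite lerDl ltW].
Qed.

Lemma abs_powR_exists : exists2 G, is_fun_calculus (fun t => t `^ p) B G &
  trace_abs_pow p Q = trace G.
Proof.
have pB := abs_posop bQ; have p0 : 0 < p by exact: lt_le_trans ltr01 p1.
have [G hG] := fcal_powR pB p0; exists G => //.
by rewrite /trace_abs_pow (fun_calculusE pB hG).
Qed.

Lemma fcal_powR_ge0 B G x : posop B -> is_fun_calculus (fun t => t `^ p) B G ->
  0 <= complex.Re (dot x (G x)).
Proof.
move=> pB hG; have [_ h] := fcal_posop pB hG (fun t _ => powR_ge0 t p).
by rewrite -ler0c ge0_RRe.
Qed.

(** For the converse direction, [fcal_trace_diag] leads to the sum of the l_j^p = |<v_j, B v_j>|^p,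
    which is an instance of [schle] with the family v used on both sides. *)
Lemma schle_basis_le c G : 0 <= c -> is_fun_calculus (fun t => t `^ p) B G ->
  basis_le G (c `^ p) <-> schle p Q c.
Proof.
move=> c0 hG; have pB := abs_posop bQ; rewrite -schle_abs; split=> [|hc].
  exact: posop_schle.
move=> s hs; rewrite big_tnth; apply: le_of_eps => e e0.
have hu := sub_basis_orthonormal hs.
have [m [v [l [hv l0 lv]]]] := fcal_trace_diag pB hG hu (fun t _ => powR_ge0 t p) e0.
move=> h; rewrite (le_trans h)// lerD2r.
have bv := orthonormal_bessel hv; apply: le_trans (hc.2 m v v bv bv).
by apply: ler_sum => j _; rewrite lv cabsR ger0_norm.
Qed.

Lemma trace_schle c : 0 <= c -> (trace_abs_pow p Q <= (c `^ p)%:E)%E <-> schle p Q c.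
Proof.
move=> c0; have [G hG ->] := abs_powR_exists.
rewrite trace_leP; first exact: schle_basis_le.
move=> x; exact: fcal_powR_ge0 (abs_posop bQ) hG.
Qed.

End Operator.

(** |F x|^r = <x, B^(2a) x>^(r/2), and Jensen's inequality applies because r / 2 >= 1. *)
Lemma fcal_colle B F G a r c : posop B -> 0 < a -> 2 <= r -> 0 <= c ->
  is_fun_calculus (fun t => t `^ a) B F -> is_fun_calculus (fun t => t `^ (a * r)) B G ->
  basis_le G (c `^ r) -> colle r F c.
Proof.
move=> pB a0 r2 c0 hF hG ht; split=> // n u hu; have r0 : 0 < r by lra.
apply: le_trans (bessel_trace_powR pB (mulr_gt0 a0 r0) hG ht hu).
apply: ler_sum => i _.
have a2 : 0 < a * 2 by rewrite mulr_gt0.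
have [K hK] := fcal_powR pB a2.
rewrite -powR_sqr ?rnorm_ge0// (fcal_rnorm _ pB hF hK) => [|t /andP[t0 _]].
  apply: (fcal_jensen pB _ hK hG); first by rewrite ler_pdivlMr// mul1r.
  - by move=> t _; exact: powR_ge0.
  - by move=> t _; rewrite -powRrM mulrAC -!mulrA; congr (_ `^ _); field.
  - exact: bessel_norm.
by rewrite -powR_mulrn ?powR_ge0// -powRrM.
Qed.

Lemma schle_colle Q Q' p c : bop Q Q' -> 2 <= p -> schle p Q c -> colle p Q c.
Proof.
move=> bQ p2 hc; have pB := abs_posop bQ; have p1 : 1 <= p by lra.
have [G hG _] := abs_powR_exists bQ p1.
have hB : is_fun_calculus (fun t => t `^ 1) (abs_operator Q) (abs_operator Q).
  by apply: fcal_ext (fcal_id _) => t /andP[t0 _]; rewrite powRr1.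
have hG1 : is_fun_calculus (fun t => t `^ (1 * p)) (abs_operator Q) G by rewrite mul1r.
have ht := (schle_basis_le bQ p1 hc.1 hG).2 hc.
have [_ h] := fcal_colle pB ltr01 p2 hc.1 hB hG1 ht; split; first exact: hc.1.
move=> n u hu; apply: le_trans (h n u hu); apply: ler_sum => i _.
by rewrite (rnorm_abs bQ).
Qed.

(** As <v, S T u> = <S' v, T u>, Cauchy-Schwarz separates the columns of S' and T, and Hoelder's
    inequality for sums finishes. *)
Lemma colle_schle S S' T p q r c d : is_adjoint dot S S' -> 0 < p -> 0 < q -> 0 < r ->
  p^-1 + q^-1 = r^-1 -> colle q S' c -> colle p T d -> schle r (S \o T) (c * d).
Proof.
move=> h p0 q0 r0 pqr [c0 hc] [d0 hd]; split=> [|n u v hu hv]; first exact: mulr_ge0.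
have qpr : q^-1 + p^-1 = r^-1 by rewrite addrC.
apply: le_trans (sum_hoelder q0 p0 r0 qpr c0 d0 _ _ (hc n v hv) (hd n u hu)).
- apply: ler_sum => i _; apply: ler_powRl; rewrite ?cabs_ge0 ?(ltW r0)//=.
  by rewrite (adj_dotr _ _ h) dot_cs.
- by move=> i; exact: rnorm_ge0.
- by move=> i; exact: rnorm_ge0.
Qed.

Lemma colle_compl Q S p c : 0 <= p -> bnd 1 S -> colle p Q c -> colle p (S \o Q) c.
Proof.
move=> p0 b [c0 hc]; split=> // n u hu; apply: le_trans (hc n u hu).
by apply: ler_sum => i _; apply: ler_powRl; rewrite ?rnorm_ge0//= (le_trans (b _))// mul1r.
Qed.

Lemma colle_compr Q S S' p c : is_adjoint dot S S' -> bnd 1 S' -> colle p Q c -> colle p (Q \o S) c.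
Proof.
move=> h b [c0 hc]; split=> // n u hu; apply: hc.
exact: bessel_contraction h b hu.
Qed.

Lemma powR_split_norm c p : 0 <= c -> 0 < p ->
  c `^ (1 - p / 2) * c `^ (p / 2) = c.
Proof.
move=> c0 p0; rewrite -powRD; first by rewrite subrK powRr1.
by rewrite subrK oner_eq0.
Qed.

(* For [p < 2], [B = |T|] factors as [B `^ (1 - p/2)], with finite norm of exponent
   [2p/(2-p) >= 2], times the Hilbert-Schmidt operator [B `^ (p/2)]. *)
Lemma abs_factor T T' p c : bop T T' -> 1 <= p -> p < 2 -> schle p T c ->
  exists F1 F2, [/\ is_fun_calculus (fun t => t `^ (1 - p / 2)) (abs_operator T) F1,
    is_fun_calculus (fun t => t `^ (p / 2)) (abs_operator T) F2,
    forall x, F1 (F2 x) = abs_operator T x,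
    colle (2 * p / (2 - p)) F1 (c `^ (1 - p / 2)) & colle 2 F2 (c `^ (p / 2))].
Proof.
move=> bT p1 p2 hT; have pB := abs_posop bT; have [c0 _] := hT.
have a1 : 0 < 1 - p / 2 by lra.
have a2 : 0 < p / 2 by lra.
have p0 : 0 < p by lra.
have s0 : 0 < 2 - p by lra.
have sn0 : 2 - p != 0 by rewrite gt_eqF.
have [F1 h1] := fcal_powR pB a1; have [F2 h2] := fcal_powR pB a2.
have [G hG _] := abs_powR_exists bT p1.
have ht := (schle_basis_le bT p1 c0 hG).2 hT.
exists F1, F2; split=> //.
- apply: (fcal_comp pB h1 h2 (fcal_id _)) => t /andP[t0 _].
  exact: powR_split_norm.
- have E : (1 - p / 2) * (2 * p / (2 - p)) = p by field.
  apply: (fcal_colle pB a1 _ _ h1 (G := G)); rewrite ?powR_ge0 ?E//.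
    by rewrite ler_pdivlMr//; lra.
  by rewrite -powRrM E.
- have E : p / 2 * 2 = p by field.
  apply: (fcal_colle pB a2 _ _ h2 (G := G)); rewrite ?powR_ge0 ?E//.
  by rewrite -powRrM E.
Qed.

(** Up to a small error S T is (S W F1) F2, with W a contraction and |T| = F1 F2. Columns give S W
    F1 the exponent x with 1/x = 1/q + 1/p - 1/2 = 1/r - 1/2. As r >= 1, x is at least 2, so columns
    can be used once more, against the Hilbert-Schmidt operator F2. *)
Lemma schle_hoelder_lt2 p q r S S' T T' c d : 1 <= p -> p < 2 -> 1 <= q -> 1 <= r ->
  p^-1 + q^-1 = r^-1 -> bop S S' -> bop T T' -> schle q S c -> schle p T d ->
  schle r (S \o T) (c * d).
Proof.
move=> p1 p2 q1 r1 pqr bS bT hS hT.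
have [c0 _] := hS; have [d0 _] := hT.
have p0 : 0 < p by lra.
have q0 : 0 < q by lra.
have r0 : 0 < r by lra.
have s0 : 0 < 2 - p by lra.
have [F1 [F2 [h1 h2 F12 co1 co2]]] := abs_factor bT p1 p2 hT.
have pB := abs_posop bT.
have bF1 := fcal_bop pB h1; have bF2 := fcal_bop pB h2.
have ri : r^-1 <= 1 by rewrite invf_le1.
have pin : 2^-1 < p^-1 by rewrite ltf_pV2 ?posrE.
(* 1/q = 1/r - 1/p < 1 - 1/2. *)
have q2 : 2 <= q.
  rewrite -(@lef_pV2 _ q 2) ?posrE//; move: pqr ri pin; set u := p^-1; set v := q^-1; lra.
pose y := 2 * p / (2 - p).
have y0 : 0 < y by rewrite divr_gt0// mulr_gt0.
have yE : y^-1 = p^-1 - 2^-1 by rewrite /y; field; rewrite !gt_eqF.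
pose x := (q^-1 + y^-1)^-1.
have xi : x^-1 = r^-1 - 2^-1 by rewrite /x invrK yE -pqr; ring.
have x0 : 0 < x by rewrite invr_gt0 addr_gt0 ?invr_gt0.
have x2 : 2 <= x by rewrite -(@lef_pV2 _ x 2) ?posrE// xi; lra.
apply: schle_lsc => //; first exact: mulr_ge0.
move=> e e0; have N0 := opnorm_ge0 S.
have e'0 : 0 < e / (opnorm S + 1) by rewrite divr_gt0// ltr_wpDl.
have [W [W' [bW W1 W1' hW _]]] := polar_approx bT e'0.
exists (S \o W \o abs_operator T); last first.
  move=> z /=; rewrite -(adjB _ _ bS.1) (le_trans (bop_opnorm bS _))//.
  apply: (@le_trans _ _ ((opnorm S + 1) * (e / (opnorm S + 1) * rnorm z))).
    by apply: ler_pM; rewrite ?rnorm_ge0 ?lerDl ?hW.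
  by rewrite mulrA [_ * (e / _)]mulrC divfK// gt_eqF// ltr_wpDl.
apply: (@schle_mono _ _ (c * d)); [exact: ltW|by rewrite lerDl ltW|].
have X : schle x (S \o (W \o F1)) (c * d `^ (1 - p / 2)).
  apply: (colle_schle bS.1 y0 q0 x0); first by rewrite /x invrK addrC.
    exact: schle_colle (bop_sym bS) q2 (schle_adj bS.1 hS).
  by apply: colle_compl => //; exact: ltW.
have bX : bop (S \o (W \o F1)) ((F1 \o W') \o S') by apply: bop_comp bS _; exact: bop_comp.
have X' := schle_colle (bop_sym bX) x2 (schle_adj bX.1 X).
have -> : S \o W \o abs_operator T = (S \o (W \o F1)) \o F2.
  by apply/funext => z /=; rewrite F12.
have := colle_schle bX.1 (ltr0Sn R 1) x0 r0 _ X' co2.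
rewrite -mulrA powR_split_norm//; apply.
by rewrite xi addrC subrK.
Qed.

(** If q < 2 <= p, pass to the adjoint T' S', whose right factor has the small exponent. If both are
    at least 2, columns suffice. *)
Lemma schle_hoelder p q r S S' T T' c d : 1 <= p -> 1 <= q -> 1 <= r ->
  p^-1 + q^-1 = r^-1 -> bop S S' -> bop T T' -> schle q S c -> schle p T d ->
  schle r (S \o T) (c * d).
Proof.
move=> p1 q1 r1 pqr bS bT hS hT.
have [p2|p2] := ltP p 2; first exact: (schle_hoelder_lt2 p1 p2 q1 r1 pqr bS bT).
have [q2|q2] := ltP q 2.
  have bST := bop_comp bS bT.
  apply: (schle_adj (adj_sym bST.1)); rewrite mulrC.
  apply: (schle_hoelder_lt2 q1 q2 p1 r1 _ (bop_sym bT) (bop_sym bS)).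
  - by rewrite addrC.
  - exact: schle_adj bT.1 hT.
  - exact: schle_adj bS.1 hS.
apply: (colle_schle bS.1 _ _ _ pqr); try lra.
  exact: schle_colle (bop_sym bS) q2 (schle_adj bS.1 hS).
exact: schle_colle bT p2 hT.
Qed.

(** F D has Hilbert-Schmidt norm at most d because its adjoint D F has. If p < 2, T D is close to W
    F1 (F D), and Hoelder's inequality applies with exponents 2p / (2 - p) and 2. If p >= 2,
    Jensen's inequality bounds |T D u|^p by |F D u|^2 for u in the unit ball. *)
Lemma schle_cut p T T' D F c d : 1 <= p -> bop T T' -> bop D D -> bnd 1 D -> 0 <= d ->
  is_fun_calculus (fun t => t `^ (p / 2)) (abs_operator T) F -> schle p T c ->
  (forall s : seq H, sub_basis s -> \sum_(e <- s) rnorm (D (F e)) ^+ 2 <= d ^+ 2) ->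
  schle p (T \o D) (if p < 2 then c `^ (1 - p / 2) * d else d `^ (2 / p)).
Proof.
move=> p1 bT bD D1 d0 hF hT hd; have p0 : 0 < p by lra.
have pB := abs_posop bT; have bF := fcal_bop pB hF.
have hFD : is_adjoint dot (F \o D) (D \o F) by move=> x y; rewrite /= bF.1 bD.1.
have hs n (u : 'I_n -> H) : bessel u -> \sum_i rnorm (F (D (u i))) ^+ 2 <= d ^+ 2.
  by move=> hu; apply: (hs_adj hFD).
case: ltP => p2.
  have [F1 [F2 [h1 h2 F12 co1 _]]] := abs_factor bT p1 p2 hT.
  have FF2 := fcal_unique pB hF h2.
  have s0 : 0 < 2 - p by lra.
  have c10 : 0 <= c `^ (1 - p / 2) * d by rewrite mulr_ge0 ?powR_ge0.
  apply: schle_lsc => // e e0.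
  have [W [W' [bW W1 W1' hW _]]] := polar_approx bT e0.
  exists (W \o F1 \o (F \o D)); last first.
    move=> x /=; rewrite FF2 F12 (le_trans (hW _))//.
    by rewrite ler_wpM2l ?(ltW e0)// -[leRHS]mul1r.
  apply: (@schle_mono _ _ (c `^ (1 - p / 2) * d)); [exact: ltW|by rewrite lerDl ltW|].
  have bWF := bop_comp bW (fcal_bop pB h1).
  have y0 : 0 < 2 * p / (2 - p) by rewrite divr_gt0// mulr_gt0.
  apply: (colle_schle bWF.1 (ltr0Sn R 1) y0 p0).
  - by field; rewrite !gt_eqF.
  - exact: colle_compr (adj_sym bW.1) W1 co1.
  - split=> // n u hu; rewrite powR_mulrn//.
    by under eq_bigr do rewrite powR_mulrn ?rnorm_ge0//; exact: hs.
have [G hG _] := abs_powR_exists bT p1.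
split=> [|n u v hu hv]; first exact: powR_ge0.
rewrite -powRrM divfK ?gt_eqF// powR_mulrn//.
apply: le_trans (hs n u hu); apply: ler_sum => i _ /=.
apply: (@le_trans _ _ (rnorm (T (D (u i))) `^ p)).
  apply: ler_powRl; rewrite ?cabs_ge0 ?(ltW p0)// (le_trans (dot_cs _ _))//.
  by rewrite ler_piMl ?rnorm_ge0// bessel_norm.
have hFG : forall t, 0 <= t <= opnorm (abs_operator T) -> (t `^ (p / 2)) ^+ 2 = t `^ p.
  by move=> t /andP[t0 _]; exact: powR_half_sqr.
have hK := fcal_poly (abs_operator T) ('X ^+ 2).
have hX (t : R) : ('X ^+ 2).[t] = t ^+ 2 by rewrite hornerXn.
rewrite (fcal_rnorm _ pB hF hG hFG) -(rnorm_abs bT) -powR_sqr ?rnorm_ge0//.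
rewrite (fcal_rnorm _ pB (fcal_id _) hK) => [|t _]; last by rewrite hX.
apply: (fcal_jensen pB _ hK hG).
- by rewrite ler_pdivlMr// mul1r.
- by move=> t _; rewrite hX sqr_ge0.
- by move=> t /andP[t0 _]; rewrite hX powR_sqr.
- by rewrite (le_trans (D1 _))// mul1r bessel_norm.
Qed.

End SchattenBounds.

(** * Traces of cut-off operators *)

Section TraceFormulas.
Variables (R : realType) (H : hilbertType R).
Implicit Types (x y z : H) (Q S T B F G K D : H -> H) (c d p e t : R) (s : seq H).

Lemma uniq_sum_split (V : zmodType) (f : H -> V) (s t0 : seq H) : uniq s -> uniq t0 -> {subset t0 <= s} ->
  \sum_(e <- s) f e = \sum_(e <- t0) f e + \sum_(e <- [seq e <- s | e \notin t0]) f e.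
Proof.
move=> us ut st; rewrite (bigID [in t0])/= big_filter; congr (_ + _).
rewrite -big_filter; apply: perm_big; apply: uniq_perm; rewrite ?filter_uniq//.
by move=> z; rewrite mem_filter; case: (boolP (z \in t0)) => //= /st ->.
Qed.

Lemma parseval_seq (xs : seq H) d : 0 < d -> exists2 s0, sub_basis s0 &
  forall s, sub_basis s -> {subset s0 <= s} -> forall x, x \in xs ->
    rnorm (x - \sum_(e <- s) dot e x *: e) <= d.
Proof.
move=> d0; elim: xs => [|x xs [s hs hx]]; first by exists [::].
have [s0 hs0 h0] := parseval x d0.
exists (undup (s0 ++ s)); first exact: sub_basis_undup.
move=> s' hs' sub y; rewrite inE => /predU1P[->|].
  by apply: h0 => // z zs; apply: sub; rewrite mem_undup mem_cat zs.
by apply: hx => // z zs; apply: sub; rewrite mem_undup mem_cat zs orbT.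
Qed.

(** The operator with terms a_i <b_i, .> need not be positive, so its trace is taken as a limit
    along the finite subsets of the basis. *)
Lemma trace_rank n (a b : 'I_n -> H) e : 0 < e -> exists2 s0, sub_basis s0 &
  forall s, sub_basis s -> {subset s0 <= s} ->
  cabs (\sum_(x <- s) \sum_i dot (b i) x * dot x (a i) - \sum_i dot (b i) (a i)) <= e.
Proof.
move=> e0; pose C := \sum_i rnorm (b i) + 1.
have C0 : 0 < C by rewrite ltr_wpDl// sumr_ge0// => i _; exact: rnorm_ge0.
have [s0 hs0 h] := parseval_seq (codom a) (divr_gt0 e0 C0).
exists s0 => // s hs sub; rewrite exchange_big /= -sumrB.
apply: (le_trans (cabs_sum _ _ _)).
apply: (@le_trans _ _ (\sum_i rnorm (b i) * (e / C))).
  apply: ler_sum => i _.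
  have -> : \sum_(x <- s) dot (b i) x * dot x (a i) - dot (b i) (a i) =
      - dot (b i) (a i - \sum_(x <- s) dot x (a i) *: x).
    rewrite dotBr opprB dot_sumr; congr (_ - _); apply: eq_bigr => x _.
    by rewrite dotZr mulrC.
  rewrite cabsN (le_trans (dot_cs _ _))// ler_wpM2l ?rnorm_ge0//.
  by apply: h => //; exact: codom_f.
rewrite -mulr_suml -ler_pdivlMr ?divr_gt0//.
have -> : e / (e / C) = C by field; rewrite !gt_eqF.
by rewrite /C lerDl.
Qed.

Lemma trace_fin G t : (forall x, 0 <= complex.Re (dot x (G x))) -> basis_le G t ->
  exists u : R, [/\ trace G = u%:E, 0 <= u, basis_le G u & forall u', basis_le G u' -> u <= u'].
Proof.
move=> G0 ht; have h0 : (0 <= trace G)%E by apply: esum_ge0 => x _; rewrite lee_fin.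
have h1 := (trace_leP t G0).2 ht.
exists (fine (trace G)); have E : trace G = (fine (trace G))%:E.
  rewrite fineK// ge0_fin_numE//; apply: le_lt_trans h1 _; exact: ltry.
split=> //; first by rewrite fine_ge0.
  by apply/(trace_leP _ G0); rewrite -E.
by move=> u' /(trace_leP _ G0); rewrite E lee_fin.
Qed.

Lemma trace_approx G u e : (forall x, 0 <= complex.Re (dot x (G x))) -> trace G = u%:E ->
  0 < e -> exists2 s, sub_basis s & u - e < \sum_(x <- s) complex.Re (dot x (G x)).
Proof.
move=> G0 tu e0; apply: contrapT => h.
have : basis_le G (u - e).
  move=> s hs; rewrite leNgt; apply/negP => h'; apply: h; by exists s.
by move=> /(trace_leP _ G0); rewrite tu lee_fin; lra.
Qed.

Lemma sub_basis_sum_le (f : H -> R) (s t0 : seq H) : sub_basis s -> sub_basis t0 ->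
  (forall x, 0 <= f x) -> {subset s <= t0} -> \sum_(e <- s) f e <= \sum_(e <- t0) f e.
Proof. by move=> [us _] [ut _]; exact: uniq_sum_le. Qed.

Lemma sub_undupl (s t0 : seq H) : {subset s <= undup (s ++ t0)}.
Proof. by move=> z zs; rewrite mem_undup mem_cat zs. Qed.

Lemma sub_undupr (s t0 : seq H) : {subset t0 <= undup (s ++ t0)}.
Proof. by move=> z zs; rewrite mem_undup mem_cat zs orbT. Qed.

Lemma poly_operator_ker q B S x : is_adjoint dot B S -> B x = 0 ->
  poly_operator q B x = (q.[0])%:C%C *: x.
Proof.
move=> hB Bx0; elim/poly_ind: q => [|q c _].
  by rewrite /poly_operator size_poly0 big_ord0 horner0 scale0r.
rewrite poly_operatorD poly_operatorMX Bx0 poly_operatorC !hornerE.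
rewrite /poly_operator big1 ?add0r// => i _.
by rewrite -[X in _ *: X](_ : 0 = _) ?scaler0//; elim: (i : nat) => //= k <-; rewrite (adj0 hB).
Qed.

Lemma fcal_ker B f F x : posop B -> is_fun_calculus f B F -> f 0 = 0 -> B x = 0 -> F x = 0.
Proof.
move=> pB hF f0 Bx0; apply: rnorm_eq0; apply/eqP; rewrite eq_le rnorm_ge0 andbT.
apply: (@le_of_epsM _ _ _ (2 * rnorm x)) => [|e e0]; first by rewrite mulr_ge0 ?rnorm_ge0.
have [q q1 q2] := fcal_approx hF e0; rewrite add0r.
have := q2 x; rewrite (poly_operator_ker q pB.1.1 Bx0).
have := q1 0; rewrite lexx opnorm_ge0 f0 subr0 => /(_ isT) h h2.
have -> : F x = (q.[0])%:C%C *: x - ((q.[0])%:C%C *: x - F x) by rewrite opprB addrC subrK.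
rewrite (le_trans (rnormB _ _))// mulrCA mulr2n mulrDl mul1r lerD//.
by rewrite rnormZ cabsR ler_wpM2r ?rnorm_ge0.
Qed.

(** [K] is determined by its values on the span of the [b i], of dimension at most n. Each vector of
    an orthonormal family there contributes at most e, by Cauchy-Schwarz and Bessel. *)
Lemma trace_small n (b : 'I_n -> H) K S e s : is_adjoint dot K S -> bnd e K -> 0 <= e ->
  (forall x, (forall i, dot (b i) x = 0) -> K x = 0) -> sub_basis s ->
  `|\sum_(x <- s) complex.Re (dot x (K x))| <= n%:R * e.
Proof.
move=> hK bK e0 Kb hs.
have [m [u [mn hu us]]] := gram_schmidt (codom b); rewrite size_codom card_ord in mn.
have KE x : K x = \sum_j dot (u j) x *: K (u j).
  apply/eqP; rewrite -subr_eq0; apply/eqP.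
  have -> : K x - \sum_j dot (u j) x *: K (u j) = K (x - \sum_j dot (u j) x *: u j).
    rewrite (adjB _ _ hK) (adj_sum _ _ _ hK); congr (_ - _).
    by apply: eq_bigr => j _; rewrite (adjZ _ _ hK).
  apply: Kb => i; rewrite (dot_spannedl _ (us _ (codom_f b i))) big1// => j _.
  by rewrite dotBr orthonormal_proj// subrr mulr0.
have -> : \sum_(x <- s) complex.Re (dot x (K x)) =
   complex.Re (\sum_j \sum_(x <- s) dot (u j) x * dot x (K (u j))).
  rewrite exchange_big /= Re_sum; apply: eq_bigr => x _.
  by rewrite {1}KE dot_sumr; congr complex.Re; apply: eq_bigr => j _; rewrite dotZr.
apply: (le_trans (Re_le_cabs _)); apply: (le_trans (cabs_sum _ _ _)).
apply: (@le_trans _ _ (\sum_(j < m) e)); last first.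
  by rewrite sumr_const card_ord -[leLHS]mulr_natl ler_wpM2r// ler_nat.
apply: ler_sum => j _; apply: (le_trans (cabs_sum _ _ _)).
have nu := orthonormal_norm j hu.
have B1 : \sum_(x <- s) cabs (dot (u j) x) ^+ 2 <= 1 ^+ 2.
  by under eq_bigr do rewrite cabs_dotC; rewrite -nu; exact: sub_basis_bessel.
have B2 : \sum_(x <- s) cabs (dot x (K (u j))) ^+ 2 <= e ^+ 2.
  apply: (le_trans (sub_basis_bessel _ hs)).
  by rewrite ler_pXn2r ?nnegrE ?rnorm_ge0// (le_trans (bK _))// nu mulr1.
under eq_bigr do rewrite cabsM.
rewrite big_tnth in B1; rewrite big_tnth in B2; rewrite big_tnth.
rewrite -[leRHS]mul1r; apply: sumM_le_sqr => // i; exact: cabs_ge0.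
Qed.

(** The factor 'X makes the polynomial vanish at 0. So r(T^* T) T^* T has finite rank, with the
    trace given by [trace_rank]; it differs from |T|^p by an operator of norm at most e that
    vanishes on vectors orthogonal to all [b i], and [trace_small] turns e into n e. *)
Lemma finite_rank_trace p T T' n (a b : 'I_n -> H) (r : {poly R}) e : 1 <= p -> bop T T' ->
  (forall x, T x = \sum_i dot (b i) x *: a i) -> 0 < e ->
  (forall t, 0 <= t <= opnorm (abs_operator T) -> `|t `^ p - (r * 'X).[t * t]| <= e) ->
  exists u : R, [/\ trace_abs_pow p T = u%:E, 0 <= u &
   `|u - complex.Re (\sum_i dot (b i) (poly_operator r (T' \o T) (T' (a i))))| <= n%:R * e].
Proof.
move=> p1 bT TE e0 hr; have p0 : 0 < p by lra.
have pB := abs_posop bT; set B := abs_operator T in pB hr *.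
have [G hG ->] := abs_powR_exists bT p1.
have G0 x : 0 <= complex.Re (dot x (G x)) by exact: fcal_powR_ge0 pB hG.
have hpoly := fcal_poly B ((r * 'X) \Po ('X * 'X)).
have hor (t : R) : ((r * 'X) \Po ('X * 'X)).[t] = (r * 'X).[t * t].
  by rewrite horner_comp !hornerE.
pose a' i := poly_operator r (T' \o T) (T' (a i)).
pose K x := G x - poly_operator ((r * 'X) \Po ('X * 'X)) B x.
have bK : bnd e K.
  apply: (fcal_bnd_dist pB (ltW e0) hG hpoly) => t ht; rewrite hor; exact: hr.
have bopK : bop K K := bopB (fcal_bop pB hG) (fcal_bop pB hpoly).
have BB : B \o B = T' \o T by apply/funext => x; rewrite /= /B (abs_sqr bT).
have adjr := poly_operator_adj r (posop_sqr bT).1.1.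
have polyE x : poly_operator ((r * 'X) \Po ('X * 'X)) B x = \sum_i dot (b i) x *: a' i.
  rewrite poly_operator_sqr BB poly_operatorMX /= TE.
  rewrite (adj_sum _ _ _ (adj_sym bT.1)) (adj_sum _ _ _ adjr).
  by apply: eq_bigr => i _; rewrite (adjZ _ _ (adj_sym bT.1)) (adjZ _ _ adjr).
have Kb x : (forall i, dot (b i) x = 0) -> K x = 0.
  move=> bx; have Tx : T x = 0 by rewrite TE big1// => i _; rewrite bx scale0r.
  have Bx : B x = 0 by apply: rnorm_eq0; rewrite (rnorm_abs bT) Tx rnorm0.
  rewrite /K (fcal_ker pB hG _ Bx) ?powR0 ?gt_eqF//.
  rewrite (poly_operator_ker _ pB.1.1 Bx) hor hornerM hornerX.
  by rewrite !mulr0 scale0r subrr.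
set t := complex.Re _.
have key (d : R) : 0 < d -> exists2 s0, sub_basis s0 & forall s, sub_basis s -> {subset s0 <= s} ->
    `|\sum_(x <- s) complex.Re (dot x (G x)) - t| <= n%:R * e + d.
  move=> d0; have [s0 hs0 h] := trace_rank a' b d0; exists s0 => // s hs sub.
  have sm := trace_small bopK.1 bK (ltW e0) Kb hs.
  have {h} := le_trans (Re_le_cabs _) (h s hs sub); rewrite ReD ReN -/t.
  have -> : complex.Re (\sum_(x <- s) \sum_i dot (b i) x * dot x (a' i)) =
      \sum_(x <- s) complex.Re (dot x (G x)) - \sum_(x <- s) complex.Re (dot x (K x)).
    rewrite Re_sum -sumrB; apply: eq_bigr => x _.
    rewrite /K dotBr ReD ReN opprD opprK addNKr polyE dot_sumr; congr complex.Re.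
    by apply: eq_bigr => i _; rewrite dotZr.
  move: sm; rewrite !ler_norml => /andP[h1 h2] /andP[h3 h4]; apply/andP; split; lra.
have le1 : basis_le G (t + n%:R * e).
  move=> s hs; apply: le_of_eps => d d0; have [s0 hs0 h] := key d d0.
  have su := sub_basis_undup hs hs0.
  apply: (le_trans (sub_basis_sum_le hs su G0 (@sub_undupl s s0))).
  have := h _ su (@sub_undupr s s0); rewrite ler_norml => /andP[_]; lra.
have [u [uE u0 hu umin]] := trace_fin G0 le1.
exists u; split=> //; rewrite ler_norml; apply/andP; split; last first.
  by rewrite lerBlDl umin.
rewrite lerNl; apply: le_of_eps => d d0; have [s0 hs0 h] := key d d0.
have := h _ hs0 (fun=> id); have := hu _ hs0; rewrite ler_norml => h1 /andP[h2 _]; lra.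
Qed.

(* [g] is the trace of [D |T|^p D], computed as [tr |T|^p - tr ((1 - D^2) |T|^p)],
   where [1 - D^2] has finite rank. *)
Lemma cut_trace p T T' D F G n (a b : 'I_n -> H) (u : R) : 1 <= p -> bop T T' -> is_adjoint dot D D ->
  is_fun_calculus (fun t => t `^ (p / 2)) (abs_operator T) F ->
  is_fun_calculus (fun t => t `^ p) (abs_operator T) G ->
  (forall x, D (D x) = x - \sum_i dot (b i) x *: a i) -> trace_abs_pow p T = u%:E ->
  let g := u - complex.Re (\sum_i dot (b i) (G (a i))) in
  (forall s, sub_basis s -> \sum_(x <- s) rnorm (D (F x)) ^+ 2 <= g) /\
  (forall t, (forall s, sub_basis s -> \sum_(x <- s) rnorm (D (F x)) ^+ 2 <= t) -> g <= t).
Proof.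
move=> p1 bT aD hF hG DD tru; have pB := abs_posop bT; set B := abs_operator T in pB hF hG *.
have trG : trace G = u%:E.
  have [G' hG' E] := abs_powR_exists bT p1; rewrite -tru E.
  by rewrite (fcal_unique pB hG hG').
have G0 x : 0 <= complex.Re (dot x (G x)) by exact: fcal_powR_ge0 pB hG.
have FG : forall t, 0 <= t <= opnorm B -> t `^ (p / 2) * t `^ (p / 2) = t `^ p.
  by move=> t /andP[t0 _]; rewrite -expr2 powR_half_sqr.
have FF x y : dot (F x) (F y) = dot x (G y) by rewrite (fcal_mul pB hF hF hG).
have aF := fcal_adj pB hF.
have DE x : rnorm (D (F x)) ^+ 2 = complex.Re (dot x (G x)) -
    complex.Re (\sum_i dot (F (b i)) x * dot x (F (a i))).
  rewrite rnorm_sqr aD DD dotBr ReD ReN FF dot_sumr; congr (_ - complex.Re _).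
  by apply: eq_bigr => i _; rewrite dotZr !aF.
move=> g.
have key (d : R) : 0 < d -> exists2 s0, sub_basis s0 & forall s, sub_basis s -> {subset s0 <= s} ->
    `|\sum_(x <- s) rnorm (D (F x)) ^+ 2 - g| <= d.
  move=> d0; have d20 : 0 < d / 2 by rewrite divr_gt0.
  have [s1 hs1 h1] := trace_rank (F \o a) (F \o b) d20.
  have [s2 hs2 h2] := trace_approx G0 trG d20.
  exists (undup (s1 ++ s2)); first exact: sub_basis_undup.
  move=> s hs sub.
  have k1 : \sum_(x <- s) complex.Re (dot x (G x)) <= u.
    by apply: (trace_leP _ G0).1 => //; rewrite trG.
  have k2 : \sum_(x <- s2) complex.Re (dot x (G x)) <= \sum_(x <- s) complex.Re (dot x (G x)).
    by apply: sub_basis_sum_le => // z zs; apply: sub; exact: sub_undupr.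
  have := le_trans (Re_le_cabs _) (h1 s hs (fun z zs => sub z (@sub_undupl s1 s2 z zs))).
  rewrite ReD ReN Re_sum /=.
  under [X in complex.Re X]eq_bigr do rewrite FF.
  under [X in _ -> `|X - _| <= _]eq_bigr do rewrite DE.
  rewrite sumrB /g; set X := \sum_(x <- s) complex.Re (\sum_i _); set Y := complex.Re _.
  rewrite !ler_norml => /andP[h3 h4]; apply/andP; split; lra.
split=> [s hs|t ht]; apply: le_of_eps => d d0; have [s0 hs0 h] := key d d0.
  have su := sub_basis_undup hs hs0.
  apply: (le_trans (sub_basis_sum_le hs su _ (@sub_undupl s s0))) => [x|]; first exact: sqr_ge0.
  have := h _ su (@sub_undupr s s0); rewrite ler_norml => /andP[_]; lra.
have := h _ hs0 (fun=> id); have := ht _ hs0; rewrite ler_norml => h1 /andP[h2 _]; lra.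
Qed.

(** A finite part s0 of the basis carries all but e/2 of the trace of |T|^p. On it, smallness of D
    at the finitely many vectors F x suffices; elsewhere, contractivity of D. *)
Lemma cut_small p T T' F (u : R) e : 1 <= p -> bop T T' ->
  is_fun_calculus (fun t => t `^ (p / 2)) (abs_operator T) F ->
  trace_abs_pow p T = u%:E -> 0 < e ->
  exists (xs : seq H) (d : R), 0 < d /\
   forall D, bnd 1 D -> (forall x, x \in xs -> rnorm (D x) <= d) ->
   forall s, sub_basis s -> \sum_(x <- s) rnorm (D (F x)) ^+ 2 <= e.
Proof.
move=> p1 bT hF tru e0; have pB := abs_posop bT; set B := abs_operator T in pB hF *.
have [G hG trG] := abs_powR_exists bT p1; rewrite tru in trG.
have G0 x : 0 <= complex.Re (dot x (G x)) by exact: fcal_powR_ge0 pB hG.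
have FG x : rnorm (F x) ^+ 2 = complex.Re (dot x (G x)).
  by apply: (fcal_rnorm _ pB hF hG) => t /andP[t0 _]; exact: powR_half_sqr.
have e20 : 0 < e / 2 by rewrite divr_gt0.
have [s0 hs0 h0] := trace_approx G0 (esym trG) e20.
have k0 : 0 < (size s0).+1%:R :> R by rewrite ltr0n.
exists (map F s0), (Num.sqrt (e / 2 / (size s0).+1%:R)).
split; first by rewrite sqrtr_gt0 divr_gt0.
move=> D D1 Dx s hs; have su := sub_basis_undup hs0 hs.
apply: (le_trans (sub_basis_sum_le hs su _ (@sub_undupr s0 s))) => [x|]; first exact: sqr_ge0.
have split_ (f : H -> R) := uniq_sum_split f su.1 hs0.1 (@sub_undupl s0 s).
rewrite split_ (splitr e) lerD//.
  apply: (@le_trans _ _ (\sum_(x <- s0) (e / 2 / (size s0).+1%:R))).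
    rewrite big_seq [leRHS]big_seq; apply: ler_sum => x xs0.
    rewrite -[leRHS]sqr_sqrtr ?(ltW (divr_gt0 e20 k0))//.
    by rewrite ler_pXn2r ?nnegrE ?rnorm_ge0 ?sqrtr_ge0// Dx// map_f.
  rewrite big_const_seq count_predT iter_addr_0 -[leLHS]mulr_natr mulrAC ler_pdivrMr// ler_wpM2l ?(ltW e20)//.
  by rewrite ler_nat.
apply: (@le_trans _ _ (\sum_(x <- [seq x <- undup (s0 ++ s) | x \notin s0]) complex.Re (dot x (G x)))).
  apply: ler_sum => x _; rewrite -FG ler_pXn2r ?nnegrE ?rnorm_ge0//.
  by rewrite (le_trans (D1 _))// mul1r.
have : \sum_(x <- undup (s0 ++ s)) complex.Re (dot x (G x)) <= u.
  by apply: (trace_leP _ G0).1 => //; rewrite -trG.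
rewrite split_; lra.
Qed.

End TraceFormulas.

(** * Gelfand theory *)

Section CStarAlgebra.
Variables (R : realType) (A : commCStarType R).
Implicit Types (x y z a b c h : A) (N M : A -> R).

Lemma cmulDr a b c : cmul a (b + c) = cmul a b + cmul a c.
Proof. by rewrite cmulC cmulDl !(cmulC a). Qed.
Lemma cmulZr (k : R[i]) a b : cmul a (k *: b) = k *: cmul a b.
Proof. by rewrite cmulC cmulZl cmulC. Qed.
Lemma cmulNl a b : cmul (- a) b = - cmul a b.
Proof. by rewrite -scaleN1r cmulZl scaleN1r. Qed.
Lemma cmulNr a b : cmul a (- b) = - cmul a b.
Proof. by rewrite cmulC cmulNl cmulC. Qed.
Lemma cmulBl a b c : cmul (a - b) c = cmul a c - cmul b c.
Proof. by rewrite cmulDl cmulNl. Qed.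
Lemma cmulBr a b c : cmul a (b - c) = cmul a b - cmul a c.
Proof. by rewrite cmulDr cmulNr. Qed.
Lemma cstarN a : cstar (- a) = - cstar a.
Proof. by rewrite -scaleN1r cstarZ rmorphN rmorph1 scaleN1r. Qed.
Lemma cstarB a b : cstar (a - b) = cstar a - cstar b.
Proof. by rewrite cstarD cstarN. Qed.
Lemma cstarMC a b : cstar (cmul a b) = cmul (cstar a) (cstar b).
Proof. by rewrite cstarM cmulC. Qed.

Lemma rnorm_cmul a b : rnorm (cmul a b) <= rnorm a * rnorm b.
Proof. by rewrite -lecR rmorphM /= -!rnormE cmul_norm. Qed.
Lemma rnorm_cstar_mul a : rnorm (cmul (cstar a) a) = rnorm a ^+ 2.
Proof. by apply: complexI; rewrite rmorphXn /= -!rnormE cstar_norm. Qed.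

(** The model is the supremum of |chi| over a closed set of characters. Shrinking the set to one
    point yields the absolute value of a single character, which is why minimal seminorms are
    sought. *)
Record cstar_seminorm N : Prop := CStarSeminorm {
  csn_ge0 : forall x, 0 <= N x ;
  csn_le : forall x, N x <= rnorm x ;
  csnD : forall x y, N (x + y) <= N x + N y ;
  csnZ : forall k x, N (k *: x) = cabs k * N x ;
  csnM : forall x y, N (cmul x y) <= N x * N y ;
  csn_sqr : forall x, N (cmul (cstar x) x) = N x ^+ 2 }.

Lemma rnorm_csn : cstar_seminorm (@rnorm R A).
Proof.
split; [exact: rnorm_ge0|by []|exact: rnormD|exact: rnormZ|exact: rnorm_cmul|].
exact: rnorm_cstar_mul.
Qed.

(** The multiplicative inequalities are asked only up to passing to another member of the directed
    family: this is the form in which they hold for the maps x |-> N (b^n x). *)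
Lemma inf_csn (F : set (A -> R)) : F !=set0 ->
  (forall M M', F M -> F M' -> exists2 L, F L & forall x, L x <= M x /\ L x <= M' x) ->
  (forall M, F M -> [/\ forall x, 0 <= M x, forall x, M x <= rnorm x,
      forall x y, M (x + y) <= M x + M y & forall k x, M (k *: x) = cabs k * M x]) ->
  (forall M, F M -> exists2 L, F L & forall x y, L (cmul x y) <= M x * M y) ->
  (forall M, F M -> exists2 L, F L & forall x, L (cmul (cstar x) x) <= M x ^+ 2) ->
  (forall M x, F M -> exists2 L, F L & L x ^+ 2 <= M (cmul (cstar x) x)) ->
  cstar_seminorm (fun x => inf [set M x | M in F]).
Proof.
move=> [M0 FM0] dir hF hM hsq1 hsq; set N := fun x => _.
have hi x : has_inf [set M x | M in F].
  split; first by exists (M0 x), M0.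
  by exists 0 => _ [M FM <-]; have [h _ _ _] := hF _ FM.
have Nle M x : F M -> N x <= M x.
  by move=> FM; apply: (ge_inf (hi x).2); exists M.
have leN x t : (forall M, F M -> t <= M x) -> t <= N x.
  by move=> h; apply: lb_le_inf (hi x).1 _ => _ [M FM <-]; exact: h.
have Nadh x (e : R) : 0 < e -> exists2 M, F M & M x < N x + e.
  by move=> e0; have [_ [M FM <-] h] := inf_adherent e0 (hi x); exists M.
have N0 x : 0 <= N x by apply: leN => M /hF[].
have Nmul x y : N (cmul x y) <= N x * N y.
  have C0 : 0 <= N x + N y + 1 by rewrite !addr_ge0.
  apply: (le_of_epsM C0) => e e0.
  wlog e1 : e e0 / e <= 1.
    move=> W; have [e1|/ltW e1] := leP e 1; first exact: W.
    by rewrite (le_trans (W 1 ltr01 (lexx _)))// lerD2l ler_wpM2r.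
  have [M1 F1 h1] := Nadh x e e0; have [M2 F2 h2] := Nadh y e e0.
  have [M FM hMM] := dir _ _ F1 F2; have [L FL hL] := hM _ FM.
  have [p1 _ _ _] := hF _ FM.
  apply: (le_trans (Nle _ _ FL)); apply: (le_trans (hL x y)).
  apply: (@le_trans _ _ ((N x + e) * (N y + e))).
    apply: ler_pM => //; first exact: le_trans (hMM x).1 (ltW h1).
    exact: le_trans (hMM y).2 (ltW h2).
  have : e * e <= e * 1 by rewrite ler_wpM2l// ltW.
  by set u := N x; set v := N y; lra.
split=> //.
- by move=> x; have [_ h _ _] := hF _ FM0; exact: le_trans (Nle _ x FM0) (h x).
- move=> x y; apply: (@le_of_epsM _ _ _ 2) => // e e0.
  have [M1 F1 h1] := Nadh x e e0; have [M2 F2 h2] := Nadh y e e0.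
  have [M FM hMM] := dir _ _ F1 F2; have [_ _ hD _] := hF _ FM.
  apply: (le_trans (Nle _ _ FM)); apply: (le_trans (hD x y)).
  by have := (hMM x).1; have := (hMM y).2; lra.
- have key k x : N (k *: x) <= cabs k * N x.
    apply: (le_of_epsM (cabs_ge0 k)) => e e0; have [M FM h] := Nadh x e e0.
    have [_ _ _ hZ] := hF _ FM; apply: (le_trans (Nle _ _ FM)).
    by rewrite hZ (mulrC e) -mulrDr ler_wpM2l ?cabs_ge0// ltW.
  move=> k x; apply/eqP; rewrite eq_le key /=.
  apply: leN => M FM; have [_ _ _ hZ] := hF _ FM.
  by rewrite hZ ler_wpM2l ?cabs_ge0// Nle.
move=> x; apply/eqP; rewrite eq_le; apply/andP; split; last first.
  apply: leN => M FM; have [L FL hL] := hsq M x FM; apply: le_trans hL.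
  by rewrite ler_pXn2r ?nnegrE//; [exact: Nle|have [h _ _ _] := hF _ FL; exact: h].
have C0 : 0 <= N x + N x + 1 by rewrite !addr_ge0.
apply: (le_of_epsM C0) => e e0.
wlog e1 : e e0 / e <= 1.
  move=> W; have [e1|/ltW e1] := leP e 1; first exact: W.
  by rewrite (le_trans (W 1 ltr01 (lexx _)))// lerD2l ler_wpM2r.
have [M FM h] := Nadh x e e0; have [L FL hL] := hsq1 _ FM.
apply: (le_trans (Nle _ _ FL)); apply: (le_trans (hL x)).
have [p1 _ _ _] := hF _ FM.
apply: (@le_trans _ _ ((N x + e) ^+ 2)).
  by rewrite ler_pXn2r ?nnegrE ?(ltW h)// addr_ge0// ltW.
have : e * e <= e * 1 by rewrite ler_wpM2l// ltW.
by rewrite !expr2; set u := N x; lra.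
Qed.

Lemma csn_star N x : cstar_seminorm N -> N (cstar x) = N x.
Proof.
move=> cN; have key y : N y <= N (cstar y).
  have [->|n0] := eqVneq (N y) 0; first exact: csn_ge0 cN _.
  have np : 0 < N y by rewrite lt_def n0 (csn_ge0 cN).
  by rewrite -(ler_pM2r np) -expr2 -(csn_sqr cN) (csnM cN).
by apply/eqP; rewrite eq_le key andbT -{2}(cstarK x) key.
Qed.

Lemma csnN N x : cstar_seminorm N -> N (- x) = N x.
Proof. by move=> cN; rewrite -scaleN1r (csnZ cN) cabsN cabs1 mul1r. Qed.

Lemma csnB N x y : cstar_seminorm N -> N (x - y) <= N x + N y.
Proof. by move=> cN; rewrite -(csnN y cN) (csnD cN). Qed.

(** Zorn's lemma; the infimum of a chain keeps the value at [x0], on which all members agree. *)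
Lemma minimal_csn x0 : exists2 N, cstar_seminorm N /\ N x0 = rnorm x0 &
  forall M, cstar_seminorm M -> M x0 = rnorm x0 -> (forall x, M x <= N x) ->
  forall x, N x <= M x.
Proof.
pose T := {N : A -> R | cstar_seminorm N /\ N x0 = rnorm x0}.
pose le (N M : T) := `[< forall x, sval M x <= sval N x >].
pose t0 : T := exist _ (@rnorm R A) (conj rnorm_csn erefl).
have [||F Ftot|[N [cN Nx]] Nmax] := @ZL_preorder T t0 le.
- by move=> t; apply/asboolP.
- by move=> r s t /asboolP h1 /asboolP h2; apply/asboolP => x; exact: le_trans (h2 x) (h1 x).
- have [[M FM]|F0] := pselect (F !=set0); last first.
    by exists t0 => s Fs; case: F0; exists s.
  pose G := [set sval L | L in F].
  have cG L : G L -> cstar_seminorm L /\ L x0 = rnorm x0.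
    by move=> [K FK <-]; exact: svalP K.
  have cI : cstar_seminorm (fun x => inf [set L x | L in G]).
    apply: inf_csn; first by exists (sval M), M.
    - move=> _ _ [L FL <-] [K FK <-]; have [/asboolP h|/asboolP h] := Ftot _ _ FL FK.
        by exists (sval K); [exists K|move=> x; split].
      by exists (sval L); [exists L|move=> x; split].
    - move=> L /cG[cL _]; split; [exact: csn_ge0|exact: csn_le|exact: csnD|exact: csnZ].
    - by move=> L GL; have [cL _] := cG _ GL; exists L => // x y; exact: csnM.
    - by move=> L GL; have [cL _] := cG _ GL; exists L => // x; rewrite (csn_sqr cL).
    - by move=> L x GL; have [cL _] := cG _ GL; exists L => //; rewrite (csn_sqr cL).
  have ix : inf [set L x0 | L in G] = rnorm x0.
    rewrite (_ : [set L x0 | L in G] = [set rnorm x0]) ?inf1//.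
    apply/seteqP; split=> [_ [L GL <-]|_ ->]; first by rewrite /= (cG _ GL).2.
    by exists (sval M); [exists M|exact: (svalP M).2].
  exists (exist (fun N => cstar_seminorm N /\ N x0 = rnorm x0) _ (conj cI ix)) => L FL; apply/asboolP => x /=.
  apply: ge_inf; last by exists (sval L) => //; exists L.
  by exists 0 => _ [K GK <-]; exact: csn_ge0 (cG _ GK).1 x.
exists N => // M cM Mx MN x.
have /asboolP := Nmax (exist (fun N => cstar_seminorm N /\ N x0 = rnorm x0) M (conj cM Mx)) ltac:(by apply/asboolP); exact.
Qed.

(** The element b^n x: in the absence of a unit, b^n is used as a multiplier. *)
Definition powm b n x := iter n (cmul b) x.

Lemma powmD b n x y : powm b n (x + y) = powm b n x + powm b n y.
Proof. by elim: n => //= n ->; rewrite cmulDr. Qed.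
Lemma powmZ b n (k : R[i]) x : powm b n (k *: x) = k *: powm b n x.
Proof. by elim: n => //= n ->; rewrite cmulZr. Qed.
Lemma powmMl b n x y : powm b n (cmul x y) = cmul (powm b n x) y.
Proof. by elim: n => //= n ->; rewrite cmulA. Qed.
Lemma powmMM b m n x y : powm b (m + n) (cmul x y) = cmul (powm b m x) (powm b n y).
Proof. by rewrite /powm iterD -/(powm b n _) cmulC powmMl cmulC -/(powm b m _) powmMl. Qed.
Lemma powm_star b n x : cstar b = b -> cstar (powm b n x) = powm b n (cstar x).
Proof. by move=> sb; elim: n => //= n IH; rewrite cstarMC sb IH. Qed.

Lemma powm_decr N b x m n : cstar_seminorm N -> N b = 1 -> (m <= n)%N ->
  N (powm b n x) <= N (powm b m x).
Proof.
move=> cN b1 mn; rewrite -(subnKC mn); elim: (n - m)%N => [|k IH]; first by rewrite addn0.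
by rewrite addnS /= (le_trans (csnM cN _ _))// b1 mul1r.
Qed.

(* Concentrates [N] where the self-adjoint element [b] attains its norm. *)
Lemma csn_concentrate N b : cstar_seminorm N -> cstar b = b -> N b = 1 ->
  cstar_seminorm (fun x => inf [set M x | M in range (fun n x => N (powm b n x))]).
Proof.
move=> cN sb b1; set F := range _.
have FP n : F (fun x => N (powm b n x)) by exists n.
apply: inf_csn.
- by exists (fun x => N (powm b 0 x)).
- move=> _ _ [m _ <-] [n _ <-]; exists (fun x => N (powm b (maxn m n) x)) => // x.
  by split; apply: powm_decr => //; rewrite ?leq_maxl ?leq_maxr.
- move=> _ [n _ <-]; split=> [x|x|x y|k x]; first exact: csn_ge0 cN _.
  + by rewrite (le_trans (@powm_decr N b x 0 n cN b1 isT))//= (csn_le cN).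
  + by rewrite powmD (csnD cN).
  + by rewrite powmZ (csnZ cN).
- move=> _ [n _ <-]; exists (fun x => N (powm b (n + n) x)) => // x y.
  by rewrite powmMM (csnM cN).
- move=> _ [n _ <-]; exists (fun x => N (powm b (n + n) x)) => // x.
  by rewrite powmMM -powm_star// (csn_sqr cN).
- move=> _ x [n _ <-]; exists (fun x => N (powm b n x)) => //.
  by rewrite -(csn_sqr cN) powm_star// -powmMM powm_decr// leq_addr.
Qed.

(** By the C*-identity squaring preserves norm 1, which reaches arbitrarily high powers of b; the
    norms of the powers decrease, so those in between have norm 1 too. *)
Lemma powm_norm N b n : cstar_seminorm N -> cstar b = b -> N b = 1 -> N (powm b n b) = 1.
Proof.
move=> cN sb b1; apply/eqP; rewrite eq_le; apply/andP; split.
  by rewrite -b1; exact: (@powm_decr N b b 0 n cN b1 isT).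
have [k kn hk] : exists2 k, (n <= k)%N & N (powm b k b) = 1.
  elim: n => [|n [k nk hk]]; first by exists 0%N.
  exists (k + k).+1; first by rewrite ltnS (leq_trans nk)// leq_addr.
  have -> : powm b (k + k).+1 b = cmul (cstar (powm b k b)) (powm b k b).
    by rewrite powm_star// sb -powmMM /powm iterSr.
  by rewrite (csn_sqr cN) hk expr1n.
by rewrite -hk; exact: powm_decr.
Qed.

(** If N (d^n b) = 1 for all n, concentrating [N] where d attains its norm keeps the value at [x0],
    so minimality gives N x <= N (d x). This is used for d = b, and then for d = c^* c with an
    arbitrary c of norm 1, which yields N (c x) = N x. *)
Lemma minimal_csn_mul x0 : rnorm x0 = 1 -> exists N b,
  [/\ cstar_seminorm N, N x0 = 1, cstar b = b, N b = 1 & forall x y, N (cmul x y) = N x * N y].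
Proof.
move=> n1; have [N [cN]] := minimal_csn x0; rewrite n1 => Nx Nmin.
pose b := cmul (cstar x0) x0.
have sb c : cstar (cmul (cstar c) c) = cmul (cstar c) c by rewrite cstarMC cstarK cmulC.
have b1 : N b = 1 by rewrite (csn_sqr cN) Nx expr1n.
have conc d : cstar d = d -> N d = 1 -> (forall n, N (powm d n b) = 1) ->
    forall x, N x <= N (cmul d x).
  move=> sd d1 db x; have cI := csn_concentrate cN sd d1.
  set I := fun x => _ in cI.
  have Ile n y : I y <= N (powm d n y).
    apply: ge_inf; last by exists (fun x => N (powm d n x)) => //; exists n.
    by exists 0 => _ [_ [k _ <-] <-]; exact: csn_ge0 cN _.
  have Ib : I b = 1.
    rewrite /I (_ : [set M b | M in _] = [set 1]) ?inf1//.
    apply/seteqP; split=> [_ [_ [k _ <-] <-]|_ ->]; first by rewrite /= db.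
    by exists (fun x => N (powm d 0 x)) => //; exists 0%N.
  have Ix : I x0 = 1.
    apply/eqP; rewrite -(eqrXn2 (n := 2)) ?(csn_ge0 cI)//.
    by rewrite -(csn_sqr cI) Ib expr1n.
  apply: le_trans (Ile 1%N x).
  by apply: Nmin => // y; exact: (Ile 0%N).
have Nb x : N (cmul b x) = N x.
  apply/eqP; rewrite eq_le (le_trans (csnM cN _ _)) ?b1 ?mul1r//=.
  by apply: conc => [|//|n]; [exact: sb|exact: powm_norm cN (sb _) b1].
have Npb n x : N (cmul (powm b n x) b) = N (powm b n x) by rewrite cmulC Nb.
exists N, b; split=> //; first exact: sb.
have mul1 c x : N c = 1 -> N (cmul c x) = N x.
  move=> c1; pose d := cmul (cstar c) c.
  have d1 : N d = 1 by rewrite (csn_sqr cN) c1 expr1n.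
  have db n : N (powm d n b) = 1.
    case: n => [//|n]; rewrite /powm iterSr -/(powm d n _) powmMl cmulC Nb.
    exact: powm_norm cN (sb c) d1.
  apply/eqP; rewrite eq_le (le_trans (csnM cN _ _)) ?c1 ?mul1r//=.
  apply: (le_trans (conc d (sb c) d1 db x)).
  by rewrite /d -cmulA (le_trans (csnM cN _ _))// csn_star// c1 mul1r.
move=> x y; have [x0'|xn0] := eqVneq (N x) 0.
  apply/eqP; rewrite x0' mul0r eq_le (csn_ge0 cN) andbT.
  by rewrite (le_trans (csnM cN _ _))// x0' mul0r.
have xp : 0 < N x by rewrite lt_def xn0 (csn_ge0 cN).
have cx : cabs ((N x)^-1)%:C%C = (N x)^-1 by rewrite cabsR ger0_norm// invr_ge0 ltW.
have := mul1 (((N x)^-1)%:C%C *: x) y; rewrite cmulZl !(csnZ cN) cx mulVf// => /(_ erefl) <-.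
by rewrite mulrA divff// mul1r.
Qed.

End CStarAlgebra.

Lemma conj_i (R : realType) : ('i%C : R[i])^* = - 'i%C.
Proof. by apply/eqP; rewrite eq_complex /= oppr0 !eqxx. Qed.

(** * Characters from multiplicative seminorms, the Gelfand transform, limits of characters *)

Section Characters.
Variables (R : realType) (A : commCStarType R).
Implicit Types (x y z a b c h k : A) (N : A -> R).

Section Ostrowski.
Variables (N : A -> R) (b : A).
Hypotheses (cN : cstar_seminorm N) (sb : cstar b = b) (b1 : N b = 1).
Hypothesis NM : forall x y, N (cmul x y) = N x * N y.

Definition sqpow n k := iter n (fun x => cmul x x) k.

Lemma sqpow_norm n k : N (sqpow n k) = N k ^+ (2 ^ n).
Proof. by elim: n => [|n IH]; rewrite ?expr1//= NM IH -exprD expnS mul2n addnn. Qed.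

Lemma sqpow_factor n k (w : R[i]) :
  sqpow n.+1 k - w ^+ 2 *: sqpow n.+1 b =
  cmul (sqpow n k - w *: sqpow n b) (sqpow n k - (- w) *: sqpow n b).
Proof.
rewrite /= -/(sqpow n k) -/(sqpow n b); set u := sqpow n k; set v := sqpow n b.
rewrite scaleNr opprK cmulDr !cmulBl !(cmulZl, cmulZr) (cmulC v u) scalerA -expr2.
by rewrite subrKA.
Qed.

Lemma csn_re h k : cstar h = h -> cstar k = k -> N h <= N (h + 'i%C *: k).
Proof.
move=> sh sk; have e : h = (2^-1 : R[i]) *: ((h + 'i%C *: k) + cstar (h + 'i%C *: k)).
  rewrite cstarD cstarZ sh sk.
  have -> : ('i%C : R[i])^* = - 'i%C by exact: conj_i.
  rewrite scaleNr addrACA subrr addr0 -mulr2n -[h *+ 2]scaler_nat scalerA mulVf ?scale1r//.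
rewrite {1}e (csnZ cN).
have -> : cabs (2^-1 : R[i]) = 2^-1.
  by rewrite /cabs normfV normr_nat -(rmorph_nat (real_complex R)) -fmorphV.
rewrite ler_pdivrMl// (le_trans (csnD cN _ _))// (csn_star _ cN).
by rewrite mulr_natl mulr2n.
Qed.

(* If [0] is a minimum of [t |-> N (k - t b)] then so is every [t] with [|t| < 1]:
   this is the key step of the Gelfand-Mazur-Ostrowski theorem. *)
Lemma ostrowski_half k : (forall w : R[i], 1 <= N (k - w *: b)) -> N k = 1 ->
  N (k - (2^-1)%:C%C *: b) = 1.
Proof.
move=> hk k1; apply/eqP; rewrite eq_le hk andbT.
(* A complex square root of w factors the expression, so k^(2^n) and b^(2^n) inherit the lower
   bound. *)
have lo n (w : R[i]) : 1 <= N (sqpow n k - w *: sqpow n b).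
  elim: n w => [|n IH] w; first exact: hk.
  rewrite -(sqrtCK w) sqpow_factor NM -[leLHS]mulr1.
  by apply: ler_pM.
pose t : R[i] := (2^-1)%:C%C.
(* In the factorization of the difference of squares the second factor is at least 1 by [lo]. The
   right-hand side is at most 1 + |t|^(2^n), which tends to 1. *)
have up n : N (k - t *: b) <= N (sqpow n k - t ^+ (2 ^ n) *: sqpow n b).
  elim: n => [|n IH]; first by rewrite expr1.
  rewrite expnSr exprM sqpow_factor NM (le_trans IH)// ler_peMr ?(csn_ge0 cN)//.
apply: le_of_eps => e e0.
have [n hn] : exists n, (2^-1 : R) ^+ (2 ^ n) <= e.
  have [n Hn] := natSinv_lt e0; exists n.+1; apply: le_trans (ltW (Hn n (leqnn n))).
  rewrite exprVn lef_pV2 ?posrE ?exprn_gt0 ?ltr0n// -natrX ler_nat.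
  by apply: (leq_trans (ltnW (ltn_expl n.+1 (ltnSn 1)))); exact: ltnW (ltn_expl _ (ltnSn 1)).
apply: (le_trans (up n)); apply: (le_trans (csnB _ _ cN)).
rewrite (csnZ cN) !sqpow_norm k1 b1 !expr1n mulr1 lerD2l cabsX cabsR ger0_norm//.
Qed.

(** Six steps of length 1/2 lead to N (k - 3 b) = 1, whereas N (3 b) = 3 exceeds N k + N (k - 3 b) =
    2. *)
Lemma ostrowski_absurd k : (forall w : R[i], 1 <= N (k - w *: b)) -> N k = 1 -> False.
Proof.
move=> hk k1.
have step n : N (k - (n%:R / 2)%:C%C *: b) = 1.
  elim: n => [|n IH]; first by rewrite mul0r scale0r subr0.
  have -> : k - (n.+1%:R / 2)%:C%C *: b = (k - (n%:R / 2)%:C%C *: b) - (2^-1)%:C%C *: b.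
    by rewrite -addrA -opprD -scalerDl -rmorphD -natr1 mulrDl mul1r.
  apply: ostrowski_half => // w.
  by rewrite -addrA -opprD -scalerDl.
have := csnB k (k - (6%:R / 2)%:C%C *: b) cN.
rewrite subKr (csnZ cN) cabsR b1 mulr1 (step 6%N) k1 ger0_norm ?divr_ge0//.
lra.
Qed.

Lemma csn_lipschitz h (s t : R) : N (h - s%:C%C *: b) - N (h - t%:C%C *: b) <= `|s - t|.
Proof.
rewrite lerBlDl.
have -> : h - s%:C%C *: b = (h - t%:C%C *: b) - (s - t)%:C%C *: b.
  by rewrite -addrA -opprD -scalerDl -rmorphD subrKC.
by rewrite (le_trans (csnB _ _ cN))// (csnZ cN) cabsR b1 mulr1.
Qed.

Lemma ostrowski_min h : exists t : R, forall s : R, N (h - t%:C%C *: b) <= N (h - s%:C%C *: b).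
Proof.
pose f (t : R) := N (h - t%:C%C *: b).
have cf : continuous f.
  move=> t; apply/cvgrPdist_le => e e0; near=> s.
  have st : `|t - s| <= e by near: s; exact: cvgr_dist_le.
  rewrite ler_norml; apply/andP; split.
    rewrite lerNl opprB (le_trans (csn_lipschitz h s t))// distrC//.
  by rewrite (le_trans (csn_lipschitz h t s)).
(* If |s| > L then N (h - s b) >= |s| - N h > N h, so the minimum on [-L, L], being at most the
   value N h at 0, is global. *)
pose L := 2 * N h + 1; have h0 := csn_ge0 cN h.
have L0 : - L <= L by rewrite /L; lra.
have [c cL cmin] := @EVT_min R f (- L) L L0 (continuous_subspaceT cf).
exists c => s; have [sL|sL] := leP `|s| L.
  by apply: cmin; rewrite in_itv /= -ler_norml.
have : f c <= f 0 by apply: cmin; rewrite in_itv /= oppr_le0 /L; apply/andP; split; lra.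
rewrite {2}/f scale0r subr0 => fc; apply: (le_trans fc).
have := csnB h (h - s%:C%C *: b) cN.
rewrite subKr (csnZ cN) cabsR b1 mulr1.
by move: sL; rewrite /L; lra.
Unshelve. all: by end_near. Qed.

(** At a minimum m > 0, the quotient of h - t b by m satisfies the hypotheses of [ostrowski_absurd]:
    real translates are covered by minimality, and complex ones reduce to them by [csn_re]. *)
Lemma ostrowski_real h : cstar h = h -> exists t : R, N (h - t%:C%C *: b) = 0.
Proof.
move=> sh; have [t ht] := ostrowski_min h; exists t.
apply/eqP; apply: contraT => mn0; exfalso.
set k := h - t%:C%C *: b in ht mn0; set m := N k in ht mn0.
have m0 : 0 < m by rewrite lt_def mn0 (csn_ge0 cN).
have sk : cstar k = k by rewrite cstarB sh cstarZ sb conjR.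
have kmin (w : R[i]) : m <= N (k - w *: b).
  have -> : k - w *: b = (h - (t + complex.Re w)%:C%C *: b) + 'i%C *: (- (complex.Im w)%:C%C *: b).
    rewrite {1}(complexE w) scalerDl opprD addrA /k scalerA mulrN scaleNr.
    by congr (_ - _); rewrite -addrA -opprD -scalerDl -rmorphD.
  apply: le_trans (csn_re _ _); first exact: ht.
    by rewrite cstarB sh cstarZ sb conjR.
  by rewrite cstarZ rmorphN /= conjR sb.
have cm : cabs (m^-1)%:C%C = m^-1 by rewrite cabsR ger0_norm// invr_ge0 ltW.
apply: (@ostrowski_absurd ((m^-1)%:C%C *: k)); last by rewrite (csnZ cN) cm mulVf.
move=> w; have -> : (m^-1)%:C%C *: k - w *: b = (m^-1)%:C%C *: (k - (m%:C%C * w) *: b).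
  by rewrite [RHS]scalerBr [in RHS]scalerA mulrA -rmorphM mulVf// mul1r.
by rewrite (csnZ cN) cm mulrC ler_pdivlMr// mul1r.
Qed.

Lemma ostrowski_complex x : exists w : R[i], N (x - w *: b) = 0.
Proof.
have n2 : (2%:R : R[i]) != 0 by rewrite pnatr_eq0.
have ii : ('i%C : R[i])^* = - 'i%C by exact: conj_i.
have i2 : 'i%C * 'i%C = -1 :> R[i] by rewrite -expr2 sqr_i.
have h2 : ((2^-1 : R[i]))^* = 2^-1 by rewrite fmorphV rmorph_nat.
pose u := (2^-1 : R[i]) *: (x + cstar x).
pose v := (- 'i%C * 2^-1 : R[i]) *: (x - cstar x).
have su : cstar u = u by rewrite /u cstarZ h2 cstarD cstarK addrC.
have sv : cstar v = v.
  rewrite /v cstarZ rmorphM rmorphN /= ii h2 cstarB cstarK opprK [in RHS]mulNr scaleNr.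
  by rewrite -scalerN opprB.
have xE : x = u + 'i%C *: v.
  rewrite /u /v scalerA mulrA mulrN i2 opprK mul1r -scalerDr addrACA subrr addr0.
  by rewrite -mulr2n -[x *+ 2]scaler_nat scalerA mulVf ?scale1r.
clearbody u v.
have [s hs] := ostrowski_real su; have [t ht] := ostrowski_real sv.
exists (s%:C%C + 'i%C * t%:C%C); apply/eqP; rewrite eq_le (csn_ge0 cN) andbT.
have -> : x - (s%:C%C + 'i%C * t%:C%C) *: b = (u - s%:C%C *: b) + 'i%C *: (v - t%:C%C *: b).
  by rewrite {1}xE scalerDl scalerBr scalerA opprD addrACA.
by rewrite (le_trans (csnD cN _ _))// (csnZ cN) hs ht mulr0 addr0.
Qed.

(** Modulo the null space of [N] every x is a multiple f x of b. As b^2 is nu b there, with nu real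
    of modulus 1, f is multiplicative only up to nu, and nu f is the character. *)
Lemma csn_character x0 : N x0 = 1 -> exists chi : character A, forall x, cabs (chi x) = N x.
Proof.
move=> Nx0; have [f hf] := choice ostrowski_complex.
have uniq x w : N (x - w *: b) = 0 -> f x = w.
  move=> hw; apply/eqP; rewrite -subr_eq0; apply/eqP/cabs_eq0.
  apply/eqP; rewrite eq_le cabs_ge0 andbT -[leLHS]mulr1 -b1 -(csnZ cN).
  have -> : (f x - w) *: b = (x - w *: b) - (x - f x *: b).
    by rewrite opprB [RHS]addrC subrKA scalerBl.
  by rewrite (le_trans (csnB _ _ cN))// hw hf addr0.
have zD x y : N x = 0 -> N y = 0 -> N (x + y) = 0.
  move=> hx hy; apply/eqP; rewrite eq_le (csn_ge0 cN) andbT.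
  by rewrite (le_trans (csnD cN _ _))// hx hy addr0.
have zM x y : N x = 0 -> N (cmul x y) = 0 by move=> hx; rewrite NM hx mul0r.
have Nf x : cabs (f x) = N x.
  have e1 : N (f x *: b) = cabs (f x) by rewrite (csnZ cN) b1 mulr1.
  apply/eqP; rewrite eq_le -e1; apply/andP; split.
    have -> : f x *: b = x - (x - f x *: b) by rewrite subKr.
    by rewrite (le_trans (csnB _ _ cN))// hf addr0.
  rewrite -{1}(subrK (f x *: b) x) (le_trans (csnD cN _ _))// hf add0r//.
have fD x y : f (x + y) = f x + f y.
  apply: uniq; rewrite scalerDl opprD addrACA; exact: zD.
have fZ (k : R[i]) x : f (k *: x) = k * f x.
  by apply: uniq; rewrite -scalerA -scalerBr (csnZ cN) hf mulr0.
have fS x : f (cstar x) = (f x)^*.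
  apply: uniq; have -> : cstar x - (f x)^* *: b = cstar (x - f x *: b).
    by rewrite cstarB cstarZ sb.
  by rewrite csn_star// hf.
pose nu := f (cmul b b).
have nu1 : cabs nu = 1 by rewrite Nf NM b1 mulr1.
have nuR : nu^* = nu by rewrite /nu -fS cstarMC sb.
have fM x y : f (cmul x y) = nu * (f x * f y).
  apply: uniq.
  have -> : cmul x y - (nu * (f x * f y)) *: b =
      (cmul (x - f x *: b) y + cmul (y - f y *: b) (f x *: b)) +
      (f x * f y) *: (cmul b b - nu *: b).
    rewrite !cmulBl !(cmulZl, cmulZr) scalerBr !scalerA (cmulC y b).
    by rewrite subrKA (mulrC nu) ?(mulrC (f y)) subrKA.
  apply: (zD); last by rewrite (csnZ cN) hf mulr0.
  by apply: (zD); apply: (zM); exact: hf.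
have gD x y : nu * f (x + y) = nu * f x + nu * f y by rewrite fD mulrDr.
have gZ (k : R[i]) x : nu * f (k *: x) = k * (nu * f x) by rewrite fZ mulrCA.
have gM x y : nu * f (cmul x y) = (nu * f x) * (nu * f y) by rewrite fM; ring.
have gS x : nu * f (cstar x) = (nu * f x)^* by rewrite rmorphM /= nuR fS.
have gN x : cabs (nu * f x) = N x by rewrite cabsM nu1 mul1r Nf.
have g0 : exists a, nu * f a != 0.
  exists x0; apply/eqP => h; have := gN x0; rewrite h cabs0 Nx0 => /eqP.
  by rewrite eq_sym oner_eq0.
by exists (Character gD gZ gM gS g0).
Qed.

End Ostrowski.

Lemma gelfand_exists a : a != 0 -> exists chi : character A, cabs (chi a) = rnorm a.
Proof.
move=> a0; have n0 : rnorm a != 0 by apply: contra_neq a0 => /rnorm_eq0.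
have np : 0 < rnorm a by rewrite lt_def n0 rnorm_ge0.
have cn : cabs ((rnorm a)^-1)%:C%C = (rnorm a)^-1 by rewrite cabsR ger0_norm// invr_ge0 ltW.
pose x0 := ((rnorm a)^-1)%:C%C *: a.
have n1 : rnorm x0 = 1 by rewrite rnormZ cn mulVf.
have [N [b [cN Nx sb b1 NM]]] := minimal_csn_mul n1.
have [chi hchi] := csn_character cN sb b1 NM Nx.
exists chi; have := hchi x0; rewrite Nx chiZ cabsM cn => h.
by rewrite -[LHS]mul1r -(mulfV n0) -mulrA h mulr1.
Qed.

Lemma contraction_fixpoint (f : A -> A) (r : R) : 0 <= r -> r < 1 ->
  (forall x y, rnorm (f x - f y) <= r * rnorm (x - y)) -> exists x, f x = x.
Proof.
move=> r0 r1 hf; pose y n := iter n f 0; pose C := rnorm (f 0 - 0).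
have C0 : 0 <= C by exact: rnorm_ge0.
have r1' : 0 < 1 - r by rewrite subr_gt0.
have st n : rnorm (y n.+1 - y n) <= r ^+ n * C.
  elim: n => [|n IH]; first by rewrite expr0 mul1r.
  have -> : y n.+2 - y n.+1 = f (y n.+1) - f (y n) by [].
  by rewrite (le_trans (hf _ _))// exprS -mulrA ler_wpM2l.
have far n (k : nat) : rnorm (y (n + k)%N - y n) <= r ^+ n * C / (1 - r).
  elim: k n => [|k IH] n.
    by rewrite addn0 subrr rnorm0 divr_ge0 ?mulr_ge0 ?exprn_ge0// ltW.
  rewrite addnS -addSn (le_trans (rnorm_triB _ (y n.+1) _))//.
  apply: (le_trans (lerD (IH n.+1) (st n))).
  rewrite exprS; set u := r ^+ n * C.
  have -> : r * r ^+ n * C / (1 - r) + u = u / (1 - r).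
    by rewrite /u; field; rewrite gt_eqF.
  by [].
have rn : forall e : R, 0 < e -> exists n, r ^+ n * C / (1 - r) <= e.
  move=> e e0; have h0 : (fun n : nat => r ^+ n) @ \oo --> (0 : R).
    by apply: cvg_expr; rewrite ger0_norm.
  move/cvgrPdist_le : h0 => /(_ (e * (1 - r) / (C + 1))).
  have d0 : 0 < e * (1 - r) / (C + 1) by rewrite divr_gt0 ?mulr_gt0// ltr_wpDl.
  move=> /(_ d0)[n _ /(_ n (leqnn n))]; rewrite sub0r normrN ger0_norm ?exprn_ge0// => h.
  exists n; rewrite ler_pdivrMr//.
  apply: (@le_trans _ _ (e * (1 - r) / (C + 1) * (C + 1))).
    by apply: ler_pM; rewrite ?exprn_ge0// lerDl.
  by rewrite divfK// gt_eqF// ltr_wpDl.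
have [l hl] : exists l, scvg y l.
  apply: scvg_complete => e e0; have [N hN] := rn (e / 2) ltac:(by rewrite divr_gt0).
  exists N => m n Nm Nn; rewrite (le_trans (rnorm_triB _ (y N) _))// (splitr e) lerD//.
    by rewrite -(subnKC Nm) (le_trans (far _ _)).
  by rewrite rnorm_distC -(subnKC Nn) (le_trans (far _ _)).
exists l; apply/eqP; rewrite -subr_eq0; apply/eqP/rnorm_eq0/eqP.
rewrite eq_le rnorm_ge0 andbT; apply: (@le_of_epsM _ _ _ 2) => // e e0.
have [N hN] := hl e e0.
rewrite add0r mulrC mulrDl !mul1r (le_trans (rnorm_triB _ (y N.+1) _))// lerD//.
  rewrite (le_trans (hf _ _))// rnorm_distC -[leRHS]mul1r.
  by apply: ler_pM; rewrite ?rnorm_ge0 ?(ltW r1)// hN.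
exact: hN.
Qed.

Lemma chi0 (chi : character A) : chi 0 = 0.
Proof. by rewrite -(scale0r 0) chiZ mul0r. Qed.
Lemma chiN (chi : character A) a : chi (- a) = - chi a.
Proof. by rewrite -scaleN1r chiZ mulN1r. Qed.
Lemma chiB (chi : character A) a b : chi (a - b) = chi a - chi b.
Proof. by rewrite chiD chiN. Qed.
Lemma chi_sum (chi : character A) (I : Type) (r : seq I) (P : pred I) (F : I -> A) :
  chi (\sum_(i <- r | P i) F i) = \sum_(i <- r | P i) chi (F i).
Proof. by apply: (big_morph chi); [exact: chiD|exact: chi0]. Qed.

(** If |chi a| > |a|, then a' = a / chi a has norm below 1, and y = a' + a' y has a solution, the
    geometric series of a'. Applying chi gives chi y = 1 + chi y. *)
Lemma char_le (chi : character A) a : cabs (chi a) <= rnorm a.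
Proof.
rewrite leNgt; apply/negP => lt; set w := chi a in lt *.
have w0 : 0 < cabs w by exact: le_lt_trans (rnorm_ge0 _) lt.
have wn0 : w != 0 by apply: contraTneq w0 => ->; rewrite cabs0 ltxx.
pose a' := w^-1 *: a.
have cw : cabs w^-1 = (cabs w)^-1.
  apply: (mulIf (x := cabs w)); first by rewrite gt_eqF.
  by rewrite -cabsM !mulVf ?cabs1// gt_eqF.
have a1 : rnorm a' < 1 by rewrite rnormZ cw mulrC ltr_pdivrMr// mul1r.
have [|y hy] := @contraction_fixpoint (fun y => a' + cmul a' y) (rnorm a') (rnorm_ge0 _) a1.
  by move=> x y; rewrite opprD addrACA subrr add0r -cmulBr rnorm_cmul.
have := congr1 chi hy; rewrite chiD chiM /a' chiZ mulVf// mul1r => /eqP.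
by rewrite -subr_eq0 addrK oner_eq0.
Qed.

Lemma gelfand_norm_le a (c : R) : 0 <= c -> (forall chi : character A, cabs (chi a) <= c) -> rnorm a <= c.
Proof.
move=> c0 h; have [->|a0] := eqVneq a 0; first by rewrite rnorm0.
by have [chi <-] := gelfand_exists a0; exact: h.
Qed.

(** The Gelfand transform is isometric, so elements of [A] whose transforms converge uniformly form
    a Cauchy sequence. *)
Lemma gelfand_closure (f : character A -> R[i]) :
  (forall e : R, 0 < e -> exists a, forall chi : character A, cabs (f chi - chi a) <= e) ->
  exists a, forall chi : character A, chi a = f chi.
Proof.
move=> hf; have i0 (n : nat) : 0 < n.+1%:R^-1 :> R by rewrite invr_gt0.
have /choice[u hu] (n : nat) := hf _ (i0 n).
have near n (chi : character A) : cabs (chi (u n) - f chi) <= n.+1%:R^-1 by rewrite cabs_distC.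
have [l hl] : exists l, scvg u l.
  apply: scvg_complete => e e0; have [N HN] := natSinv_lt (divr_gt0 e0 (ltr0Sn R 1)).
  exists N => m n Nm Nn; apply: gelfand_norm_le => [|chi]; first exact: ltW.
  have -> : chi (u m - u n) = (chi (u m) - f chi) - (chi (u n) - f chi).
    by rewrite chiB opprB addrA subrK.
  rewrite (le_trans (cabsB _ _))// (splitr e) lerD// (le_trans (near _ _))//.
    exact/ltW/HN.
  exact/ltW/HN.
exists l => chi; apply/eqP; rewrite -subr_eq0; apply/eqP/cabs_eq0/eqP.
rewrite eq_le cabs_ge0 andbT; apply: (@le_of_epsM _ _ _ 2) => // e e0.
have [N1 h1] := hl e e0; have [N2 h2] := natSinv_lt e0; pose n := maxn N1 N2.
have -> : chi l - f chi = (chi (u n) - f chi) - chi (u n - l).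
  by rewrite chiB; ring.
rewrite add0r mulrC mulrDl !mul1r (le_trans (cabsB _ _))// lerD//.
  by rewrite (le_trans (near _ _))// ltW// h2// leq_maxr.
by rewrite (le_trans (char_le _ _))// h1// leq_maxl.
Qed.

Lemma ultra_bounded_cvg (U : set_system nat) (u : nat -> R) (M : R) : UltraFilter U ->
  (forall n, `|u n| <= M) -> exists l : R, forall e : R, 0 < e -> U [set n | `|u n - l| <= e].
Proof.
move=> UU uM; have cM := @segment_compact R (- M) M.
have FP : ProperFilter (fmap u U) by exact: fmap_proper_filter.
have FM : fmap u U [set` `[- M, M]].
  rewrite /fmap /=; apply: filterS filterT => n _ /=.
  by rewrite in_itv /= -ler_norml.
have [l [_ hl]] := cM _ FP FM; exists l => e e0.
have [//|nU] := in_ultra_setVsetC [set n | `|u n - l| <= e] UU.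
exfalso; have hA : (fmap u U) (~` [set x | `|x - l| <= e]) by [].
have hB : nbhs l [set x | `|l - x| < e] by apply/nbhs_normP; exists e.
have [x [/= h1 h2]] := hl _ _ hA hB; apply: h1.
by rewrite distrC ltW.
Qed.

(** Pointwise limits along an ultrafilter exist because |chi x| <= |x|; the lower bound at [a0]
    keeps the limit from being 0. *)
Lemma char_ultralimit (X : nat -> character A) a0 (e0 : R) : 0 < e0 ->
  (forall n, e0 <= cabs (X n a0)) ->
  exists (U : set_system nat) (chi : character A),
  [/\ ProperFilter U, (forall N : nat, U [set n | (N <= n)%N]) &
    forall x (e : R), 0 < e -> U [set n | cabs (X n x - chi x) <= e]].
Proof.
move=> e0p hX; have [U [UU Usub]] := @ultraFilterLemma nat \oo _.
have UN (N : nat) : U [set n | (N <= n)%N] by apply: Usub; exists N.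
have UP : ProperFilter U by exact: ultra_proper.
have /choice[f hf] x : exists l : R[i], forall e : R, 0 < e -> U [set n | cabs (X n x - l) <= e].
  have bR n : `|complex.Re (X n x)| <= rnorm x by rewrite (le_trans (Re_le_cabs _))// char_le.
  have bI n : `|complex.Im (X n x)| <= rnorm x.
    rewrite (le_trans _ (char_le (X n) x))// -lecR -cabsE normc_def lecR -sqrtr_sqr ler_wsqrtr//.
    by rewrite lerDr sqr_ge0.
  have [a ha] := ultra_bounded_cvg UU bR; have [b hb] := ultra_bounded_cvg UU bI.
  exists (Complex a b) => e ep; have e2 : 0 < e / 2 by rewrite divr_gt0.
  apply: filterS (filterI (ha _ e2) (hb _ e2)) => n /= [].
  case: (X n x) => c d /= h1 h2.
  have -> : Complex c d - Complex a b = (c - a)%:C%C + 'i%C * (d - b)%:C%C :> R[i].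
    by rewrite [LHS]complexE.
  rewrite (le_trans (cabsD _ _))// (splitr e) cabsR lerD//.
  rewrite cabsM cabsR (_ : cabs 'i%C = 1) ?mul1r//.
  by rewrite /cabs normc_def /= expr0n expr1n add0r sqrtr1.
have uniq x w : (forall e : R, 0 < e -> U [set n | cabs (X n x - w) <= e]) -> f x = w.
  move=> hw; apply/eqP; rewrite -subr_eq0; apply/eqP/cabs_eq0/eqP.
  rewrite eq_le cabs_ge0 andbT; apply: (@le_of_epsM _ _ _ 2) => // e ep.
  have [n [/= h1 h2]] := filter_ex (filterI (hf x e ep) (hw e ep)).
  have -> : f x - w = (X n x - w) - (X n x - f x) by ring.
  by rewrite add0r mulrC mulrDl !mul1r (le_trans (cabsB _ _))// lerD.
have fD x y : f (x + y) = f x + f y.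
  apply: uniq => e ep; have e2 : 0 < e / 2 by rewrite divr_gt0.
  apply: filterS (filterI (hf x _ e2) (hf y _ e2)) => n /= [h1 h2].
  by rewrite chiD opprD addrACA (splitr e) (le_trans (cabsD _ _))// lerD.
have fZ (k : R[i]) x : f (k *: x) = k * f x.
  apply: uniq => e ep; have k0 : 0 < cabs k + 1 by rewrite ltr_wpDl ?cabs_ge0.
  apply: filterS (hf x _ (divr_gt0 ep k0)) => n /= h.
  rewrite chiZ -mulrBr cabsM; apply: (@le_trans _ _ ((cabs k + 1) * (e / (cabs k + 1)))).
    by apply: ler_pM; rewrite ?cabs_ge0// lerDl.
  by rewrite mulrC divfK// gt_eqF.
have fS x : f (cstar x) = (f x)^*.
  apply: uniq => e ep; apply: filterS (hf x _ ep) => n /= h.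
  by rewrite chi_star -rmorphB cabsJ.
have fM x y : f (cmul x y) = f x * f y.
  apply: uniq => e ep.
  have k0 : 0 < rnorm y + cabs (f x) + 1 by rewrite ltr_wpDl ?addr_ge0 ?rnorm_ge0 ?cabs_ge0.
  have d0 := divr_gt0 ep k0.
  apply: filterS (filterI (hf x _ d0) (hf y _ d0)) => n /= [h1 h2].
  have -> : X n (cmul x y) - f x * f y = (X n x - f x) * X n y + f x * (X n y - f y).
    by rewrite chiM; ring.
  rewrite (le_trans (cabsD _ _))// !cabsM.
  apply: (@le_trans _ _ (e / (rnorm y + cabs (f x) + 1) * rnorm y +
     cabs (f x) * (e / (rnorm y + cabs (f x) + 1)))).
    rewrite lerD// ?ler_wpM2l ?cabs_ge0//.
    by apply: ler_pM; rewrite ?cabs_ge0// char_le.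
  rewrite [X in _ + X]mulrC -mulrDr mulrAC ler_pdivrMr// ler_wpM2l ?(ltW ep)// lerDl//.
have f0 : exists a, f a != 0.
  exists a0; apply/eqP => fa; have e2 : 0 < e0 / 2 by rewrite divr_gt0.
  have [n /= h] := filter_ex (hf a0 _ e2).
  by have := hX n; move: h; rewrite fa subr0; lra.
by exists U, (Character fD fZ fM fS f0); split.
Qed.

End Characters.

(** * Hilbert modules and their localizations *)

Section HilbertModuleBasics.
Variables (R : realType) (A : commCStarType R) (E : hilbertModType A).
Implicit Types (x y z w : E) (a b : A) (T S : E -> E) (chi : character A).

Lemma innerDl x y z : inner (x + y) z = inner x z + inner y z.
Proof. by rewrite innerC innerDr cstarD -!innerC. Qed.
Lemma innerZl (k : R[i]) x y : inner (k *: x) y = k^* *: inner x y.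
Proof. by rewrite innerC innerZr cstarZ -innerC. Qed.
Lemma innerNr x y : inner x (- y) = - inner x y.
Proof. by rewrite -scaleN1r innerZr scaleN1r. Qed.
Lemma innerBr x y z : inner x (y - z) = inner x y - inner x z.
Proof. by rewrite innerDr innerNr. Qed.
Lemma innerBl x y z : inner (x - y) z = inner x z - inner y z.
Proof. by rewrite innerC innerBr cstarB -!innerC. Qed.
Lemma inner0r x : inner x 0 = 0.
Proof. by rewrite -(scale0r 0) innerZr scale0r. Qed.
Lemma inner_actl x y a : inner (act x a) y = cmul (cstar a) (inner x y).
Proof. by rewrite innerC inner_act cstarM -innerC. Qed.

Lemma rnorm_inner x : rnorm (inner x x) = rnorm x ^+ 2.
Proof. by apply: complexI; rewrite rmorphXn /= -!rnormE inner_norm. Qed.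

Lemma inner_nondeg x y : (forall z, inner z x = inner z y) -> x = y.
Proof.
move=> h; apply/eqP; rewrite -subr_eq0; apply/eqP/rnorm_eq0/eqP.
by rewrite -sqrf_eq0 -rnorm_inner innerBr h subrr rnorm0.
Qed.

Lemma inner_sumr (I : Type) (r : seq I) (P : pred I) (F : I -> E) x :
  inner x (\sum_(i <- r | P i) F i) = \sum_(i <- r | P i) inner x (F i).
Proof. by apply: (big_morph (inner x)); [exact: innerDr|exact: inner0r]. Qed.

Lemma chi_ge0 chi x : 0 <= chi (inner x x).
Proof. exact: sip_ge0 (localized_sip E chi) x. Qed.

Section Localize.
Variable chi : character A.
Local Notation loc := (localize chi : E -> localization E chi).

Lemma dot_loc x y : dot (loc x) (loc y) = chi (inner x y).
Proof. exact: (completion_dot_in x (completion_in (localized_sip E chi) y)). Qed.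

Lemma locE x (f : localization E chi) : dot (loc x) f = f x.
Proof. exact: (completion_dot_in x f). Qed.

Lemma loc_ext (f g : localization E chi) : (forall x, dot (loc x) f = dot (loc x) g) -> f = g.
Proof.
by move=> h; apply/val_inj/funext => x; have := h x; rewrite !locE.
Qed.

Lemma loc_dense (f : localization E chi) (e : R) : 0 < e -> exists x, rnorm (f - loc x) <= e.
Proof.
move=> e0; have e0' : 0 < e%:C%C :> R[i] by rewrite ltcR.
have [N hN] := seq_repr_approx (cauchy_repP f) e0'.
exists (cauchy_rep f N); have := hN N (leqnn N).
by rewrite -lecR -rnormE => /ltW.
Qed.

Lemma locD x y : loc (x + y) = loc x + loc y.
Proof. by apply: loc_ext => z; rewrite dotDr !dot_loc innerDr chiD. Qed.
Lemma locZ (k : R[i]) x : loc (k *: x) = k *: loc x.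
Proof. by apply: loc_ext => z; rewrite dotZr !dot_loc innerZr chiZ. Qed.
Lemma loc_act x a : loc (act x a) = chi a *: loc x.
Proof. by apply: loc_ext => z; rewrite dotZr !dot_loc inner_act chiM mulrC. Qed.
Lemma loc_sum (I : Type) (r : seq I) (P : pred I) (F : I -> E) :
  loc (\sum_(i <- r | P i) F i) = \sum_(i <- r | P i) loc (F i).
Proof.
apply: (big_morph loc); first exact: locD.
by rewrite -(scale0r 0) locZ scale0r.
Qed.

Lemma rnorm_loc_sqr x : rnorm (loc x) ^+ 2 = complex.Re (chi (inner x x)).
Proof. by rewrite rnorm_sqr dot_loc. Qed.

Lemma rnorm_loc_le x : rnorm (loc x) <= rnorm x.
Proof.
rewrite -(@ler_pXn2r _ 2) ?nnegrE ?rnorm_ge0// rnorm_loc_sqr -rnorm_inner.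
by rewrite -cabs_ge0E ?chi_ge0// char_le.
Qed.

Lemma bop_loc_ext (P P' Q Q' : localization E chi -> localization E chi) :
  bop P P' -> bop Q Q' -> (forall x, P (loc x) = Q (loc x)) -> P = Q.
Proof.
move=> bP bQ h; apply/funext => f; apply: dot_nondeg => z.
rewrite (adj_dotr _ _ bP.1) (adj_dotr _ _ bQ.1).
suff -> : P' z = Q' z by [].
by apply: loc_ext => x; rewrite -bP.1 -bQ.1 h.
Qed.

End Localize.

(* Otherwise unification unfolds the completion. *)
Local Opaque rnorm localize.

Lemma inner_cs x y : rnorm (inner x y) <= rnorm x * rnorm y.
Proof.
apply: gelfand_norm_le => [|chi]; first by rewrite mulr_ge0 ?rnorm_ge0.
rewrite -dot_loc (le_trans (dot_cs _ _))//.
by apply: ler_pM; rewrite ?rnorm_ge0 ?rnorm_loc_le.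
Qed.

Lemma rnorm_loc_exists x : x != 0 -> exists chi, rnorm (localize chi x) = rnorm x.
Proof.
move=> x0; have ix : inner x x != 0.
  apply: contra_neq x0 => h; apply: rnorm_eq0; apply/eqP.
  by rewrite -sqrf_eq0 -rnorm_inner h rnorm0.
have [chi hchi] := gelfand_exists ix; exists chi.
apply/eqP; rewrite -(eqrXn2 (n := 2)) ?rnorm_ge0// rnorm_loc_sqr -rnorm_inner -hchi.
by rewrite cabs_ge0E ?chi_ge0.
Qed.

Section AdjointPair.
Variables (T S : E -> E).
Hypothesis TS : is_adjoint inner T S.

Lemma inner_adjr x y : inner x (T y) = inner (S x) y.
Proof. by rewrite innerC TS -innerC. Qed.

Lemma madjD x y : T (x + y) = T x + T y.
Proof. by apply: inner_nondeg => z; rewrite innerDr !inner_adjr innerDr. Qed.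
Lemma madjZ (k : R[i]) x : T (k *: x) = k *: T x.
Proof. by apply: inner_nondeg => z; rewrite innerZr !inner_adjr innerZr. Qed.
Lemma madj_act x a : T (act x a) = act (T x) a.
Proof. by apply: inner_nondeg => z; rewrite inner_act !inner_adjr inner_act. Qed.
Lemma madj0 : T 0 = 0.
Proof. by have := madjZ 0 0; rewrite !scale0r. Qed.
Lemma madjB x y : T (x - y) = T x - T y.
Proof. by rewrite madjD -scaleN1r madjZ scaleN1r. Qed.
Lemma madj_sum (I : Type) (r : seq I) (P : pred I) (F : I -> E) :
  T (\sum_(i <- r | P i) F i) = \sum_(i <- r | P i) T (F i).
Proof. by apply: (big_morph T); [exact: madjD|exact: madj0]. Qed.

Lemma madjoint_sym : is_adjoint inner S T.
Proof. by move=> x y; rewrite inner_adjr. Qed.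

(* Uniform boundedness by the gliding hump: if [T] is unbounded, pick [y n] in the
   unit ball with [T (y n)] large and move [x n] by [3^-n] in the direction
   [+- T (y n)] so that [inner (T (y n)) (x n)] becomes large; the limit [x]
   contradicts [|inner (T (y n)) x| <= |S x|]. *)
Lemma adjointable_bounded : exists M : R, forall x, rnorm (T x) <= M * rnorm x.
Proof.
apply: contrapT => nb.
have hy (n : nat) : exists y, rnorm y <= 1 /\ n.+1%:R * 3 ^+ n <= rnorm (T y).
  apply: contrapT => ny; apply: nb; exists (n.+1%:R * 3 ^+ n) => x.
  have [x0|xn0] := eqVneq (rnorm x) 0.
    by rewrite (rnorm_eq0 x0) madj0 rnorm0 mulr0.
  have xp : 0 < rnorm x by rewrite lt_def xn0 rnorm_ge0.
  have cx : cabs (rnorm x)^-1%:C%C = (rnorm x)^-1 by rewrite cabsR ger0_norm// invr_ge0 ltW.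
  rewrite leNgt; apply/negP => lt; apply: ny; exists ((rnorm x)^-1%:C%C *: x).
  rewrite madjZ !rnormZ cx mulVf//; split=> //.
  by rewrite [leRHS]mulrC ler_pdivlMr// ltW.
have [y hy1] := choice hy.
have Typ n : 0 < rnorm (T (y n)).
  by apply: lt_le_trans (hy1 n).2; rewrite mulr_gt0// exprn_gt0.
pose xi n := ((3 ^- n) / rnorm (T (y n)))%:C%C *: T (y n).
have xin n : rnorm (xi n) = 3 ^- n.
  rewrite rnormZ cabsR ger0_norm ?divr_ge0 ?invr_ge0 ?exprn_ge0 ?(ltW (Typ n))//.
  by rewrite divfK// gt_eqF.
have phixi n : rnorm (inner (T (y n)) (xi n)) = 3 ^- n * rnorm (T (y n)).
  rewrite innerZr rnormZ rnorm_inner cabsR ger0_norm; last first.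
    by rewrite divr_ge0 ?invr_ge0 ?exprn_ge0 ?(ltW (Typ n)).
  have := Typ n; move: (rnorm (T (y n))) => u u0.
  by field; rewrite (gt_eqF u0) expf_neq0.
(* One of the two signs always works, because x + xi n and x - xi n differ by twice xi n. *)
pose step n x := if 3 ^- n * rnorm (T (y n)) <= rnorm (inner (T (y n)) (x + xi n))
  then x + xi n else x - xi n.
pose fix X n := if n is m.+1 then step m (X m) else 0.
have stepd n x : rnorm (step n x - x) = 3 ^- n.
  by rewrite /step; case: ifP => _; rewrite addrAC subrr add0r ?rnormN xin.
have steph n x : 3 ^- n * rnorm (T (y n)) <= rnorm (inner (T (y n)) (step n x)).
  rewrite /step; case: ifP => // /negbT; rewrite -ltNge => lt.
  have : rnorm (inner (T (y n)) (2%:C%C *: xi n)) <=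
      rnorm (inner (T (y n)) (x + xi n)) + rnorm (inner (T (y n)) (x - xi n)).
    have -> : 2%:C%C *: xi n = (x + xi n) - (x - xi n).
      by rewrite rmorph_nat scaler_nat mulr2n opprB addrC addrA subrK.
    by rewrite innerBr rnormB.
  rewrite innerZr rnormZ phixi cabsR ger0_norm//; lra.
(* 3 / 2 is the sum of the geometric series of ratio 1 / 3. *)
have far n k : rnorm (X (n + k)%N - X n) <= (3 / 2) * 3 ^- n.
  elim: k n => [|k IH] n.
    by rewrite addn0 subrr rnorm0 mulr_ge0 ?divr_ge0 ?invr_ge0 ?exprn_ge0.
  rewrite addnS -addSn (le_trans (rnorm_triB _ (X n.+1) _))//.
  apply: (le_trans (lerD (IH n.+1) (lexx _))); rewrite stepd exprS invfM.
  by set u := 3 ^- n; lra.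
have sm (e : R) : 0 < e -> exists n : nat, (3 / 2) * 3 ^- n <= e.
  move=> e0; have [n hn] := natSinv_lt (divr_gt0 e0 (ltr0Sn R 1)); exists n.+1.
  apply: (@le_trans _ _ (2 * n.+1%:R^-1)).
    apply: ler_pM; rewrite ?divr_ge0 ?invr_ge0 ?exprn_ge0//; first lra.
    by rewrite lef_pV2 ?posrE ?exprn_gt0// -natrX ler_nat ltnW// ltn_expl.
  by rewrite mulrC -ler_pdivlMr// ltW// hn.
have [x hx] : exists x, scvg X x.
  apply: scvg_complete => e e0; have [N hN] := sm (e / 2) ltac:(by rewrite divr_gt0).
  exists N => m n Nm Nn; rewrite (le_trans (rnorm_triB _ (X N) _))// (splitr e) lerD//.
    by rewrite -(subnKC Nm) (le_trans (far _ _)).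
  by rewrite rnorm_distC -(subnKC Nn) (le_trans (far _ _)).
(* The moves after step n amount to at most 3^-n / 2 in norm, so at least half of the value reached
   at step n survives in the limit. *)
have key n : n.+1%:R / 2 <= rnorm (S x).
  have h1 : rnorm (x - X n.+1) <= 2^-1 * 3 ^- n.
    apply: (scvg_le hx); exists n.+1 => k nk; rewrite -(subnKC nk).
    by rewrite (le_trans (far _ _))// exprS invfM; set u := 3 ^- n; lra.
  have h2 := steph n (X n); rewrite -/(X n.+1) in h2.
  have h3 : rnorm (inner (T (y n)) (X n.+1)) <=
      rnorm (inner (T (y n)) x) + rnorm (inner (T (y n)) (x - X n.+1)).
    have -> : inner (T (y n)) (X n.+1) = inner (T (y n)) x - inner (T (y n)) (x - X n.+1).
      by rewrite -innerBr subKr.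
    exact: rnormB.
  have h4 := inner_cs (T (y n)) (x - X n.+1).
  have h5 : rnorm (inner (T (y n)) x) <= rnorm (S x).
    rewrite TS (le_trans (inner_cs _ _))// ler_piMl ?rnorm_ge0//; exact: (hy1 n).1.
  have h6 : rnorm (T (y n)) * rnorm (x - X n.+1) <= rnorm (T (y n)) * (2^-1 * 3 ^- n).
    by rewrite ler_wpM2l ?rnorm_ge0.
  have h7 : n.+1%:R <= 3 ^- n * rnorm (T (y n)).
    by rewrite mulrC ler_pdivlMr ?exprn_gt0//; exact: (hy1 n).2.
  have : rnorm (T (y n)) * (2^-1 * 3 ^- n) = 2^-1 * (3 ^- n * rnorm (T (y n))) by ring.
  move: h2 h3 h4 h5 h6 h7; set v := 3 ^- n * _; set u := n.+1%:R => *; lra.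
have := key (Num.truncn (2 * rnorm (S x))); rewrite ler_pdivrMr// leNgt => /negP; apply.
by rewrite mulrC truncnS_gt.
Qed.

Lemma madj_opnorm x : rnorm (T x) <= opnorm T * rnorm x.
Proof. by have [M hM] := adjointable_bounded; apply: le_opnorm hM x; exact: madjZ. Qed.

End AdjointPair.

Lemma bernoulli_ineq (d : R) n : 0 <= d -> 1 + n%:R * d <= (1 + d) ^+ n.
Proof.
move=> d0; elim: n => [|n IH]; first by rewrite mul0r addr0 expr0.
rewrite exprS; apply: (@le_trans _ _ ((1 + d) * (1 + n%:R * d))); last first.
  by rewrite ler_wpM2l// addr_ge0.
have : 0 <= n%:R * (d * d) by rewrite !mulr_ge0.
rewrite -natr1; lra.
Qed.

(** A division-free form of (c_1 / c_0)^(2^n) <= c_(2^n) / c_0. *)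
Lemma iterated_cs (c : nat -> R) : (forall m, 0 <= c m) ->
  (forall m, c m ^+ 2 <= c 0%N * c (m + m)%N) ->
  forall n, c 0%N * c 1%N ^+ (2 ^ n) <= c 0%N ^+ (2 ^ n) * c (2 ^ n)%N.
Proof.
move=> c0 cs; elim=> [|n IH]; first by rewrite !expr1.
rewrite expnS mul2n -addnn; set m := (2 ^ n)%N in IH *.
have [e0|n0] := eqVneq (c 0%N) 0.
  by rewrite e0 !mul0r mulr_ge0 ?exprn_ge0.
have p0 : 0 < c 0%N by rewrite lt_def n0 c0.
rewrite !exprD -(ler_pM2l p0).
set u := c 1%N ^+ m in IH *; set w := c 0%N ^+ m in IH *.
have u0 : 0 <= u by exact: exprn_ge0.
apply: (@le_trans _ _ ((w * c m) ^+ 2)).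
  have -> : c 0%N * (c 0%N * (u * u)) = (c 0%N * u) ^+ 2 by ring.
  by rewrite ler_pXn2r ?nnegrE ?mulr_ge0 ?exprn_ge0.
have -> : (w * c m) ^+ 2 = (w * w) * c m ^+ 2 by ring.
have -> : c 0%N * (w * w * c (m + m)%N) = (w * w) * (c 0%N * c (m + m)%N) by ring.
by rewrite ler_wpM2l// -expr2 sqr_ge0.
Qed.

(* [a1 ^ (2^n) <= a0 ^ (2^n - 1) * |P ^ (2^n) x|], by Cauchy-Schwarz; take [2^n]-th roots. *)
Lemma loc_selfadjoint_le chi (P : E -> E) K x : is_adjoint inner P P -> 0 < K ->
  (forall x, rnorm (P x) <= K * rnorm x) ->
  rnorm (localize chi (P x)) <= K * rnorm (localize chi x).
Proof.
move=> aP K0 bP; set a0 := rnorm (localize chi x); set a1 := rnorm (localize chi (P x)).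
have a00 : 0 <= a0 by exact: rnorm_ge0.
have a10 : 0 <= a1 by exact: rnorm_ge0.
have aPn n : is_adjoint inner (iter n P) (iter n P).
  by elim: n => // n IH u v; rewrite iterS aP IH -iterSr.
have cs m : rnorm (localize chi (iter m P x)) ^+ 2 <= a0 * rnorm (localize chi (iter (m + m) P x)).
  rewrite rnorm_sqr dot_loc (aPn m) -iterD -dot_loc.
  by rewrite (le_trans (ler_norm _))// (le_trans (Re_le_cabs _))// dot_cs.
have bPn n : rnorm (iter n P x) <= K ^+ n * rnorm x.
  elim: n => [|n IH]; first by rewrite mul1r.
  by rewrite iterS (le_trans (bP _))// exprS -mulrA ler_wpM2l// ltW.
have pw n : a0 * a1 ^+ (2 ^ n) <= a0 ^+ (2 ^ n) * rnorm (localize chi (iter (2 ^ n) P x)).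
  apply: (@iterated_cs (fun m => rnorm (localize chi (iter m P x)))) => [m|]; first exact: rnorm_ge0.
  exact: cs.
have cs1 : a1 ^+ 2 <= a0 * rnorm (localize chi (iter 2 P x)) by exact: (cs 1%N).
clearbody a0 a1.
have [a0z|an0] := eqVneq a0 0.
  have := cs1; rewrite a0z mul0r => h.
  by rewrite mulr0 -(ler_pXn2r (n := 2)) ?nnegrE// expr0n.
have ap : 0 < a0 by rewrite lt_def an0.
have c0 : 0 < K * a0 by rewrite mulr_gt0.
rewrite leNgt; apply/negP => lt.
pose d := a1 / (K * a0) - 1.
have d0 : 0 < d by rewrite subr_gt0 ltr_pdivlMr// mul1r.
have dE : a1 = (1 + d) * (K * a0) by rewrite /d subrKC divfK// gt_eqF.
have bd n : a0 * (1 + d) ^+ (2 ^ n) <= rnorm x.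
  have h1 := pw n; rewrite dE exprMn in h1.
  have h2 := le_trans (rnorm_loc_le chi _) (bPn (2 ^ n)%N).
  have kp : 0 < (K * a0) ^+ (2 ^ n) by rewrite exprn_gt0.
  rewrite -(ler_pM2r kp) -mulrA (le_trans h1)//.
  rewrite exprMn [leRHS]mulrC [K ^+ _ * _]mulrC -mulrA ler_wpM2l ?exprn_ge0//.
have [n hn] : exists n : nat, rnorm x / a0 / d < n.+1%:R.
  by exists (Num.truncn (rnorm x / a0 / d)); exact: truncnS_gt.
have := bd n.+1; apply/negP; rewrite -ltNge.
rewrite mulrC -ltr_pdivrMr//; apply: lt_le_trans (bernoulli_ineq _ (ltW d0)).
rewrite ltr_pdivrMr// in hn; apply: (lt_le_trans hn).
apply: (@le_trans _ _ ((2 ^ n.+1)%:R * d)); last by rewrite lerDr.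
by rewrite ler_wpM2r ?(ltW d0)// ler_nat ltnW// ltn_expl.
Qed.

Lemma madj_opnorm_adj T S : is_adjoint inner T S -> forall x, rnorm (S (T x)) <= opnorm T ^+ 2 * rnorm x.
Proof.
move=> TS; have ST := madjoint_sym TS.
have key z : rnorm (S z) <= opnorm T * rnorm z.
  have [S0|Sn0] := eqVneq (rnorm (S z)) 0.
    by rewrite S0 mulr_ge0 ?opnorm_ge0 ?rnorm_ge0.
  have Sp : 0 < rnorm (S z) by rewrite lt_def Sn0 rnorm_ge0.
  rewrite -(ler_pM2r Sp) -expr2 -rnorm_inner ST (le_trans (inner_cs _ _))//.
  by rewrite mulrAC mulrC ler_wpM2r ?rnorm_ge0// (madj_opnorm TS).
by move=> x; rewrite (le_trans (key _))// expr2 -mulrA ler_wpM2l ?opnorm_ge0// (madj_opnorm TS).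
Qed.

Lemma eps_sum_le (u v e w k f z : R) : u <= e * w -> v <= k * f * (z + e) ->
  u + v <= k * f * z + e * (w + k * f).
Proof. by move=> h1 h2; rewrite (le_trans (lerD h1 h2))// le_eqVlt; apply/orP; left; apply/eqP; ring. Qed.

Lemma eps_sum_le2 (u v e k c f : R) : u <= k * e -> v <= c * (f + e) ->
  u + v <= c * f + e * (k + c).
Proof. by move=> h1 h2; rewrite (le_trans (lerD h1 h2))// le_eqVlt; apply/orP; left; apply/eqP; ring. Qed.

Lemma sqr_le_trans (u n m k r : R) : u ^+ 2 = r -> r <= n * m -> m <= k * n -> 0 <= n ->
  u ^+ 2 <= k * n ^+ 2.
Proof.
move=> -> rnm mkn n0; rewrite (le_trans rnm)// expr2 mulrA [leRHS]mulrC.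
by rewrite ler_wpM2l.
Qed.

(** In the localization |T x|^2 = <x, S T x>, and [loc_selfadjoint_le] applies to S T, whose norm is
    at most |T|^2. Adding e makes the constant positive. *)
Lemma loc_le chi T S x : is_adjoint inner T S ->
  rnorm (localize chi (T x)) <= opnorm T * rnorm (localize chi x).
Proof.
move=> TS; have ST := madjoint_sym TS.
rewrite -(ler_pXn2r (n := 2)) ?nnegrE ?mulr_ge0 ?opnorm_ge0 ?rnorm_ge0//.
rewrite exprMn; apply: (@le_of_epsM _ _ _ (rnorm (localize chi x) ^+ 2)); first exact: sqr_ge0.
move=> e e0; rewrite -mulrDl.
have K0 : 0 < opnorm T ^+ 2 + e by rewrite ltr_wpDl// sqr_ge0.
have aP : is_adjoint inner (S \o T) (S \o T) by move=> u v; rewrite /= ST TS.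
have bP u : rnorm ((S \o T) u) <= (opnorm T ^+ 2 + e) * rnorm u.
  by rewrite mulrDl (le_trans (madj_opnorm_adj TS u))// lerDl mulr_ge0 ?rnorm_ge0// ltW.
have h := loc_selfadjoint_le chi x aP K0 bP.
have E1 : rnorm (localize chi (T x)) ^+ 2 = complex.Re (dot (localize chi x) (localize chi (S (T x)))).
  rewrite rnorm_sqr.
  rewrite dot_loc.
  by rewrite TS -dot_loc.
have E2 := le_trans (ler_norm _) (le_trans (Re_le_cabs _) (dot_cs (localize chi x) (localize chi (S (T x))))).
exact: (sqr_le_trans E1 E2 h (rnorm_ge0 _)).
Qed.

Section LocalizeOp.
Variables (chi : character A).
Local Notation loc := (localize chi : E -> localization E chi).

(** An element f of the completion is the functional y |-> <y, f>, so T acts on it by composition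
    with the adjoint [S]. The image under T of a sequence that represents f is Cauchy by
    [loc_le]. *)
Lemma loc_functional_repr T S : is_adjoint inner T S -> forall f : localization E chi,
  completion_pred (localized_sip E chi) (f \o S).
Proof.
move=> TS f; apply/asboolP; have [cu uf] := cauchy_repP f.
have Tloc u : sip_norm (localized_sip E chi) u = (rnorm (loc u))%:C%C.
  apply/eqP; rewrite -(eqrXn2 (n := 2)) ?sip_norm_ge0 ?ler0c ?rnorm_ge0//.
  by rewrite sip_normK -rmorphXn /= -dotxx dot_loc.
exists (fun n => T (cauchy_rep f n)); split.
  move=> e e0; pose K := opnorm T + 1.
  have K0 : 0 < K by rewrite ltr_wpDl ?opnorm_ge0.
  have Kc : 0 < K%:C%C :> R[i] by rewrite ltcR.
  have [N hN] := cu (e / K%:C%C) ltac:(by rewrite divr_gt0).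
  exists N => m n Nm Nn; have := hN m n Nm Nn.
  rewrite ltr_pdivlMr//; apply: le_lt_trans.
  rewrite !Tloc -(madjB TS) -rmorphM lecR mulrC (le_trans (loc_le chi _ TS))//.
  by rewrite ler_wpM2r ?rnorm_ge0// lerDl.
move=> y /=; have -> : (fun n => localized_sip E chi y (T (cauchy_rep f n)) : R[i]^o) =
   (fun n => localized_sip E chi (S y) (cauchy_rep f n) : R[i]^o).
  by apply/funext => n /=; rewrite (inner_adjr TS).
exact: uf.
Qed.

Definition loc_op T S (TS : is_adjoint inner T S) (f : localization E chi) : localization E chi :=
  Completion (loc_functional_repr TS f).

Lemma loc_opE T S (TS : is_adjoint inner T S) f x :
  dot (loc x) (loc_op TS f) = dot (loc (S x)) f.
Proof. by rewrite !locE. Qed.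

Lemma loc_op_loc T S (TS : is_adjoint inner T S) x : loc_op TS (loc x) = loc (T x).
Proof. by apply: loc_ext => z; rewrite loc_opE !dot_loc (inner_adjr TS). Qed.

Lemma loc_op_bop T S (TS : is_adjoint inner T S) (ST : is_adjoint inner S T) :
  bop (loc_op TS) (loc_op ST).
Proof.
have bd T' S' (TS' : is_adjoint inner T' S') : exists2 c : R, 0 <= c & bnd c (loc_op TS').
  have ST' := madjoint_sym TS'.
  exists (opnorm S'); first exact: opnorm_ge0.
  move=> f; apply: rnorm_le_dot; first by rewrite mulr_ge0 ?opnorm_ge0 ?rnorm_ge0.
  move=> z; pose C := rnorm (loc_op TS' f) + opnorm S' * rnorm f.
  have C0 : 0 <= C by rewrite addr_ge0 ?mulr_ge0 ?opnorm_ge0 ?rnorm_ge0.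
  apply: (le_of_epsM C0) => e e0; have [x hx] := loc_dense z e0.
  rewrite -{1}(subrK (loc x) z) dotDl loc_opE; apply: (le_trans (cabsD _ _)).
  have h1 : cabs (dot (z - loc x) (loc_op TS' f)) <= e * rnorm (loc_op TS' f).
    by rewrite (le_trans (dot_cs _ _))// ler_wpM2r ?rnorm_ge0.
  have h2 : cabs (dot (loc (S' x)) f) <= opnorm S' * rnorm f * (rnorm z + e).
    rewrite (le_trans (dot_cs _ _))// mulrAC ler_wpM2r ?rnorm_ge0//.
    rewrite (le_trans (loc_le chi _ ST'))// ler_wpM2l ?opnorm_ge0//.
    have -> : loc x = z - (z - loc x) by rewrite subKr.
    by rewrite (le_trans (rnormB _ _))// lerD2l.
  exact: eps_sum_le h1 h2.
have [c c0 bc] := bd _ _ TS; have [d d0 bd'] := bd _ _ ST.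
split; last by exists c.
move=> f g; apply/eqP; rewrite -subr_eq0; apply/eqP/cabs_eq0/eqP.
rewrite eq_le cabs_ge0 andbT.
pose C := c * rnorm g + d * rnorm g.
have C0 : 0 <= C by rewrite addr_ge0 ?mulr_ge0 ?rnorm_ge0.
apply: (le_of_epsM C0) => e e0; have [x hx] := loc_dense f e0.
have lin u v : loc_op TS (u - v) = loc_op TS u - loc_op TS v.
  by apply: loc_ext => z; rewrite dotBr !loc_opE dotBr.
have -> : dot (loc_op TS f) g - dot f (loc_op ST g) =
    dot (loc_op TS (f - loc x)) g - dot (f - loc x) (loc_op ST g).
  by rewrite lin !dotBl loc_op_loc loc_opE opprB subrKA.
rewrite add0r (le_trans (cabsB _ _))// mulrDr lerD//.
  rewrite (le_trans (dot_cs _ _))// mulrA ler_wpM2r ?rnorm_ge0// (le_trans (bc _))//.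
  by rewrite mulrC ler_wpM2r.
rewrite (le_trans (dot_cs _ _))//; apply: ler_pM; rewrite ?rnorm_ge0//; exact: bd'.
Qed.

(** Bounded operators that agree on the dense image of [E] are equal, which pins down the choice
    made in [localize_op]. *)
Lemma localize_op_eq T S (TS : is_adjoint inner T S) : localize_op chi T = loc_op TS.
Proof.
have ST := madjoint_sym TS; have b := loc_op_bop TS ST.
apply: xget_unique.
  split; last exact: loc_op_loc.
  split; last by have [_] := b.
  by move=> k x y; rewrite (adj_linear k x y b.1).
move=> Q [[linQ [M bQ]] hQ]; apply/funext => f.
apply/eqP; rewrite -subr_eq0; apply/eqP/rnorm_eq0/eqP.
rewrite eq_le rnorm_ge0 andbT.
have QB u v : Q (u - v) = Q u - Q v by rewrite addrC -scaleN1r linQ scaleN1r addrC.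
have [_ [c bc]] := b.
apply: (@le_of_epsM _ _ _ (`|M| + `|c|)) => [|e e0]; first by rewrite addr_ge0.
have [x hx] := loc_dense f e0.
have -> : Q f - loc_op TS f = Q (f - loc x) - loc_op TS (f - loc x).
  by rewrite QB (adjB _ _ b.1) hQ loc_op_loc opprB addrA subrK.
rewrite add0r mulrDr (le_trans (rnormB _ _))// lerD//.
  rewrite (le_trans (bQ _))// mulrC; apply: (@le_trans _ _ (rnorm (f - loc x) * `|M|)).
    by rewrite ler_wpM2l ?rnorm_ge0 ?ler_norm.
  by rewrite ler_wpM2r.
rewrite (le_trans (bc _))// mulrC; apply: (@le_trans _ _ (rnorm (f - loc x) * `|c|)).
  by rewrite ler_wpM2l ?rnorm_ge0 ?ler_norm.
by rewrite ler_wpM2r.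
Qed.

Lemma localize_op_bop T S : is_adjoint inner T S -> bop (localize_op chi T) (localize_op chi S).
Proof.
move=> TS; rewrite (localize_op_eq TS) (localize_op_eq (madjoint_sym TS)).
exact: loc_op_bop.
Qed.

Lemma localize_op_loc T S x : is_adjoint inner T S -> localize_op chi T (loc x) = loc (T x).
Proof. by move=> TS; rewrite (localize_op_eq TS) loc_op_loc. Qed.

Lemma localize_op_bnd T S (c : R) : is_adjoint inner T S -> 0 <= c ->
  (forall x, rnorm (loc (T x)) <= c * rnorm (loc x)) -> bnd c (localize_op chi T).
Proof.
move=> TS c0 h f; have b := localize_op_bop TS.
apply: (@le_of_epsM _ _ _ (opnorm (localize_op chi T) + c)) => [|e e0].
  by rewrite addr_ge0 ?opnorm_ge0.
have [x hx] := loc_dense f e0.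
rewrite -{1}(subrK (loc x) f) (adjD _ _ b.1) (localize_op_loc _ TS).
apply: (le_trans (rnormD _ _)).
have h1 : rnorm (localize_op chi T (f - loc x)) <= opnorm (localize_op chi T) * e.
  by rewrite (le_trans (bop_opnorm b _))// ler_wpM2l ?opnorm_ge0.
have h2 : rnorm (loc (T x)) <= c * (rnorm f + e).
  rewrite (le_trans (h x))// ler_wpM2l//.
  have -> : loc x = f - (f - loc x) by rewrite subKr.
  by rewrite (le_trans (rnormB _ _))// lerD2l.
exact: eps_sum_le2 h1 h2.
Qed.

Lemma localize_op_opnorm T S : is_adjoint inner T S -> bnd (opnorm T) (localize_op chi T).
Proof.
by move=> TS; apply: (localize_op_bnd TS (opnorm_ge0 T)) => x; exact: loc_le TS.
Qed.

Lemma localize_op_comp T T' S S' : is_adjoint inner T T' -> is_adjoint inner S S' ->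
  localize_op chi (S \o T) = localize_op chi S \o localize_op chi T.
Proof.
move=> hT hS; have hST : is_adjoint inner (S \o T) (T' \o S') by move=> x y; rewrite /= hS hT.
apply: bop_loc_ext (localize_op_bop hST) (bop_comp (localize_op_bop hS) (localize_op_bop hT)) _.
by move=> x; rewrite /= (localize_op_loc _ hST) (localize_op_loc _ hT) (localize_op_loc _ hS).
Qed.

Lemma madjoint_lin T T' S S' (k : R[i]) : is_adjoint inner T T' -> is_adjoint inner S S' ->
  is_adjoint inner (fun x => T x + k *: S x) (fun x => T' x + k^* *: S' x).
Proof.
by move=> hT hS x y; rewrite innerDl innerDr innerZl innerZr hT hS.
Qed.

Lemma localize_op_lin T T' S S' (k : R[i]) : is_adjoint inner T T' -> is_adjoint inner S S' ->
  localize_op chi (fun x => T x + k *: S x) =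
  fun f => localize_op chi T f + k *: localize_op chi S f.
Proof.
move=> hT hS; have h := madjoint_lin k hT hS.
have b := bopD (localize_op_bop hT) (bopZ k (localize_op_bop hS)).
apply: bop_loc_ext (localize_op_bop h) b _.
move=> x; rewrite (localize_op_loc _ h) (localize_op_loc _ hT) (localize_op_loc _ hS).
by rewrite locD locZ.
Qed.

End LocalizeOp.

Lemma opnorm_le_local T S c : is_adjoint inner T S -> 0 <= c ->
  (forall chi, bnd c (localize_op chi T)) -> opnorm T <= c.
Proof.
move=> TS c0 h; apply: opnorm_le => // x.
have [Tx0|Txn0] := eqVneq (T x) 0; first by rewrite Tx0 rnorm0 mulr_ge0 ?rnorm_ge0.
have [chi <-] := rnorm_loc_exists Txn0.
rewrite -(localize_op_loc chi x TS) (le_trans (h chi _))// ler_wpM2l//.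
exact: rnorm_loc_le.
Qed.

Lemma adjoint_innerE T S : is_adjoint inner T S -> adjoint inner T = S.
Proof.
move=> h; rewrite /adjoint; apply: xget_unique => // S' hS.
by apply/funext => x; apply: inner_nondeg => z; rewrite -h hS.
Qed.

End HilbertModuleBasics.

(** * Finite-rank operators *)

Lemma schle_triB (R : realType) (H : hilbertType R) (p c d : R) (Q S : H -> H) : 1 <= p ->
  schle p (fun x => Q x - S x) d -> schle p S c -> schle p Q (c + d).
Proof.
move=> p1 hd hc; have := schleD p1 hc hd.
by congr (schle p _ _); apply/funext => x; rewrite addrC subrK.
Qed.

Lemma schle_distC (R : realType) (H : hilbertType R) (p d : R) (Q S : H -> H) : 1 <= p ->
  schle p (fun x => Q x - S x) d -> schle p (fun x => S x - Q x) d.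
Proof.
move=> p1 hd; have := schleZ (-1) p1 hd; rewrite cabsN cabs1 mul1r.
by congr (schle p _ _); apply/funext => x; rewrite scaleN1r opprB.
Qed.

Local Opaque rnorm localize.

Section SchattenClass.
Variables (R : realType) (A : commCStarType R) (E : hilbertModType A).
Implicit Types (x y z w : E) (a b : A) (T S F : E -> E) (chi : character A).
Local Notation loc chi := (localize chi : E -> localization E chi).

Definition finite_rank F := exists s : seq (E * E), forall z,
  F z = \sum_(u <- s) act u.1 (inner u.2 z).

Lemma inner_suml (I : Type) (r : seq I) (P : pred I) (f : I -> E) x :
  inner (\sum_(i <- r | P i) f i) x = \sum_(i <- r | P i) inner (f i) x.
Proof.
apply: (big_morph (fun u => inner u x)) => [y z|]; first exact: innerDl.
by rewrite -(scale0r 0) innerZl rmorph0 !scale0r.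
Qed.

Lemma finite_rank_adj F : finite_rank F -> exists2 F', finite_rank F' & is_adjoint inner F F'.
Proof.
move=> [s hs]; exists (fun z => \sum_(u <- s) act u.2 (inner u.1 z)) => [|z w].
  by exists [seq (u.2, u.1) | u <- s] => z; rewrite big_map.
rewrite hs inner_suml inner_sumr; apply: eq_bigr => u _.
by rewrite inner_actl inner_act -innerC.
Qed.

Lemma finite_rank_compl F S S' : is_adjoint inner S S' -> finite_rank F -> finite_rank (S \o F).
Proof.
move=> hS [s hs]; exists [seq (S u.1, u.2) | u <- s] => z.
rewrite big_map /= hs (madj_sum hS); apply: eq_bigr => u _.
by rewrite (madj_act hS).
Qed.

Lemma finite_rank_compr F S S' : is_adjoint inner S S' -> finite_rank F -> finite_rank (F \o S).
Proof.
move=> hS [s hs]; exists [seq (u.1, S' u.2) | u <- s] => z.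
by rewrite big_map /= hs; apply: eq_bigr => u _; rewrite (inner_adjr hS).
Qed.

Lemma finite_rank_lin F G (k : R[i]) : finite_rank F -> finite_rank G ->
  finite_rank (fun z => F z + k *: G z).
Proof.
move=> [s hs] [t ht]; exists (s ++ [seq (k *: u.1, u.2) | u <- t]) => z.
rewrite big_cat big_map /= hs ht; congr (_ + _).
by rewrite scaler_sumr; apply: eq_bigr => u _; rewrite actZl.
Qed.

Lemma finite_rank0 : finite_rank (fun=> 0).
Proof. by exists [::] => z; rewrite big_nil. Qed.

Lemma bop_rank (H : hilbertType R) (I : Type) (s : seq I) (a b : I -> H) :
  bop (fun f => \sum_(u <- s) dot (b u) f *: a u) (fun f => \sum_(u <- s) dot (a u) f *: b u).
Proof.
split.
  move=> f g; rewrite dot_suml dot_sumr; apply: eq_bigr => u _.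
  by rewrite dotZl dotZr -dotC mulrC.
exists (\sum_(u <- s) rnorm (b u) * rnorm (a u)) => f.
rewrite (le_trans (rnorm_sum _ _ _))// mulr_suml; apply: ler_sum => u _.
by rewrite rnormZ mulrAC ler_wpM2r ?rnorm_ge0// dot_cs.
Qed.

Lemma finite_rank_local F F' (s : seq (E * E)) chi : is_adjoint inner F F' ->
  (forall z, F z = \sum_(u <- s) act u.1 (inner u.2 z)) ->
  forall f, localize_op chi F f = \sum_(u <- s) dot (loc chi u.2) f *: loc chi u.1.
Proof.
move=> hF hs f.
have b := bop_rank s (fun u => loc chi u.1) (fun u => loc chi u.2).
rewrite (_ : localize_op chi F = fun f => \sum_(u <- s) dot (loc chi u.2) f *: loc chi u.1)//.
apply: bop_loc_ext (localize_op_bop chi hF) b _ => x.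
rewrite (localize_op_loc _ x hF) hs loc_sum; apply: eq_bigr => u _.
by rewrite loc_act dot_loc.
Qed.

Definition mod_poly (q : {poly R}) S x := \sum_(i < size q) (q`_i)%:C%C *: iter i S x.

Lemma mod_poly_local q S S' chi x : is_adjoint inner S S' ->
  poly_operator q (localize_op chi S) (loc chi x) = loc chi (mod_poly q S x).
Proof.
move=> hS; rewrite /poly_operator /mod_poly loc_sum; apply: eq_bigr => i _.
rewrite locZ; congr (_ *: _); elim: (i : nat) => // k IH.
by rewrite !iterS IH (localize_op_loc _ _ hS).
Qed.

Lemma abs_opnorm_le (H : hilbertType R) (Q Q' : H -> H) c : bop Q Q' -> 0 <= c -> bnd c Q ->
  opnorm (abs_operator Q) <= c.
Proof. by move=> bQ c0 bc; apply: opnorm_le => // x; rewrite (rnorm_abs bQ). Qed.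

Lemma abs_local_opnorm T T' chi : is_adjoint inner T T' ->
  opnorm (abs_operator (localize_op chi T)) <= opnorm T.
Proof.
move=> hT; apply: (abs_opnorm_le (localize_op_bop chi hT)); first exact: opnorm_ge0.
exact: localize_op_opnorm hT.
Qed.

(** Approximate s^(p/2) within e/2 by a polynomial q on the squares s = t^2, then subtract q(0),
    which is at most e/2 in modulus since 0^(p/2) = 0. *)
Lemma sqr_poly_approx (p M e : R) : 0 < p -> 0 <= M -> 0 < e -> exists r : {poly R},
  forall t, 0 <= t <= M -> `|t `^ p - (r * 'X).[t * t]| <= e.
Proof.
move=> p0 M0 e0; have M2 : 0 < M * M + 1 by rewrite ltr_wpDl// mulr_ge0.
have p2 : 0 < p / 2 by rewrite divr_gt0.
have [q hq] := @poly_approx_powR R _ _ M2 p2 (e / 2) ltac:(by rewrite divr_gt0).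
have q0 : `|q.[0]| <= e / 2.
  by have := hq 0; rewrite lexx (ltW M2) powR0 ?gt_eqF// subr0; apply.
have rq : root (q - q.[0]%:P) 0 by rewrite rootE !hornerE subrr.
have [r hr] := factor_theorem _ _ rq; rewrite subr0 in hr.
exists r => t /andP[t0 tM]; rewrite -hr hornerD hornerN hornerC.
have -> : t `^ p = (t * t) `^ (p / 2) by rewrite -expr2 powR_sqr.
have -> : (t * t) `^ (p / 2) - (q.[t * t] - q.[0]) = q.[0] - (q.[t * t] - (t * t) `^ (p / 2)).
  by ring.
rewrite (le_trans (ler_normB _ _))// (splitr e) lerD// hq// mulr_ge0//=.
by rewrite (@le_trans _ _ (M * M)) ?lerDl// ler_pM.
Qed.

Lemma trace_real p T T' chi (c : R) : is_adjoint inner T T' -> 1 <= p ->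
  schle p (localize_op chi T) c ->
  exists u : R, [/\ trace_abs_pow p (localize_op chi T) = u%:E, 0 <= u & u <= c `^ p].
Proof.
move=> hT p1 hc; have bT := localize_op_bop chi hT; have [c0 _] := hc.
have h := (trace_schle bT p1 c0).2 hc.
have [G hG trE] := abs_powR_exists bT p1; rewrite trE in h *.
have G0 f : 0 <= complex.Re (dot f (G f)) := fcal_powR_ge0 f (abs_posop bT) hG.
have [u [uE u0 _ umin]] := trace_fin G0 ((trace_leP _ G0).1 h).
by exists u; split; [exact: uE|exact: u0|exact: umin ((trace_leP _ G0).1 h)].
Qed.

Lemma schle_trace p T T' chi (u c : R) : is_adjoint inner T T' -> 1 <= p -> 0 <= c ->
  trace_abs_pow p (localize_op chi T) = u%:E ->
  schle p (localize_op chi T) c <-> u <= c `^ p.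
Proof.
by move=> hT p1 c0 trE; rewrite -(trace_schle (localize_op_bop chi hT) p1 c0) trE lee_fin.
Qed.

Lemma gelfand_real (z : A) : exists z' : A, forall chi, chi z' = (complex.Re (chi z))%:C%C.
Proof.
exists ((2^-1 : R[i]) *: (z + cstar z)) => chi.
by rewrite chiZ chiD chi_star addcJ mulrA mulVf ?mul1r// pnatr_eq0.
Qed.

Lemma is_gelfand_approx (f : character A -> \bar R) :
  (forall e : R, 0 < e -> exists z : A, forall chi, exists u : R,
     f chi = u%:E /\ cabs (u%:C%C - chi z) <= e) -> exists z : A, is_gelfand f z.
Proof.
move=> main.
have [z hz] : exists z : A, forall chi, chi z = (fine (f chi))%:C%C.
  apply: gelfand_closure => e /main[z hz]; exists z => chi.
  by have [u [-> hu]] := hz chi.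
exists z => chi; have [z' /(_ chi)[u [uE _]]] := main 1 ltr01.
by exists u => //; rewrite hz uE.
Qed.

(** One polynomial serves all characters, since every |chi_* F| has norm at most |F|. The
    approximate traces are then the values of the characters at a single element of [A], and
    [is_gelfand_approx] passes to the limit. *)
Lemma finite_rank_schatten p F : 1 <= p -> finite_rank F -> schatten_class E p F.
Proof.
move=> p1 fF; have p0 : 0 < p by lra.
have [F' _ hF] := finite_rank_adj fF; split; first by exists F'.
have hF' := madjoint_sym hF.
have [s hs] := fF; pose n := size s.
pose a chi (i : 'I_n) := loc chi (tnth (in_tuple s) i).1.
pose b chi (i : 'I_n) := loc chi (tnth (in_tuple s) i).2.
have FE chi f : localize_op chi F f = \sum_i dot (b chi i) f *: a chi i.
  by rewrite (finite_rank_local hF hs) big_tnth.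
have hP : is_adjoint inner (F' \o F) (F' \o F) by move=> x y; rewrite /= hF' hF.
have PE chi : localize_op chi (F' \o F) = localize_op chi F' \o localize_op chi F.
  exact: localize_op_comp hF hF'.
apply: is_gelfand_approx => e e0; have n0 : 0 < n.+1%:R :> R by rewrite ltr0n.
have d0 : 0 < e / n.+1%:R by rewrite divr_gt0.
have [r hr] := sqr_poly_approx p0 (opnorm_ge0 F) d0.
have [z hz] := gelfand_real (\sum_i inner (tnth (in_tuple s) i).2
   (mod_poly r (F' \o F) (F' (tnth (in_tuple s) i).1))).
exists z => chi.
have [|u [uE u0 hu]] := finite_rank_trace p1 (localize_op_bop chi hF) (FE chi) d0 (r := r).
  move=> t /andP[t0 tM]; apply: hr; rewrite t0 (le_trans tM)//.
  exact: abs_local_opnorm hF.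
exists u; split; first exact: uE.
rewrite hz -rmorphB cabsR.
have Ez : chi (\sum_i inner (tnth (in_tuple s) i).2
    (mod_poly r (F' \o F) (F' (tnth (in_tuple s) i).1))) =
    \sum_i dot (b chi i) (poly_operator r (localize_op chi F' \o localize_op chi F)
       (localize_op chi F' (a chi i))).
  rewrite chi_sum; apply: eq_bigr => i _.
  by rewrite -dot_loc -PE (localize_op_loc _ _ hF') (mod_poly_local _ _ _ hP).
rewrite Ez (le_trans hu)// mulrC mulrAC ler_pdivrMr// ler_wpM2l ?(ltW e0)//.
by rewrite ler_nat.
Qed.

Lemma tr_eltP p T : schatten_class E p T -> is_gelfand (tr_abs_pow p T) (tr_elt p T).
Proof. by move=> [_ ex]; exact: xgetPex ex. Qed.

Lemma schatten_local p T T' : 1 <= p -> is_adjoint inner T T' -> schatten_class E p T ->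
  forall chi, exists u : R, [/\ trace_abs_pow p (localize_op chi T) = u%:E, 0 <= u,
    chi (tr_elt p T) = u%:C%C & schle p (localize_op chi T) (u `^ p^-1)].
Proof.
move=> p1 hT sT chi; have p0 : 0 < p by lra.
have [u uE trE] := tr_eltP sT chi; rewrite /tr_abs_pow in trE.
have bT := localize_op_bop chi hT.
have [G hG E'] := abs_powR_exists bT p1.
have u0 : 0 <= u.
  rewrite -lee_fin -trE E'; apply: esum_ge0 => x _.
  by rewrite lee_fin (fcal_powR_ge0 x (abs_posop bT) hG).
exists u; split; [exact: trE|exact: u0|exact: uE|].
apply/(schle_trace hT p1 _ trE); first exact: powR_ge0.
by rewrite powRVK.
Qed.

Lemma pnorm_leP p T T' (c : R) : 1 <= p -> is_adjoint inner T T' -> schatten_class E p T ->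
  0 <= c -> pnorm p T <= c <-> forall chi, schle p (localize_op chi T) c.
Proof.
move=> p1 hT sT c0; have p0 : 0 < p by lra.
have loc_ := schatten_local p1 hT sT.
have -> : pnorm p T <= c <-> rnorm (tr_elt p T) <= c `^ p.
  rewrite /pnorm; split=> h.
    by rewrite -(powRVK p0 (rnorm_ge0 _)) ler_powRl ?powR_ge0 ?(ltW p0).
  rewrite -[leRHS](powRKV p0 c0) ler_powRl ?rnorm_ge0//.
  by rewrite invr_ge0 ltW.
split=> [h chi|h].
  have [u [uE u0 chiE _]] := loc_ chi; apply/(schle_trace hT p1 c0 uE).
  apply: le_trans h; have := char_le chi (tr_elt p T).
  by rewrite chiE cabsR ger0_norm.
apply: gelfand_norm_le => [|chi]; first exact: powR_ge0.
have [u [uE u0 chiE _]] := loc_ chi; rewrite chiE cabsR ger0_norm//.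
exact/(schle_trace hT p1 c0 uE).
Qed.

Lemma pnorm_ge0 p T : 0 <= pnorm p T :> R.
Proof. exact: powR_ge0. Qed.

Lemma pnorm_schle p T T' chi : 1 <= p -> is_adjoint inner T T' -> schatten_class E p T ->
  schle p (localize_op chi T) (pnorm p T).
Proof.
by move=> p1 hT sT; apply: ((pnorm_leP p1 hT sT (pnorm_ge0 p T)).1 (lexx _)).
Qed.

Lemma localize_opB T T' S S' chi : is_adjoint inner T T' -> is_adjoint inner S S' ->
  localize_op chi (fun x => T x - S x) = fun f => localize_op chi T f - localize_op chi S f.
Proof.
move=> hT hS; have := localize_op_lin chi (-1) hT hS.
rewrite (_ : (fun x => T x + -1 *: S x) = (fun x => T x - S x)); last first.
  by apply/funext => x; rewrite scaleN1r.
by move=> ->; apply/funext => f; rewrite scaleN1r.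
Qed.

Lemma madjointB T T' S S' : is_adjoint inner T T' -> is_adjoint inner S S' ->
  is_adjoint inner (fun x => T x - S x) (fun x => T' x - S' x).
Proof. by move=> hT hS x y; rewrite innerBl innerBr hT hS. Qed.

Definition fr_approx p T := forall e : R, 0 < e -> exists F F',
  [/\ finite_rank F, is_adjoint inner F F' &
    forall chi, schle p (localize_op chi (fun x => T x - F x)) e].

Lemma schatten_of_approx p T T' : 1 <= p -> is_adjoint inner T T' -> fr_approx p T ->
  schatten_class E p T.
Proof.
move=> p1 hT app; have p0 : 0 < p by lra.
split; first by exists T'.
have [F1 [F1' [f1 h1 d1]]] := app 1 ltr01.
pose c1 := pnorm p F1; have c10 : 0 <= c1 by exact: pnorm_ge0.
have addB S S' F F' chi (c d : R) : is_adjoint inner S S' -> is_adjoint inner F F' ->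
    schle p (localize_op chi (fun x => S x - F x)) d -> schle p (localize_op chi F) c ->
    schle p (localize_op chi S) (c + d).
  by move=> hS hF; rewrite (localize_opB chi hS hF); exact: schle_triB.
have opp S F chi (d : R) : (exists S', is_adjoint inner S S') -> (exists F', is_adjoint inner F F') ->
    schle p (localize_op chi (fun x => S x - F x)) d ->
    schle p (localize_op chi (fun x => F x - S x)) d.
  move=> [S' hS] [F' hF]; rewrite (localize_opB chi hS hF) (localize_opB chi hF hS).
  exact: schle_distC.
have bT chi : schle p (localize_op chi T) (c1 + 1).
  exact: (addB _ _ _ _ chi _ _ hT h1 (d1 chi) (pnorm_schle chi p1 h1 (finite_rank_schatten p1 f1))).
(* Bounds the p-th roots s and t of both traces below: s <= c1 + 1, and t <= s + d with d <= 1. On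
   [0, K] the power p has the Lipschitz constant L. *)
pose K := c1 + 2; have K0 : 0 <= K by rewrite /K; lra.
pose L := p * K `^ (p - 1).
have L0 : 0 <= L by rewrite mulr_ge0 ?powR_ge0// ltW.
apply: is_gelfand_approx => e e0; pose d := Num.min 1 (e / (L + 1)).
have L1 : 0 < L + 1 by rewrite ltr_wpDl.
have d0 : 0 < d by rewrite lt_min ltr01 divr_gt0.
have dle1 : d <= 1 by rewrite ge_min lexx.
have dle : d <= e / (L + 1) by rewrite ge_min lexx orbT.
have [F [F' [fF hF dF]]] := app d d0.
have sF := finite_rank_schatten p1 fF.
exists (tr_elt p F) => chi.
have [u [uE u0 uc]] := trace_real hT p1 (bT chi).
have [v [vE v0 chiE vle]] := schatten_local p1 hF sF chi.
exists u; split; first exact: uE.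
rewrite chiE -rmorphB cabsR.
pose s := u `^ p^-1; pose t := v `^ p^-1.
have s0 : 0 <= s by exact: powR_ge0.
have t0 : 0 <= t by exact: powR_ge0.
have us : s `^ p = u by exact: powRVK.
have vt : t `^ p = v by exact: powRVK.
have Ts : schle p (localize_op chi T) s by apply/(schle_trace hT p1 s0 uE); rewrite us.
have st : s <= t + d.
  apply: (powR_le_inv p0); first by rewrite addr_ge0// ltW.
  rewrite us; apply/(schle_trace hT p1 _ uE); first by rewrite addr_ge0// ltW.
  exact: addB hT hF (dF chi) vle.
have ts : t <= s + d.
  apply: (powR_le_inv p0); first by rewrite addr_ge0// ltW.
  rewrite vt; apply/(schle_trace hF p1 _ vE); first by rewrite addr_ge0// ltW.
  exact: addB hF hT (opp _ _ chi _ (ex_intro _ _ hT) (ex_intro _ _ hF) (dF chi)) Ts.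
have cK : c1 + 1 <= K by rewrite /K lerD2l ler1n.
have sK : 0 <= s <= K.
  rewrite s0 /=; apply: (@le_trans _ _ (c1 + 1)); last exact: cK.
  apply: (powR_le_inv p0); first by rewrite addr_ge0.
  by rewrite us.
have tK : 0 <= t <= K.
  rewrite t0 /=; apply: (le_trans ts).
  have : s <= c1 + 1.
    by apply: (powR_le_inv p0); rewrite ?us// addr_ge0.
  by move=> /lerD /(_ dle1) /le_trans; apply; rewrite /K -addrA.
rewrite -us -vt (le_trans (powR_lip p1 sK tK))// -/L.
apply: (@le_trans _ _ ((L + 1) * (e / (L + 1)))); last first.
  by rewrite mulrC divfK// gt_eqF.
apply: ler_pM => //; first by rewrite lerDl.
by apply: le_trans dle; rewrite ler_distl lerBlDr ts st.
Qed.

Lemma eps_div_le (e m n : R) : 0 <= m -> 0 <= n -> 0 <= e -> m * (e / (m * n + 1) * n) <= e.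
Proof.
move=> m0 n0 e0; have h : 0 < m * n + 1 by rewrite ltr_wpDl// mulr_ge0.
have -> : m * (e / (m * n + 1) * n) = e * (m * n) / (m * n + 1) by ring.
by rewrite ler_pdivrMr// ler_wpM2l// lerDl.
Qed.

(** Matrix coefficients of |chi_* T|^p at elements of [E] are Gelfand transforms, again by
    polynomials chosen uniformly in chi. They form the finite-rank correction in [cut_trace]. *)
Lemma powR_elt p T T' x y : 1 <= p -> is_adjoint inner T T' ->
  exists z : A, forall chi G, is_fun_calculus (fun t => t `^ p) (abs_operator (localize_op chi T)) G ->
    chi z = dot (loc chi y) (G (loc chi x)).
Proof.
move=> p1 hT; have p0 : 0 < p by lra.
have hT' := madjoint_sym hT.
have hP : is_adjoint inner (T' \o T) (T' \o T) by move=> u v; rewrite /= hT' hT.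
have pB chi := abs_posop (localize_op_bop chi hT).
pose G chi := sval (cid (fcal_powR (pB chi) p0)).
have hG chi : is_fun_calculus (fun t => t `^ p) (abs_operator (localize_op chi T)) (G chi).
  exact: (svalP (cid (fcal_powR (pB chi) p0))).
have [z hz] : exists z : A, forall chi, chi z = dot (loc chi y) (G chi (loc chi x)).
  apply: gelfand_closure => e e0.
  pose C := rnorm y * rnorm x + 1.
  have C0 : 0 < C by rewrite ltr_wpDl// mulr_ge0 ?rnorm_ge0.
  have [r hr] := sqr_poly_approx p0 (opnorm_ge0 T) (divr_gt0 e0 C0).
  exists (inner y (mod_poly (r * 'X) (T' \o T) x)) => chi.
  have hpoly := fcal_poly (abs_operator (localize_op chi T)) ((r * 'X) \Po ('X * 'X)).
  have BB : abs_operator (localize_op chi T) \o abs_operator (localize_op chi T) =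
      localize_op chi (T' \o T).
    rewrite (localize_op_comp chi hT hT'); apply/funext => f.
    exact: (abs_sqr (localize_op_bop chi hT)).
  rewrite -dot_loc -(mod_poly_local _ _ _ hP) -BB -poly_operator_sqr -dotBr.
  apply: (le_trans (dot_cs _ _)).
  have ec0 : 0 <= e / C by rewrite ltW// divr_gt0.
  have bd := fcal_bnd_dist (pB chi) ec0 (hG chi) hpoly.
  have h1 : rnorm (G chi (loc chi x) - poly_operator ((r * 'X) \Po ('X * 'X))
      (abs_operator (localize_op chi T)) (loc chi x)) <= e / C * rnorm x.
    apply: le_trans (bd _ _) _ => [t /andP[t0 tM]|].
      rewrite horner_comp (_ : ('X * 'X).[t] = t * t); last by rewrite !hornerE.
      apply: hr; rewrite t0 (le_trans tM)//; exact: abs_local_opnorm hT.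
    by rewrite ler_wpM2l// rnorm_loc_le.
  apply: (le_trans (ler_pM (rnorm_ge0 _) (rnorm_ge0 _) (rnorm_loc_le chi y) h1)).
  exact: eps_div_le (rnorm_ge0 _) (rnorm_ge0 _) (ltW e0).
exists z => chi G' hG'; rewrite hz.
by rewrite (fcal_unique (pB chi) (hG chi) hG').
Qed.

End SchattenClass.

(** (m + 1) s (1 - s)^m and (1 - s)^(m + 1) are two terms of the binomial expansion of (s + (1 -
    s))^(m + 1) = 1. *)
Lemma mul_expr_le (R : realType) (s : R) m : 0 <= s <= 1 -> s * (1 - s) ^+ m <= m.+1%:R^-1.
Proof.
move=> /andP[s0 s1]; have t0 : 0 <= 1 - s by rewrite subr_ge0.
suff h : m.+1%:R * s * (1 - s) ^+ m + (1 - s) ^+ m.+1 <= 1.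
  rewrite -[leRHS]mulr1 ler_pdivlMl ?ltr0n// mulrA (le_trans _ h)// lerDl exprn_ge0//.
elim: m => [|m IH]; first by rewrite expr0 expr1 !mulr1 mul1r addrC subrK.
apply: le_trans IH; rewrite -subr_ge0 !exprS [_ m.+2]mulrSr [_ m.+1]mulrSr.
have x0 : 0 <= (1 - s) ^+ m by rewrite exprn_ge0.
set x := (1 - s) ^+ m in x0 *.
have -> : (m%:R + 1) * s * x + (1 - s) * x - ((m%:R + 1 + 1) * s * ((1 - s) * x) +
   (1 - s) * ((1 - s) * x)) = (m%:R + 1) * (s * s * x) by ring.
by rewrite mulr_ge0 ?addr_ge0 ?ler0n ?mulr_ge0.
Qed.

(** * Powers of 1 - P, and approximate units of finite-rank operators *)

Section Damping.
Variables (R : realType) (H : hilbertType R) (P : H -> H).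
Hypotheses (pP : posop P) (P1 : opnorm P <= 1).
Let D k := iter k (fun f => f - P f).

Lemma fcal_damp k : is_fun_calculus (fun t => (1 - t) ^+ k) P (D k).
Proof.
have hpoly j : is_fun_calculus (fun t => (1 - t) ^+ j) P (poly_operator ((1 - 'X) ^+ j) P).
  apply: fcal_ext (fcal_poly P ((1 - 'X) ^+ j)) => t _; rewrite horner_exp !hornerE//.
suff -> : D k = poly_operator ((1 - 'X) ^+ k) P by [].
have h1 x : poly_operator (1 - 'X) P x = x - P x.
  rewrite addrC poly_operatorD -scaleN1r poly_operatorZ -[X in poly_operator X]mul1r.
  rewrite poly_operatorMX -polyC1 !poly_operatorC scale1r addrC; congr (_ + _); first by rewrite scale1r.
  by rewrite rmorphN1 scaleN1r.
elim: k => [|k IH]; apply/funext => x.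
  by rewrite expr0 -polyC1 poly_operatorC scale1r.
rewrite /D iterS -/(D k) IH -h1; apply: (fcal_comp pP (hpoly 1%N) (hpoly k) (hpoly k.+1)) => t _.
by rewrite expr1 exprS.
Qed.

Let damp01 t k : 0 <= t <= opnorm P -> 0 <= (1 - t) ^+ k <= 1.
Proof.
move=> /andP[t0 tP]; have t1 : 0 <= 1 - t by rewrite subr_ge0 (le_trans tP).
by rewrite exprn_ge0//= exprn_ile1// gerBl.
Qed.

Lemma damp_bnd k : bnd 1 (D k).
Proof.
apply: (fcal_bnd pP ler01 (fcal_damp k)) => t /(@damp01 _ k)/andP[h0 h1].
by rewrite ger0_norm.
Qed.

(* [|D v|^4 = |<v, D D v>|^2 <= c <D v, P (1 - P)^(2k) D v>], and [s (1 - s)^(2k)] is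
   at most [1 / (k + 1)] on [[0, 1]]. *)
Lemma damp_small k v (c : R) : 0 <= c ->
  (forall z, cabs (dot v z) ^+ 2 <= c * complex.Re (dot z (P z))) ->
  rnorm (D k v) ^+ 2 <= c / k.+1%:R.
Proof.
move=> c0 hv; have aD := fcal_adj pP (fcal_damp k).
pose w := D k v; rewrite -/w.
have hX := fcal_poly P ('X * (1 - 'X) ^+ (k + k)).
pose K := poly_operator ('X * (1 - 'X) ^+ (k + k)) P.
have hK : is_fun_calculus (fun t => t * (1 - t) ^+ (k + k)) P K.
  by apply: fcal_ext hX => t _; rewrite !(hornerE, horner_exp).
have hP2 : is_fun_calculus (fun t => t * (1 - t) ^+ k) P (P \o D k).
  have hY := fcal_poly P ('X * (1 - 'X) ^+ k).
  rewrite (_ : P \o D k = poly_operator ('X * (1 - 'X) ^+ k) P).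
    by apply: fcal_ext hY => t _; rewrite !(hornerE, horner_exp).
  apply/funext => x /=; apply: (fcal_comp pP (fcal_id _) (fcal_damp k) hY) => t _.
  by rewrite !(hornerE, horner_exp).
have KE z : dot (D k z) (P (D k z)) = dot z (K z).
  by apply: (fcal_mul pP (fcal_damp k) hP2 hK) => t _; rewrite exprD; ring.
have bK : bnd k.+1%:R^-1 K.
  apply: (fcal_bnd pP _ hK) => [|t ht]; first by rewrite invr_ge0 ler0n.
  have /andP[d0 _] := @damp01 t (k + k) ht; case/andP: ht => t0 tP.
  have t1 := le_trans tP P1.
  rewrite ger0_norm ?mulr_ge0// (le_trans (mul_expr_le _ _)) ?t0//.
  by rewrite lef_pV2 ?posrE ?ltr0n// ler_nat ltnS leq_addr.
have h4 : (rnorm w ^+ 2) ^+ 2 <= c / k.+1%:R * rnorm w ^+ 2.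
  have E : dot v (D k w) = (rnorm w ^+ 2)%:C%C by rewrite -aD dotxx.
  have := hv (D k w); rewrite E cabsR ger0_norm ?sqr_ge0// KE => /le_trans; apply.
  rewrite -mulrA ler_wpM2l// (le_trans (ler_norm _))// (le_trans (Re_le_cabs _))//.
  rewrite (le_trans (dot_cs _ _))// [rnorm w ^+ 2]expr2 mulrCA.
  by rewrite ler_wpM2l ?rnorm_ge0.
have [w0|wn0] := eqVneq (rnorm w) 0; first by rewrite w0 expr0n divr_ge0.
have wp : 0 < rnorm w ^+ 2 by rewrite exprn_gt0// lt_def wn0 rnorm_ge0.
by rewrite -(ler_pM2r wp) -expr2.
Qed.

End Damping.

Section ApproximateUnit.
Variables (R : realType) (A : commCStarType R) (E : hilbertModType A).
Implicit Types (x y z w : E) (chi : character A) (g : nat -> E).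
Local Notation loc chi := (localize chi : E -> localization E chi).

Lemma localize_op_id chi : localize_op chi (fun x : E => x) = id.
Proof.
have h : is_adjoint inner (fun x : E => x) (fun x => x) by move=> x y.
apply: bop_loc_ext (localize_op_bop chi h) (bop_id _) _ => x.
exact: localize_op_loc h.
Qed.

Lemma sum_rnorm_le (H : hilbertType R) (D : H -> H) n (a : 'I_n -> R[i]) (v : 'I_n -> H)
    (b : 'I_n -> R) (d : R) : is_adjoint dot D D -> (forall i, cabs (a i) <= b i) ->
  (forall i, rnorm (D (v i)) <= d) -> rnorm (D (\sum_i a i *: v i)) <= (\sum_i b i) * d.
Proof.
move=> hD ab hv; rewrite (adj_sum _ _ _ hD) (le_trans (rnorm_sum _ _ _))// mulr_suml.
apply: ler_sum => i _; rewrite (adjZ _ _ hD) rnormZ; apply: ler_pM => //; first exact: cabs_ge0.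
exact: rnorm_ge0.
Qed.

Lemma madj_iter (T : E -> E) i : is_adjoint inner T T -> is_adjoint inner (iter i T) (iter i T).
Proof. by move=> hT; elim: i => [|i IH] z w //; rewrite iterS hT IH -iterSr. Qed.

Lemma dot_rank1 (H : hilbertType R) (f v : H) (a : R) :
  dot f (dot v f *: (a%:C%C *: v)) = (a * cabs (dot v f) ^+ 2)%:C%C.
Proof. by rewrite !dotZr rmorphM /= cabs_sqr mulrCA [_^* * _]mulrC -dotC. Qed.

(** [D] is (1 - S)^j, where S is the sum of the g_i <g_i, .> divided by a number c above its norm.
    Since |<g_i, z>|^2 <= c <z, S z>, [damp_small] bounds |D g_i|^2 by c / (j + 1), with the same j
    at every character. *)
Lemma approx_unit_step g n : exists D : E -> E,
  [/\ is_adjoint inner D D, finite_rank (fun z => z - D z),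
      (forall chi, bnd 1 (localize_op chi D)) &
      forall i chi, (i < n)%N -> rnorm (localize_op chi D (loc chi (g i))) <= n.+1%:R^-1].
Proof.
pose G z := \sum_(i < n) act (g i) (inner (g i) z).
have hG : is_adjoint inner G G.
  move=> z w; rewrite /G inner_suml inner_sumr; apply: eq_bigr => i _.
  by rewrite inner_actl inner_act -innerC.
pose c := opnorm G + 1; have c0 : 0 < c by rewrite ltr_wpDl ?opnorm_ge0.
pose k : R[i] := (c^-1)%:C%C.
pose S z := k *: G z.
have hS : is_adjoint inner S S by move=> z w; rewrite innerZl innerZr hG conjR.
pose s := [seq (k *: g i, g i) | i : 'I_n].
have Ss z : S z = \sum_(u <- s) act u.1 (inner u.2 z).
  rewrite /S /G scaler_sumr /s big_image /=; apply: eq_bigr => i _.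
  by rewrite actZl.
have Sn : opnorm S <= 1.
  apply: opnorm_le => // z; rewrite rnormZ cabsR ger0_norm ?invr_ge0 ?(ltW c0)// mul1r.
  rewrite ler_pdivrMl// (le_trans (madj_opnorm hG z))// ler_wpM2r ?rnorm_ge0//.
  by rewrite lerDl.
have SE chi f : dot f (localize_op chi S f) =
    (c^-1 * \sum_(i < n) cabs (dot (loc chi (g i)) f) ^+ 2)%:C%C.
  rewrite (finite_rank_local hS Ss) dot_sumr /s big_image /= mulr_sumr rmorph_sum /=.
  apply: eq_bigr => i _; rewrite /= locZ; exact: dot_rank1.
have pS chi : posop (localize_op chi S).
  split; [exact: (localize_op_bop chi hS)|move=> f].
  rewrite SE ler0c mulr_ge0 ?invr_ge0 ?(ltW c0)// sumr_ge0// => i _.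
  exact: sqr_ge0.
have S1 chi : opnorm (localize_op chi S) <= 1.
  apply: le_trans Sn; apply: opnorm_le (opnorm_ge0 S) _.
  exact: localize_op_opnorm hS.
have m0 : 0 < n.+1%:R^-1 ^+ 2 / c by rewrite divr_gt0// exprn_gt0// invr_gt0 ltr0n.
have [j /(_ j (leqnn j)) hj] := natSinv_lt m0.
have hB : is_adjoint inner (fun z => z - S z) (fun z => z - S z).
  by apply: madjointB hS => z w.
have hD i : is_adjoint inner (iter i (fun z => z - S z)) (iter i (fun z => z - S z)).
  exact: madj_iter hB.
have locD chi i : localize_op chi (iter i (fun z => z - S z)) =
    iter i (fun f => f - localize_op chi S f).
  elim: i => [|i IH]; first exact: localize_op_id.
  rewrite (_ : iter i.+1 (fun z => z - S z) = (fun z => z - S z) \o iter i (fun z => z - S z))//.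
  rewrite (localize_op_comp chi (hD i) hB) IH; apply/funext => f /=.
  have hI : is_adjoint inner (fun z : E => z) (fun z => z) by move=> z w.
  by rewrite (localize_opB chi hI hS) localize_op_id.
exists (iter j (fun z => z - S z)); split; first exact: hD.
- elim: j {hj} => [|j IH].
    by exists [::] => z; rewrite big_nil subrr.
  have fS : finite_rank S by exists s.
  have := finite_rank_lin 1 IH (finite_rank_compr (hD j) fS).
  by congr finite_rank; apply/funext => z; rewrite /= scale1r opprD opprK addrA.
- by move=> chi; rewrite locD; exact: damp_bnd (pS chi) (S1 chi) j.
move=> i chi ni; rewrite locD.
suff h : rnorm (iter j (fun f => f - localize_op chi S f) (loc chi (g i))) ^+ 2 <= n.+1%:R^-1 ^+ 2.
  by move: h; rewrite ler_pXn2r// nnegrE ?rnorm_ge0// invr_ge0 ler0n.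
have := damp_small (pS chi) (S1 chi) j (v := loc chi (g i)) (ltW c0).
move=> /(_ _)/le_trans; apply.
  move=> f; rewrite SE /= mulVKf ?gt_eqF//.
  rewrite (bigD1 (Ordinal ni))//= lerDl sumr_ge0// => l _; exact: sqr_ge0.
by rewrite mulrC -ler_pdivlMr// ltW.
Qed.

(** The approximate unit proper consists of the operators 1 - D n; the complements D n tend to 0,
    uniformly in chi at each element of [E]. *)
Definition approximate_unit (D : nat -> E -> E) :=
  [/\ forall n, is_adjoint inner (D n) (D n), forall n, finite_rank (fun z => z - D n z),
      forall n chi, bnd 1 (localize_op chi (D n)) &
      forall x (e : R), 0 < e -> exists N, forall n, (N <= n)%N -> forall chi,
        rnorm (localize_op chi (D n) (loc chi x)) <= e].

Lemma approximate_unit_exists : countably_generated E -> exists D, approximate_unit D.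
Proof.
move=> [g hg]; have [D hD] := choice (approx_unit_step g).
exists D; split=> [n|n|n|].
- by have [] := hD n.
- by have [] := hD n.
- by have [] := hD n.
move=> x e e0; have e20 : 0 < e / 2 by rewrite divr_gt0.
have [m [a ha]] := hg x _ e20.
pose C := \sum_(i < m) rnorm (a i) + 1.
have C0 : 0 < C by rewrite ltr_wpDl// sumr_ge0// => i _; exact: rnorm_ge0.
have [N hN] := natSinv_lt (divr_gt0 e20 C0).
exists (maxn m N) => n; rewrite geq_max => /andP[mn Nn] chi.
have [aD _ bD sD] := hD n; have bo := localize_op_bop chi aD.
pose y := \sum_(i < m) act (g i) (a i).
have -> : loc chi x = loc chi (x - y) + loc chi y by rewrite -locD subrK.
rewrite (adjD _ _ bo.1); apply: le_trans (rnormD _ _) _.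
rewrite [e in _ <= e]splitr; apply: lerD.
  apply: le_trans (bD chi _) _; rewrite mul1r.
  exact: le_trans (rnorm_loc_le chi _) (ltW ha).
have -> : loc chi y = \sum_(i < m) chi (a i) *: loc chi (g i).
  by rewrite /y loc_sum; apply: eq_bigr => i _; rewrite loc_act.
apply: le_trans (sum_rnorm_le (d := n.+1%:R^-1) bo.1 (fun i => char_le chi (a i)) _) _.
  by move=> i; apply: sD; exact: leq_trans mn.
have /ltW := hN n Nn; rewrite ler_pdivlMr// mulrC; apply: le_trans.
by rewrite ler_wpM2r ?invr_ge0 ?ler0n// lerDl.
Qed.

Lemma approximate_unit_strong D chi f (e : R) : approximate_unit D -> 0 < e ->
  exists N, forall n, (N <= n)%N -> rnorm (localize_op chi (D n) f) <= e.
Proof.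
move=> [hD _ bD sD] e0; have e20 : 0 < e / 2 by rewrite divr_gt0.
have [x hx] := loc_dense f e20; have [N hN] := sD x _ e20.
exists N => n /hN/(_ chi) h.
rewrite -[f](subrK (loc chi x)) (adjD _ _ (localize_op_bop chi (hD n)).1).
apply: le_trans (rnormD _ _) _; rewrite [e in _ <= e]splitr; apply: lerD h.
by apply: le_trans (bD n chi _) _; rewrite mul1r.
Qed.

End ApproximateUnit.

Lemma cut_sum_le (R : realType) (H : hilbertType R) (D D' F : H -> H) (k : R) (s : seq H) :
  (forall x, rnorm (D (F x)) <= rnorm (D' (F x)) + k * rnorm (F x)) ->
  \sum_(x <- s) rnorm (D (F x)) ^+ 2 <=
    2 * \sum_(x <- s) rnorm (D' (F x)) ^+ 2 + 2 * k ^+ 2 * \sum_(x <- s) rnorm (F x) ^+ 2.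
Proof.
move=> h; rewrite !mulr_sumr -big_split; apply: ler_sum => x _ /=.
have := h x; move: (rnorm_ge0 (D (F x))); set a := rnorm (D _); set b := rnorm (D' _).
set c := rnorm (F x); have b0 : 0 <= b := rnorm_ge0 _.
move=> a0 /(fun h => ler_pM a0 a0 h h); rewrite -!expr2 => /le_trans; apply.
by rewrite -subr_ge0; have := sqr_ge0 (b - k * c); congr (0 <= _); ring.
Qed.

Lemma contraction_sum_le (R : realType) (H : hilbertType R) (D F : H -> H) (s : seq H) : bnd 1 D ->
  \sum_(x <- s) rnorm (D (F x)) ^+ 2 <= \sum_(x <- s) rnorm (F x) ^+ 2.
Proof.
move=> D1; apply: ler_sum => x _; rewrite ler_pXn2r ?nnegrE ?rnorm_ge0//.
by have := D1 (F x); rewrite mul1r.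
Qed.

Lemma cut_const (R : realType) (p c e : R) : 0 < e -> 1 <= p -> exists2 d, 0 < d &
  (if p < 2 then c `^ (1 - p / 2) * d else d `^ (2 / p)) <= e.
Proof.
move=> e0 p1; have p0 : 0 < p by lra.
case: ltP => _.
  have h : 0 < c `^ (1 - p / 2) + 1 by rewrite ltr_wpDl ?powR_ge0.
  exists (e / (c `^ (1 - p / 2) + 1)); first by rewrite divr_gt0.
  by rewrite mulrA ler_pdivrMr// mulrC ler_wpM2l ?(ltW e0)// lerDl.
exists (e `^ (p / 2)); first by rewrite powR_gt0.
by rewrite -powRrM (_ : p / 2 * (2 / p) = 1) ?powRr1 ?(ltW e0)//; field; rewrite gt_eqF.
Qed.

(** The budget for d^2: the first term takes 2 (1/4 + 1/8) = 3/4 of it, and the second at most 1/4,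
    as 8 K <= 9 (K + 1)^2. *)
Lemma cut_contra (R : realType) (d K u g a1 a2 a3 : R) : 0 <= K -> 0 <= a3 -> a3 <= u -> u <= K ->
  a2 <= g -> g <= d ^+ 2 / 4 + d ^+ 2 / 8 ->
  a1 <= 2 * a2 + 2 * (d / (3 * (K + 1))) ^+ 2 * a3 -> d ^+ 2 < a1 -> False.
Proof.
move=> K0 a30 au uK ag hg h1 lt.
have k2 : 2 * (d / (3 * (K + 1))) ^+ 2 * a3 <= d ^+ 2 / 4.
  have aK : a3 <= K by exact: le_trans uK.
  have K1 : 0 < K + 1 by rewrite ltr_wpDl.
  rewrite -subr_ge0 (_ : _ - _ = d ^+ 2 * (9 * (K + 1) ^+ 2 - 8 * a3) / (36 * (K + 1) ^+ 2)).
    apply: divr_ge0; last by rewrite mulr_ge0// sqr_ge0.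
    by apply: mulr_ge0; [exact: sqr_ge0|nra].
  by field; rewrite gt_eqF.
by move: lt; rewrite ltNge => /negP; apply; apply: le_trans h1 _; lra.
Qed.

(** * Finite-rank approximation of Schatten operators *)

Section FiniteRankApproximation.
Variables (R : realType) (A : commCStarType R) (E : hilbertModType A).
Implicit Types (x y z w : E) (chi : character A) (T F : E -> E).
Local Notation loc chi := (localize chi : E -> localization E chi).

(** Convergence at the finitely many vectors that span the range becomes convergence in norm,
    uniformly in chi because the coefficients <b_i, f> are at most |b_i| |f|. *)
Lemma approximate_unit_rank D F F' (e : R) : approximate_unit D -> finite_rank F ->
  is_adjoint inner F F' -> 0 < e -> exists N, forall n, (N <= n)%N -> forall chi,
  bnd e (localize_op chi (D n) \o localize_op chi F).
Proof.
move=> [hD _ _ sD] [s hs] hF e0; pose m := size s.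
pose a (i : 'I_m) := (tnth (in_tuple s) i).1; pose b (i : 'I_m) := (tnth (in_tuple s) i).2.
have FE chi f : localize_op chi F f = \sum_i dot (loc chi (b i)) f *: loc chi (a i).
  by rewrite (finite_rank_local hF hs) big_tnth.
pose C := \sum_i rnorm (b i) + 1.
have C0 : 0 < C by rewrite ltr_wpDl// sumr_ge0// => i _; exact: rnorm_ge0.
have [N hN] := choice (fun i => sD (a i) _ (divr_gt0 e0 C0)).
exists (\max_i N i)%N => n hn chi f /=; rewrite FE.
have ab i : cabs (dot (loc chi (b i)) f) <= rnorm (b i) * rnorm f.
  apply: le_trans (dot_cs _ _) _; apply: ler_wpM2r (rnorm_loc_le _ _).
  exact: rnorm_ge0.
have Dn i : rnorm (localize_op chi (D n) (loc chi (a i))) <= e / C.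
  by apply: hN; apply: leq_trans hn; exact: leq_bigmax.
apply: le_trans (sum_rnorm_le (localize_op_bop chi (hD n)).1 ab Dn) _.
rewrite -mulr_suml mulrAC; apply: ler_wpM2r; first exact: rnorm_ge0.
by rewrite mulrA ler_pdivrMr// mulrC ler_wpM2l ?(ltW e0)// lerDl.
Qed.

(** 1 - D^2 = (1 - D) + (1 - D) D has finite rank, so [cut_trace] applies at each character, and
    [powR_elt] makes its correction term an element of [A]. *)
Lemma cut_elt p T T' D : 1 <= p -> is_adjoint inner T T' -> schatten_class E p T ->
  is_adjoint inner D D -> finite_rank (fun z => z - D z) ->
  exists z : A, forall chi Q,
    is_fun_calculus (fun t => t `^ (p / 2)) (abs_operator (localize_op chi T)) Q ->
    exists g : R, [/\ chi z = g%:C%C,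
      (forall s, sub_basis s -> \sum_(x <- s) rnorm (localize_op chi D (Q x)) ^+ 2 <= g) &
      (forall t, (forall s, sub_basis s ->
         \sum_(x <- s) rnorm (localize_op chi D (Q x)) ^+ 2 <= t) -> g <= t)].
Proof.
move=> p1 hT sT hD fD; have p0 : 0 < p by lra.
have fDD : finite_rank (fun z => z - D (D z)).
  have := finite_rank_lin 1 fD (finite_rank_compr hD fD).
  by congr finite_rank; apply/funext => z; rewrite /= scale1r addrA subrK.
have hI : is_adjoint inner (fun z : E => z) (fun z => z) by move=> z w.
have hDD : is_adjoint inner (D \o D) (D \o D) by move=> z w; rewrite /= !hD.
have [s hs] := fDD; pose m := size s.
pose a (i : 'I_m) := (tnth (in_tuple s) i).1; pose b (i : 'I_m) := (tnth (in_tuple s) i).2.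
have [f hf] := choice (fun i => powR_elt (a i) (b i) p1 hT).
have [z hz] := gelfand_real (\sum_i f i).
exists (tr_elt p T - z) => chi Q hQ.
have bT := localize_op_bop chi hT; have bD := localize_op_bop chi hD.
have pB := abs_posop bT; have [G hG] := fcal_powR pB p0.
have [u [uE u0 chiE _]] := schatten_local p1 hT sT chi.
have DD (x : localization E chi) : localize_op chi D (localize_op chi D x) =
    x - \sum_i dot (loc chi (b i)) x *: loc chi (a i).
  have := finite_rank_local (madjointB hI hDD) hs x; rewrite big_tnth => <-.
  rewrite (localize_opB chi hI hDD) localize_op_id (localize_op_comp chi hD hD) /=.
  by rewrite opprB addrC subrK.
have [h1 h2] := cut_trace p1 bT bD.1 hQ hG DD uE.
exists (u - complex.Re (\sum_i dot (loc chi (b i)) (G (loc chi (a i))))); split.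
- rewrite chiB chiE hz -rmorphB chi_sum; congr ((u - complex.Re _)%:C%C).
  by apply: eq_bigr => i _; exact: hf hG.
- exact: h1.
- exact: h2.
Qed.

Lemma cut_sum_trace p T T' chi Q : 1 <= p -> is_adjoint inner T T' -> schatten_class E p T ->
  is_fun_calculus (fun t => t `^ (p / 2)) (abs_operator (localize_op chi T)) Q ->
  exists u : R, [/\ 0 <= u, chi (tr_elt p T) = u%:C%C &
    forall s, sub_basis s -> \sum_(x <- s) rnorm (Q x) ^+ 2 <= u].
Proof.
move=> p1 hT sT hQ; have p0 : 0 < p by lra.
have bT := localize_op_bop chi hT; have [G hG] := fcal_powR (abs_posop bT) p0.
have [u [uE u0 chiE _]] := schatten_local p1 hT sT chi.
exists u; split; [exact: u0|exact: chiE|].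
(* [cut_trace] with D = 1 and an empty correction. *)
have h0 (x : localization E chi) : x = x - \sum_(i < 0) dot (0 : localization E chi) x *: 0.
  by rewrite big_ord0 subr0.
have [h _] := cut_trace p1 bT (bop_id _).1 hQ hG h0 uE.
by move=> s /h; rewrite big_ord0 subr0.
Qed.

(* Otherwise some characters [X n] violate the bound for [D n]; let [chi] be their limit
   along an ultrafilter.  Some [D m] makes [tr (D m |T|^p D m)] small at [chi], hence at
   many [X n], because this trace is the Gelfand transform of an element of [A]; and for
   large [n] the norm [|D n y|] is at most [|D m y|] up to a small error, as [1 - D m] has
   finite rank. *)
Lemma cut_uniform p T T' D (d : R) : 1 <= p -> is_adjoint inner T T' -> schatten_class E p T ->
  approximate_unit D -> 0 < d -> exists n, forall chi Q s,
    is_fun_calculus (fun t => t `^ (p / 2)) (abs_operator (localize_op chi T)) Q ->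
    sub_basis s -> \sum_(x <- s) rnorm (localize_op chi (D n) (Q x)) ^+ 2 <= d ^+ 2.
Proof.
move=> p1 hT sT aD d0; have [hD fD bD sD] := aD.
have p20 : 0 < p / 2 by lra.
have hI : is_adjoint inner (fun z : E => z) (fun z => z) by move=> z w.
apply: contrapT => bad.
have {}bad n : exists chi, exists Q s,
    [/\ is_fun_calculus (fun t => t `^ (p / 2)) (abs_operator (localize_op chi T)) Q,
        sub_basis s & d ^+ 2 < \sum_(x <- s) rnorm (localize_op chi (D n) (Q x)) ^+ 2].
  apply: contrapT => h; apply: bad; exists n => chi Q s hQ hs.
  rewrite leNgt; apply/negP => lt; apply: h.
  by exists chi, Q, s; split; [exact: hQ|exact: hs|exact: lt].
have [X hX] := choice bad.
have d20 : 0 < d ^+ 2 by rewrite exprn_gt0.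
(* D n is a contraction, so the full trace exceeds d^2 at X n as well; this is the lower bound that
   makes the limit a character. *)
have lowX n : d ^+ 2 <= cabs (X n (tr_elt p T)).
  have [Q [s [hQ hs lt]]] := hX n.
  have [u [u0 -> hu]] := cut_sum_trace p1 hT sT hQ.
  rewrite cabsR ger0_norm//; apply: le_trans (ltW lt) _; apply: le_trans (hu s hs).
  exact: contraction_sum_le (bD n (X n)).
have [U [chi [PU tU hU]]] := char_ultralimit d20 lowX.
have [z hz] := choice (fun n => cut_elt p1 hT sT (hD n) (fD n)).
have bT := localize_op_bop chi hT.
have [Q hQ] := fcal_powR (abs_posop bT) p20.
have [u0 [uE _ _ _]] := schatten_local p1 hT sT chi.
have d40 : 0 < d ^+ 2 / 4 by rewrite divr_gt0.
have [xs [dl [dl0 hxs]]] := cut_small p1 bT hQ uE d40.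
have [m hm] : exists m, forall v, v \in xs -> rnorm (localize_op chi (D m) v) <= dl.
  suff [N hN] : exists N, forall n, (N <= n)%N ->
      forall v, v \in xs -> rnorm (localize_op chi (D n) v) <= dl.
    by exists N; exact: (hN N (leqnn N)).
  elim: (xs) => [|f l [N hN]]; first by exists 0%N.
  have [N' hN'] := approximate_unit_strong f aD dl0.
  exists (maxn N N') => n; rewrite geq_max => /andP[h1 h2] f1.
  by rewrite inE => /predU1P[->|/(hN n h1)]; [exact: hN'|].
have [g [chig _ gmin]] := hz m chi Q hQ.
have gle : g <= d ^+ 2 / 4 by apply: gmin => s hs; exact: hxs (bD m chi) hm s hs.
pose K := rnorm (tr_elt p T); have K0 : 0 <= K by exact: rnorm_ge0.
pose k := d / (3 * (K + 1)).
have K1 : 0 < 3 * (K + 1) by rewrite mulr_gt0// ltr_wpDl.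
have k0 : 0 < k by rewrite divr_gt0.
have [N hN] := approximate_unit_rank aD (fD m) (madjointB hI (hD m)) k0.
have d80 : 0 < d ^+ 2 / 8 by rewrite divr_gt0.
have [n [/= Nn hn]] := filter_ex (filterI (tU N) (hU (z m) _ d80)).
have [Qn [s [hQn hs lt]]] := hX n.
have [gn [chign hgn _]] := hz m (X n) Qn hQn.
have [un [un0 chiu hun]] := cut_sum_trace p1 hT sT hQn.
have unK : un <= K by have := char_le (X n) (tr_elt p T); rewrite chiu cabsR ger0_norm.
have gnle : gn <= d ^+ 2 / 4 + d ^+ 2 / 8.
  move: hn; rewrite chign chig -rmorphB cabsR => /(le_trans (ler_norm _)).
  by rewrite lerBlDl => /le_trans; apply; rewrite lerD2r.
have pt (x : localization E (X n)) : rnorm (localize_op (X n) (D n) (Qn x)) <=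
    rnorm (localize_op (X n) (D m) (Qn x)) + k * rnorm (Qn x).
  have bn := localize_op_bop (X n) (hD n); have := hN n Nn (X n) (Qn x) => /=.
  rewrite (localize_opB (X n) hI (hD m)) localize_op_id => hk.
  have := bD n (X n) (localize_op (X n) (D m) (Qn x)); rewrite mul1r => h1.
  rewrite -{1}[Qn x](subrK (localize_op (X n) (D m) (Qn x))) (adjD _ _ bn.1) addrC.
  apply: le_trans (rnormD _ _) _; exact: lerD h1 hk.
have a30 : 0 <= \sum_(v <- s) rnorm (Qn v) ^+ 2.
  by apply: sumr_ge0 => v _; exact: sqr_ge0.
exact: (cut_contra K0 a30 (hun s hs) unK (hgn s hs) gnle (cut_sum_le s pt) lt).
Qed.

Lemma schatten_approx p T T' : countably_generated E -> 1 <= p -> is_adjoint inner T T' ->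
  schatten_class E p T -> fr_approx p T.
Proof.
move=> hE p1 hT sT e e0; have p0 : 0 < p by lra.
have p20 : 0 < p / 2 by lra.
have [D aD] := approximate_unit_exists hE.
have [d d0 hd] := cut_const (pnorm p T) e0 p1.
have [n hn] := cut_uniform p1 hT sT aD d0; have [hD fD bD _] := aD.
have hI : is_adjoint inner (fun z : E => z) (fun z => z) by move=> z w.
have hF := madjointB hI (hD n).
exists (T \o (fun z => z - D n z)), ((fun z => z - D n z) \o T'); split.
- exact: finite_rank_compl hT (fD n).
- by move=> z w; rewrite /= hT hF.
move=> chi.
rewrite (_ : (fun x => T x - (T \o (fun z => z - D n z)) x) = T \o D n); last first.
  by apply/funext => x /=; rewrite (madjB hT) opprB addrC subrK.
have bT := localize_op_bop chi hT; have [Q hQ] := fcal_powR (abs_posop bT) p20.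
rewrite (localize_op_comp chi (hD n) hT).
apply: schle_mono (ltW p0) hd _; apply: (schle_cut p1 bT (localize_op_bop chi (hD n)) (bD n chi) (ltW d0) hQ).
  exact: pnorm_schle p1 hT sT.
by move=> s hs; exact: hn hQ hs.
Qed.

End FiniteRankApproximation.

(** * The Schatten class *)

Section SchattenNorm.
Variables (R : realType) (A : commCStarType R) (E : hilbertModType A).
Implicit Types (x y z w : E) (chi : character A) (T S F : E -> E) (p c d : R) (k : R[i]).

Lemma schle_opnorm p T T' c : 1 <= p -> is_adjoint inner T T' -> 0 <= c ->
  (forall chi, schle p (localize_op chi T) c) -> opnorm T <= c.
Proof.
move=> p1 hT c0 h; have p0 : 0 < p by lra.
apply: (opnorm_le_local hT c0) => chi.
exact: schle_bnd p0 (localize_op_bop chi hT).1 (h chi).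
Qed.

Lemma schle_madjoint p T T' c chi : is_adjoint inner T T' ->
  schle p (localize_op chi T) c -> schle p (localize_op chi T') c.
Proof. move=> hT; exact: schle_adj (localize_op_bop chi hT).1. Qed.

Lemma madjoint_comp T T' S S' : is_adjoint inner S S' -> is_adjoint inner T T' ->
  is_adjoint inner (S \o T) (T' \o S').
Proof. by move=> hS hT x y; rewrite /= hS hT. Qed.

Lemma schle_localZ p T T' S S' k c d chi : 1 <= p -> is_adjoint inner T T' -> is_adjoint inner S S' ->
  schle p (localize_op chi T) c -> schle p (localize_op chi S) d ->
  schle p (localize_op chi (fun x => T x + k *: S x)) (c + cabs k * d).
Proof.
move=> p1 hT hS h1 h2; rewrite (localize_op_lin chi k hT hS).
exact: schleD p1 h1 (schleZ k p1 h2).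
Qed.

Lemma fr_approx_lin p T T' S S' k : 1 <= p -> is_adjoint inner T T' -> is_adjoint inner S S' ->
  fr_approx p T -> fr_approx p S -> fr_approx p (fun x => T x + k *: S x).
Proof.
move=> p1 hT hS aT aS e e0; have e20 : 0 < e / 2 by rewrite divr_gt0.
have k0 : 0 < cabs k + 1 by rewrite ltr_wpDl// cabs_ge0.
have [F [F' [fF hF dF]]] := aT _ e20.
have [G [G' [fG hG dG]]] := aS _ (divr_gt0 e20 k0).
exists (fun x => F x + k *: G x), (fun x => F' x + k^* *: G' x); split.
- exact: finite_rank_lin.
- exact: madjoint_lin hF hG.
move=> chi; rewrite (_ : (fun x => _) = (fun x => (T x - F x) + k *: (S x - G x))).
  have := schle_localZ k p1 (madjointB hT hF) (madjointB hS hG) (dF chi) (dG chi).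
  apply: schle_mono; first lra.
  rewrite [leRHS]splitr lerD2l mulrA ler_pdivrMr// mulrC ler_wpM2l ?(ltW e20)//.
  by rewrite lerDl.
by apply/funext => x; rewrite scalerBr opprD addrACA.
Qed.

Lemma fr_approx_madjoint p T T' : is_adjoint inner T T' -> fr_approx p T -> fr_approx p T'.
Proof.
move=> hT aT e /aT[F [F' [fF hF dF]]].
have [F1 fF1 hF1] := finite_rank_adj fF.
exists F1, F; split; [exact: fF1|exact: madjoint_sym|move=> chi].
exact: schle_madjoint (madjointB hT hF1) (dF chi).
Qed.

Lemma fr_approx_limit p T T' : 1 <= p -> is_adjoint inner T T' ->
  (forall e : R, 0 < e -> exists S S', [/\ is_adjoint inner S S', fr_approx p S &
     forall chi, schle p (localize_op chi (fun x => T x - S x)) e]) -> fr_approx p T.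
Proof.
move=> p1 hT aT e e0; have e20 : 0 < e / 2 by rewrite divr_gt0.
have [S [S' [hS aS dS]]] := aT _ e20; have [F [F' [fF hF dF]]] := aS _ e20.
exists F, F'; split; [exact: fF|exact: hF|move=> chi].
have := schle_localZ 1 p1 (madjointB hT hS) (madjointB hS hF) (dS chi) (dF chi).
rewrite cabs1 mul1r -splitr; congr (schle p (localize_op chi _) e).
by apply/funext => x; rewrite scale1r addrA subrK.
Qed.

Lemma fr_approx_compl p T T' S S' : 1 <= p -> is_adjoint inner T T' -> is_adjoint inner S S' ->
  fr_approx p T -> fr_approx p (S \o T).
Proof.
move=> p1 hT hS aT e e0; have o0 : 0 < opnorm S + 1 by rewrite ltr_wpDl ?opnorm_ge0.
have [F [F' [fF hF dF]]] := aT _ (divr_gt0 e0 o0).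
exists (S \o F), (F' \o S'); split; [exact: finite_rank_compl hS fF|exact: madjoint_comp hS hF|].
move=> chi; rewrite (_ : (fun x => _) = S \o (fun x => T x - F x)); last first.
  by apply/funext => x; rewrite /= (madjB hS).
rewrite (localize_op_comp chi (madjointB hT hF) hS).
have := schle_compl p1 (opnorm_ge0 S) (localize_op_bop chi hS).1 (localize_op_opnorm hS) (dF chi).
apply: schle_mono; first lra.
by rewrite mulrA ler_pdivrMr// mulrC ler_wpM2l ?(ltW e0)// lerDl.
Qed.

Lemma hoelder_local p q r T T' S S' c d chi : 1 <= p -> 1 <= q -> 1 <= r -> p^-1 + q^-1 = r^-1 ->
  is_adjoint inner T T' -> is_adjoint inner S S' ->
  schle q (localize_op chi S) c -> schle p (localize_op chi T) d ->
  schle r (localize_op chi (S \o T)) (c * d).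
Proof.
move=> p1 q1 r1 pqr hT hS h1 h2; rewrite (localize_op_comp chi hT hS).
exact: schle_hoelder p1 q1 r1 pqr (localize_op_bop chi hS) (localize_op_bop chi hT) h1 h2.
Qed.

(** [S] times a finite-rank operator has finite rank, so approximating [T] is enough; [S] enters
    through its bound of exponent q. *)
Lemma fr_approx_hoelder p q r T T' S S' c : 1 <= p -> 1 <= q -> 1 <= r -> p^-1 + q^-1 = r^-1 ->
  is_adjoint inner T T' -> is_adjoint inner S S' -> 0 <= c ->
  (forall chi, schle q (localize_op chi S) c) -> fr_approx p T -> fr_approx r (S \o T).
Proof.
move=> p1 q1 r1 pqr hT hS c0 hc aT e e0; have c1 : 0 < c + 1 by rewrite ltr_wpDl.
have [F [F' [fF hF dF]]] := aT _ (divr_gt0 e0 c1).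
exists (S \o F), (F' \o S'); split; [exact: finite_rank_compl hS fF|exact: madjoint_comp hS hF|].
move=> chi; rewrite (_ : (fun x => _) = S \o (fun x => T x - F x)); last first.
  by apply/funext => x; rewrite /= (madjB hS).
have := hoelder_local p1 q1 r1 pqr (madjointB hT hF) hS (hc chi) (dF chi).
apply: schle_mono; first lra.
by rewrite mulrA ler_pdivrMr// mulrC ler_wpM2l ?(ltW e0)// lerDl.
Qed.

End SchattenNorm.

(** * Norm properties and completeness *)

Section SchattenBanach.
Variables (R : realType) (A : commCStarType R) (E : hilbertModType A).
Hypothesis hE : countably_generated E.
Variable p : R.
Hypothesis p1 : 1 <= p.
Let p0 : 0 < p. Proof. exact: lt_le_trans ltr01 p1. Qed.
Implicit Types (x y z w : E) (chi : character A) (T S F : E -> E) (c d : R) (k : R[i]).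

Lemma schatten_classP T T' : is_adjoint inner T T' -> schatten_class E p T <-> fr_approx p T.
Proof.
by move=> hT; split; [exact: schatten_approx hE p1 hT|exact: schatten_of_approx p1 hT].
Qed.

Lemma schatten_lin T S k : schatten_class E p T -> schatten_class E p S ->
  schatten_class E p (fun x => T x + k *: S x).
Proof.
move=> sT sS; have [[T' hT] _] := sT; have [[S' hS] _] := sS.
apply/(schatten_classP (madjoint_lin k hT hS)).
by apply: (fr_approx_lin k p1 hT hS); [exact/(schatten_classP hT)|exact/(schatten_classP hS)].
Qed.

Lemma schatten_sub T S : schatten_class E p T -> schatten_class E p S ->
  schatten_class E p (fun x => T x - S x).
Proof.
move=> sT sS; rewrite (_ : (fun x => _) = fun x => T x + (-1) *: S x).
  exact: schatten_lin.
by apply/funext => x; rewrite scaleN1r.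
Qed.

Lemma pnorm_lin T S k : schatten_class E p T -> schatten_class E p S ->
  pnorm p (fun x => T x + k *: S x) <= pnorm p T + cabs k * pnorm p S.
Proof.
move=> sT sS; have [[T' hT] _] := sT; have [[S' hS] _] := sS.
apply/(pnorm_leP p1 (madjoint_lin k hT hS) (schatten_lin k sT sS)).
  by rewrite addr_ge0 ?pnorm_ge0// mulr_ge0 ?pnorm_ge0 ?cabs_ge0.
move=> chi; have h := schle_localZ k p1 hT hS (pnorm_schle chi p1 hT sT) (pnorm_schle chi p1 hS sS).
exact: h.
Qed.

Lemma schatten0 : schatten_class E p (fun=> 0).
Proof. exact: finite_rank_schatten p1 (@finite_rank0 _ _ E). Qed.

Lemma pnorm0 : pnorm p (fun=> 0 : E) = 0.
Proof.
apply/eqP; rewrite eq_le pnorm_ge0 andbT.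
have h0 : is_adjoint inner (fun=> 0 : E) (fun=> 0).
  by move=> x y; rewrite inner0r -(scale0r 0) innerZl rmorph0 scale0r.
apply/(pnorm_leP p1 h0 schatten0 (lexx 0)) => chi.
have h := pnorm_schle chi p1 h0 schatten0.
have := localize_op_lin chi (-1) h0 h0.
rewrite (_ : (fun x => _) = (fun=> 0 : E)); last by apply/funext => x; rewrite scaler0 addr0.
move=> e0; have {}e0 f : localize_op chi (fun=> 0 : E) f = 0.
  by have := congr1 (fun Q => Q f) e0 => /= ->; rewrite scaleN1r subrr.
split=> // n u v _ _; rewrite big1 ?powR_ge0// => i _.
by rewrite e0 dot0r cabs0 powR0// gt_eqF.
Qed.

(** The inequality for k, together with the one for 1/k applied to k T, gives equality. *)
Lemma pnormZ T k : schatten_class E p T ->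
  schatten_class E p (fun x => k *: T x) /\ pnorm p (fun x => k *: T x) = cabs k * pnorm p T.
Proof.
have le S l : schatten_class E p S -> schatten_class E p (fun x => l *: S x) /\
    pnorm p (fun x => l *: S x) <= cabs l * pnorm p S.
  move=> sS; rewrite (_ : (fun x => l *: S x) = fun x => 0 + l *: S x).
    split; first exact: schatten_lin schatten0 sS.
    by rewrite -[leRHS]add0r -pnorm0; exact: pnorm_lin schatten0 sS.
  by apply/funext => x; rewrite add0r.
move=> sT; have [sk h] := le T k sT; split; first exact: sk.
apply/eqP; rewrite eq_le h /=.
have [->|k0] := eqVneq k 0; first by rewrite cabs0 mul0r pnorm_ge0.
have ck : 0 < cabs k.
  by rewrite lt_def cabs_ge0 andbT; apply: contraNneq k0 => /cabs_eq0/eqP.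
have [_] := le _ k^-1 sk.
rewrite (_ : (fun x => k^-1 *: (k *: T x)) = T); last first.
  by apply/funext => x; rewrite scalerA mulVf// scale1r.
have -> : cabs k^-1 = (cabs k)^-1.
  by apply: (mulfI (lt0r_neq0 ck)); rewrite -cabsM divff// divff ?cabs1// lt0r_neq0.
by rewrite ler_pdivlMl.
Qed.

Lemma opnorm_le_pnorm T : schatten_class E p T -> opnorm T <= pnorm p T.
Proof.
move=> sT; have [[T' hT] _] := sT; apply: (schle_opnorm p1 hT (pnorm_ge0 _ _)) => chi.
exact: pnorm_schle.
Qed.

Lemma pnorm_eq0 T : schatten_class E p T -> pnorm p T = 0 -> T = 0.
Proof.
move=> sT T0; have [[T' hT] _] := sT; have := opnorm_le_pnorm sT; rewrite T0 => h.
apply/funext => x; apply: rnorm_eq0; apply/eqP; rewrite eq_le rnorm_ge0 andbT.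
apply: le_trans (madj_opnorm hT x) _; rewrite -(mul0r (rnorm x)).
by apply: ler_wpM2r h; exact: rnorm_ge0.
Qed.

Lemma schatten_adjoint T T' : is_adjoint inner T T' -> schatten_class E p T ->
  schatten_class E p T' /\ pnorm p T' = pnorm p T.
Proof.
move=> hT sT; have hT' := madjoint_sym hT.
have sT' : schatten_class E p T'.
  exact/(schatten_classP hT')/(fr_approx_madjoint hT (iffLR (schatten_classP hT) sT)).
split; first exact: sT'.
apply/eqP; rewrite eq_le; apply/andP; split.
  apply/(pnorm_leP p1 hT' sT' (pnorm_ge0 p T)) => chi.
  exact: schle_madjoint hT (pnorm_schle chi p1 hT sT).
apply/(pnorm_leP p1 hT sT (pnorm_ge0 p T')) => chi.
exact: schle_madjoint hT' (pnorm_schle chi p1 hT' sT').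
Qed.

Lemma schatten_compl T S : adjointable E S -> schatten_class E p T ->
  schatten_class E p (S \o T) /\ pnorm p (S \o T) <= opnorm S * pnorm p T.
Proof.
move=> [S' hS] sT; have [[T' hT] _] := sT; have hST := madjoint_comp hS hT.
have sST : schatten_class E p (S \o T).
  exact/(schatten_classP hST)/(fr_approx_compl p1 hT hS (iffLR (schatten_classP hT) sT)).
split; first exact: sST.
apply/(pnorm_leP p1 hST sST) => [|chi]; first by rewrite mulr_ge0 ?opnorm_ge0 ?pnorm_ge0.
rewrite (localize_op_comp chi hT hS).
exact: schle_compl p1 (opnorm_ge0 S) (localize_op_bop chi hS).1 (localize_op_opnorm hS)
  (pnorm_schle chi p1 hT sT).
Qed.

Lemma schatten_hoelder T S q r : 1 <= q -> 1 <= r -> p^-1 + q^-1 = r^-1 ->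
  schatten_class E q S -> schatten_class E p T ->
  schatten_class E r (S \o T) /\ pnorm r (S \o T) <= pnorm q S * pnorm p T.
Proof.
move=> q1 r1 pqr sS sT; have [[T' hT] _] := sT; have [[S' hS] _] := sS.
have hST := madjoint_comp hS hT.
have sST : schatten_class E r (S \o T).
  apply: (schatten_of_approx r1 hST).
  apply: (fr_approx_hoelder p1 q1 r1 pqr hT hS (pnorm_ge0 q S) _ (iffLR (schatten_classP hT) sT)).
  by move=> chi; exact: pnorm_schle.
split; first exact: sST.
apply/(pnorm_leP r1 hST sST) => [|chi]; first by rewrite mulr_ge0 ?pnorm_ge0.
exact: hoelder_local p1 q1 r1 pqr hT hS (pnorm_schle chi q1 hS sS) (pnorm_schle chi p1 hT sT).
Qed.

Lemma schatten_norm_local T : schatten_class E p T -> forall chi, exists c,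
  [/\ schatten_norm p (localize_op chi T) = c%:E, 0 <= c, c <= pnorm p T &
      schle p (localize_op chi T) c].
Proof.
move=> sT chi; have [[T' hT] _] := sT.
have [u [uE u0 chiE hc]] := schatten_local p1 hT sT chi.
exists (u `^ p^-1); split.
- by rewrite /schatten_norm uE.
- exact: powR_ge0.
- apply: ler_powRl => //; first by rewrite invr_ge0 ltW.
  by have := char_le chi (tr_elt p T); rewrite chiE cabsR ger0_norm.
- exact: hc.
Qed.

Lemma pnorm_sup T : schatten_class E p T -> (pnorm p T)%:E =
  ereal_sup ([set 0%E] `|` range (fun chi : character A => schatten_norm p (localize_op chi T))).
Proof.
move=> sT; have [[T' hT] _] := sT; set M := ereal_sup _.
have M0 : (0 <= M)%E by apply: ereal_sup_ubound; left.
have Mle : (M <= (pnorm p T)%:E)%E.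
  apply: ge_ereal_sup => _ [->|[chi _ <-]]; first by rewrite lee_fin pnorm_ge0.
  by have [c [-> _ cp _]] := schatten_norm_local sT chi; rewrite lee_fin.
have Mchi chi : (schatten_norm p (localize_op chi T) <= M)%E.
  by apply: ereal_sup_ubound; right; exists chi.
(* M is finite, as it lies between the added 0 and the norm; the 0 also covers an empty space of
   characters. *)
move: M M0 Mle Mchi => [m| |] // m0 mle mchi; apply/eqP; rewrite eq_le mle andbT lee_fin.
rewrite lee_fin in m0.
apply/(pnorm_leP p1 hT sT m0) => chi; have := mchi chi.
have [c [-> _ _ hc]] := schatten_norm_local sT chi; rewrite lee_fin => cm.
exact: schle_mono (ltW p0) cm hc.
Qed.

Lemma uniform_limit (u : nat -> E -> E) :
  (forall e : R, 0 < e -> exists N, forall m n, (N <= m)%N -> (N <= n)%N ->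
     forall x, rnorm (u m x - u n x) <= e * rnorm x) ->
  exists2 v : E -> E, forall x, scvg (u ^~ x) (v x) &
    forall e : R, 0 < e -> exists N, forall n, (N <= n)%N ->
     forall x, rnorm (v x - u n x) <= e * rnorm x.
Proof.
move=> cu; have [x|v hv] := @choice _ _ (fun x l => scvg (u ^~ x) l).
  apply: scvg_complete => e e0; have x0 : 0 < rnorm x + 1 by rewrite ltr_wpDl ?rnorm_ge0.
  have [N hN] := cu _ (divr_gt0 e0 x0); exists N => m n Nm Nn.
  apply: le_trans (hN m n Nm Nn x) _; rewrite mulrAC ler_pdivrMr// ler_wpM2l ?(ltW e0)//.
  by rewrite lerDl.
exists v => // e e0; have [N hN] := cu e e0; exists N => n Nn x.
by apply: scvg_le (hv x) _; exists N => m Nm; exact: hN.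
Qed.

Lemma limit_adjoint (u u' : nat -> E -> E) v v' : (forall n, is_adjoint inner (u n) (u' n)) ->
  (forall x, scvg (u ^~ x) (v x)) -> (forall x, scvg (u' ^~ x) (v' x)) -> is_adjoint inner v v'.
Proof.
move=> hu hv hv' x y.
have innerl z : scvg (fun n => inner (u n x) z) (inner (v x) z).
  move=> e e0; have z0 : 0 < rnorm z + 1 by rewrite ltr_wpDl ?rnorm_ge0.
  have [N hN] := hv x _ (divr_gt0 e0 z0); exists N => n /hN h.
  rewrite -innerBl; apply: le_trans (inner_cs _ _) _.
  apply: (@le_trans _ _ (e / (rnorm z + 1) * rnorm z)).
    by apply: ler_wpM2r h; exact: rnorm_ge0.
  by rewrite mulrAC ler_pdivrMr// ler_wpM2l ?(ltW e0)// lerDl.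
apply: (scvg_unique (innerl y)) => e e0.
have x0 : 0 < rnorm x + 1 by rewrite ltr_wpDl ?rnorm_ge0.
have [N hN] := hv' y _ (divr_gt0 e0 x0); exists N => n /hN h.
rewrite hu -innerBr; apply: le_trans (inner_cs _ _) _.
apply: (@le_trans _ _ (rnorm x * (e / (rnorm x + 1)))).
  by apply: ler_wpM2l h; exact: rnorm_ge0.
by rewrite mulrA ler_pdivrMr// mulrC ler_wpM2l ?(ltW e0)// lerDl.
Qed.

(** The Schatten norm dominates the operator norm, so the sequence and its adjoints converge in norm
    and the limit is adjointable. Lower semicontinuity turns the Cauchy estimate into convergence in
    Schatten norm, and the limit inherits finite-rank approximations. *)
Lemma schatten_complete : sequentially_complete (schatten_class E p) (pnorm p).
Proof.
move=> u Lu cu; have [u' hu] := choice (fun n => (Lu n).1).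
have hB m n : is_adjoint inner (fun x => u m x - u n x) (fun x => u' m x - u' n x).
  exact: madjointB.
have cau e : 0 < e -> exists N, forall m n, (N <= m)%N -> (N <= n)%N ->
    forall chi, schle p (localize_op chi (fun x => u m x - u n x)) e.
  move=> e0; have [N hN] := cu e e0; exists N => m n Nm Nn.
  apply/(pnorm_leP p1 (hB m n) (schatten_sub (Lu m) (Lu n)) (ltW e0)).
  exact: ltW (hN m n Nm Nn).
have [|v hv vu] := @uniform_limit u.
  move=> e e0; have [N hN] := cau e e0; exists N => m n Nm Nn x.
  apply: le_trans (madj_opnorm (hB m n) x) _; apply: ler_wpM2r; first exact: rnorm_ge0.
  exact: schle_opnorm p1 (hB m n) (ltW e0) (hN m n Nm Nn).
have [|v' hv' _] := @uniform_limit u'.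
  move=> e e0; have [N hN] := cau e e0; exists N => m n Nm Nn x.
  have hB' := madjoint_sym (hB m n).
  apply: le_trans (madj_opnorm hB' x) _; apply: ler_wpM2r; first exact: rnorm_ge0.
  apply: (schle_opnorm p1 hB' (ltW e0)) => chi.
  exact: schle_madjoint (hB m n) (hN m n Nm Nn chi).
have av := limit_adjoint hu hv hv'.
have key e : 0 < e -> exists N, forall n, (N <= n)%N -> forall chi,
    schle p (localize_op chi (fun x => v x - u n x)) e.
  move=> e0; have [N hN] := cau e e0; exists N => n Nn chi.
  (* v - u n is close in norm to u m - u n with m large, which obeys the Cauchy bound. *)
  apply: schle_lsc p1 (ltW e0) _ => d d0; have [M hM] := vu d d0.
  exists (localize_op chi (fun x => u (maxn N M) x - u n x)).
    apply: schle_mono (ltW p0) _ (hN _ n (leq_maxl N M) Nn chi).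
    by rewrite lerDl ltW.
  have hvm := madjointB av (hu (maxn N M)).
  have bm : bnd d (localize_op chi (fun x => v x - u (maxn N M) x)).
    exact: bndW (opnorm_le (ltW d0) (hM _ (leq_maxr N M))) (localize_op_opnorm hvm).
  move=> f; have := bm f.
  rewrite (localize_opB chi av (hu n)) (localize_opB chi (hu (maxn N M)) (hu n)).
  rewrite (localize_opB chi av (hu (maxn N M))).
  by rewrite opprB addrA subrK.
have Lv : schatten_class E p v.
  apply: (schatten_of_approx p1 av); apply: (fr_approx_limit p1 av) => e /key[N hN].
  exists (u N), (u' N); split; [exact: hu|exact: (iffLR (schatten_classP (hu N)))|].
  exact: hN N (leqnn N).
exists v; first exact: Lv.
apply/cvgrPdist_le => e e0; have [N hN] := key e e0; exists N => // n /= Nn.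
rewrite sub0r normrN ger0_norm ?pnorm_ge0//.
apply/(pnorm_leP p1 (madjointB (hu n) av) (schatten_sub (Lu n) Lv) (ltW e0)) => chi.
rewrite (localize_opB chi (hu n) av); apply: schle_distC p1 _.
by rewrite -(localize_opB chi av (hu n)); exact: hN.
Qed.

End SchattenBanach.

Theorem theorem3p28 (R : realType) (A : commCStarType R)
    (E : hilbertModType A) (hE : countably_generated E)
    (p : R) (hp : 1 <= p) :
  [/\ normed_subspace (schatten_class E p) (pnorm p),
      (forall T : E -> E, schatten_class E p T ->
        [/\ (* the supremum is taken in [0, +oo], hence the added 0 *)
            (pnorm p T)%:E =
              ereal_sup ([set 0%E] `|`
                range (fun chi : character A =>
                         schatten_norm p (localize_op chi T))),
            schatten_class E p (adjoint inner T) /\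
              pnorm p (adjoint inner T) = pnorm p T,
            (forall S : E -> E, adjointable E S ->
              schatten_class E p (S \o T) /\
              pnorm p (S \o T) <= opnorm S * pnorm p T),
            opnorm T <= pnorm p T
          & (forall q r : R, 1 <= q -> 1 <= r -> p^-1 + q^-1 = r^-1 ->
              forall S : E -> E, schatten_class E q S ->
                schatten_class E r (S \o T) /\
                pnorm r (S \o T) <= pnorm q S * pnorm p T)])
    & sequentially_complete (schatten_class E p) (pnorm p)].
Proof.
have addE (T S : E -> E) : T + S = fun x => T x + 1 *: S x.
  by apply/funext => x; rewrite scale1r.
split.
- split; split.
  + exact: schatten0.
  + by move=> T S sT sS; rewrite addE; exact: schatten_lin.
  + by move=> k T sT; have [] := pnormZ hE hp k sT.
  + by move=> T _; exact: pnorm_ge0.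
  + by move=> T; exact: pnorm_eq0.
  + by move=> k T sT; have [] := pnormZ hE hp k sT.
  + move=> T S sT sS; rewrite addE; apply: le_trans (pnorm_lin hE hp 1 sT sS) _.
    by rewrite cabs1 mul1r.
- move=> T sT; split.
  + exact: pnorm_sup.
  + have [[T' hT] _] := sT; rewrite (adjoint_innerE hT); exact: schatten_adjoint.
  + by move=> S sS; exact: schatten_compl.
  + exact: opnorm_le_pnorm.
  + by move=> q r q1 r1 pqr S sS; exact: schatten_hoelder.
- exact: schatten_complete.
Qed.
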